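(* Let $d\ge1$ and let $\varphi_1,\varphi_2\in\mathcal{C}_0^\infty(\mathbb{R}^d)$ with $\varphi_1(0)=\varphi_2(0)=1$, $\varphi_1\ge0$, $\varphi_2\ge0$. If, for some $1\le p,q,r,s\le\infty$ and some constant $C>0$, the estimate $$\|A_a^{\varphi_1,\varphi_2}f\|_{W(L^r,L^s)}\le C\,\|a\|_{W(L^p,L^q)}\,\|f\|_{W(L^r,L^s)}\qquad\text{for all } f\in\mathcal{S}(\mathbb{R}^d),\ a\in\mathcal{S}(\mathbb{R}^{2d})$$ holds, then $$\frac1q\ge\left|\frac1r-\frac12\right|.$$
   Context: $\mathcal{C}_0^\infty$ denotes smooth compactly supported functions and $\mathcal{S}$ the Schwartz class. STFT: $V_\varphi f(x,\omega)=\int_{\mathbb{R}^d} f(t)\,\overline{\varphi(t-x)}\,e^{-2\pi i\omega t}\,dt$, $(x,\omega)\in\mathbb{R}^{2d}$. Localization operator with symbol $a$ and windows $\varphi_1,\varphi_2$: $A_a^{\varphi_1,\varphi_2}f(t)=\int_{\mathbb{R}^{2d}}a(x,\omega)V_{\varphi_1}f(x,\omega)M_\omega T_x\varphi_2(t)\,dx\,d\omega$, where $T_xf(t)=f(t-x)$, $M_\omega f(t)=e^{2\pi i\omega t}f(t)$. Wiener amalgam space: $W(L^p,L^q)(\mathbb{R}^n)$ is the space of measurable functions $f$ on $\mathbb{R}^n$ with finite norm $\|f\|_{W(L^p,L^q)}=\Big(\sum_{k\in\mathbb{Z}^n}\|f\,\chi_{k+[0,1)^n}\|_{L^p}^q\Big)^{1/q}$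 (supremum over $k$ if $q=\infty$). The norm of $a$ is taken on $\mathbb{R}^{2d}$, the others on $\mathbb{R}^d$. *)

(* Defs.v *)
From HB Require Import structures.
From mathcomp Require Import all_boot all_order all_algebra.
From mathcomp Require Import complex.
From mathcomp Require Import all_classical all_reals all_analysis.
Import Order.TTheory GRing.Theory Num.Theory.
Import numFieldNormedType.Exports.

Set Implicit Arguments.
Unset Strict Implicit.
Unset Printing Implicit Defensive.

Local Open Scope classical_set_scope.
Local Open Scope ring_scope.

(* R^n is 'rV[R]_n; its sigma-algebra is the one generated by the coordinate
   maps (the analogue of the library's structure on n.-tuple T), which is the
   Borel sigma-algebra. *)
Section measurable_rV.
Variables (R : realType) (n : nat).

Definition rV_coord (i : 'I_n) (v : 'rV[R]_n) : R := v ord0 i.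

Let rV_set0 : g_sigma_preimage rV_coord set0.
Proof. exact: sigma_algebra0. Qed.

Let rV_setC A : g_sigma_preimage rV_coord A -> g_sigma_preimage rV_coord (~` A).
Proof. exact: sigma_algebraC. Qed.

Let rV_bigcup (F : (set 'rV[R]_n)^nat) :
  (forall i, g_sigma_preimage rV_coord (F i)) ->
  g_sigma_preimage rV_coord (\bigcup_i (F i)).
Proof. exact: sigma_algebra_bigcup. Qed.

HB.instance Definition _ := @isMeasurable.Build default_measure_display
  'rV[R]_n (g_sigma_preimage rV_coord) rV_set0 rV_setC rV_bigcup.

End measurable_rV.

Section measurable_rV_lemmas.
Context d (T : measurableType d) (R : realType).

Lemma measurable_rV_coord n (i : 'I_n) :
  measurable_fun [set: 'rV[R]_n] (@rV_coord R n i).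
Proof.
move=> _ Y mY; rewrite setTI; apply: sub_sigma_algebra => /=.
rewrite -bigcup_seq/=; exists i => /=; first by rewrite mem_index_enum.
by exists Y => //; rewrite setTI.
Qed.

Lemma measurable_fun_rV n (f : T -> 'rV[R]_n) :
  (forall i, measurable_fun [set: T] (fun x => f x ord0 i)) ->
  measurable_fun [set: T] f.
Proof.
move=> mf _ Y mY; rewrite setTI.
suff : g_sigma_preimage (fun i => @rV_coord R n i \o f) `<=` measurable.
  by apply; rewrite g_sigma_preimage_comp; exists Y => //; rewrite setTI.
apply: smallest_sub; first exact: sigma_algebra_measurable.
case: n => [|n] in f mf Y mY *; first by rewrite big_ord0.
rewrite -bigcup_mkord_ord; apply: bigcup_sub => i Ii.
by move=> A [B mB <-]; exact: mf.
Qed.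

End measurable_rV_lemmas.

Section lebesgue_rV.
Variable R : realType.

(* (v, x) |-> (x, v_0, ..., v_(n-1)) *)
Definition rV_cons n (vx : 'rV[R]_n * measurableTypeR R) : 'rV[R]_n.+1 :=
  row_mx (const_mx (vx.2 : R) : 'rV[R]_1) vx.1.

Lemma measurable_rV_cons n : measurable_fun setT (@rV_cons n).
Proof.
apply: measurable_fun_rV => i; rewrite /rV_cons.
case: (@split_ordP 1 n i) => j ->.
- rewrite [X in measurable_fun _ X](_ : _ = snd); first exact: measurable_snd.
  by apply/funext => x; rewrite (row_mxEl _ _ ord0 j) mxE.
- rewrite [X in measurable_fun _ X](_ : _ = @rV_coord R n j \o fst).
    exact: (measurableT_comp (@measurable_rV_coord R n j) measurable_fst).
  by apply/funext => x; exact: (row_mxEr _ _ ord0 j).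
Qed.

Section step.
Variables (n : nat) (mu : {measure set 'rV[R]_n -> \bar R}).
Definition lebesgue_rV_step : set 'rV[R]_n.+1 -> \bar R :=
  pushforward (mu \x @lebesgue_measure R)%E (@rV_cons n).

Let step0 : lebesgue_rV_step set0 = 0%E.
Proof. by rewrite /lebesgue_rV_step /pushforward preimage_set0 measure0. Qed.

Let step_ge0 A : (0 <= lebesgue_rV_step A)%E.
Proof. by rewrite /lebesgue_rV_step /pushforward; exact: measure_ge0. Qed.

Let step_sigma_additive : semi_sigma_additive lebesgue_rV_step.
Proof.
have mcons := @measurable_rV_cons n.
move=> F mF tF mUF; rewrite /lebesgue_rV_step /pushforward preimage_bigcup.
apply: measure_semi_sigma_additive.
- by move=> k; rewrite -[X in measurable X]setTI; exact: mcons.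
- apply/trivIsetP => /= i j _ _ ij; rewrite -preimage_setI.
  by move/trivIsetP : tF => /(_ _ _ _ _ ij) ->//; rewrite preimage_set0.
- by rewrite -preimage_bigcup -[X in measurable X]setTI; exact: mcons.
Qed.

HB.instance Definition _ := isMeasure.Build _ _ _
  lebesgue_rV_step step0 step_ge0 step_sigma_additive.

End step.

(* n-dimensional Lebesgue measure: the n-fold product of the Lebesgue measure
   of R; R^0 is a point, of mass 1. *)
Fixpoint lebesgue_rV n : {measure set 'rV[R]_n -> \bar R} :=
  if n is n'.+1 then lebesgue_rV_step (lebesgue_rV n')
  else \d_(0 : 'rV[R]_0).

End lebesgue_rV.
Arguments lebesgue_rV {R} n.

Section complex_valued.
Variable R : realType.
Local Open Scope complex_scope.

(* real modulus: the norm `|z| of R[i] is itself R[i]-valued *)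
Definition modc (z : R[i]) : R := Normc.normc z.

Definition expi (x : R) : R[i] := cos x +i* sin x.

(* Only meaningful for integrable f, as Rintegral is. *)
Definition Cintegral d (T : measurableType d) (mu : {measure set T -> \bar R})
    (f : T -> R[i]) : R[i] :=
  (\int[mu]_t complex.Re (f t)) +i* (\int[mu]_t complex.Im (f t)).

End complex_valued.

Section function_classes.
Variables (R : realType) (n : nat).
Implicit Types (u : 'rV[R]_n -> R) (f : 'rV[R]_n -> R[i]).

Definition partial (i : 'I_n) u : 'rV[R]_n -> R :=
  fun x => 'D_(delta_mx ord0 i) u x.

Definition partials (s : seq 'I_n) u : 'rV[R]_n -> R := foldr partial u s.

Definition smoothR u : Prop := forall s : seq 'I_n,
  continuous (partials s u) /\
  forall i x, derivable (partials s u) x (delta_mx ord0 i).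

Definition smooth f : Prop :=
  smoothR (@complex.Re R \o f) /\ smoothR (@complex.Im R \o f).

Definition Cpartials (s : seq 'I_n) f (x : 'rV[R]_n) : R[i] :=
  (partials s (@complex.Re R \o f) x +i* partials s (@complex.Im R \o f) x)%C.

Definition monomial (alpha : 'I_n -> nat) (x : 'rV[R]_n) : R :=
  \prod_(i < n) x ord0 i ^+ alpha i.

(* s ranges over the sequences of directions of differentiation, i.e. over
   the multi-indices beta of the iterated partial derivative D^beta. *)
Definition schwartz f : Prop := smooth f /\
  forall (alpha : 'I_n -> nat) (s : seq 'I_n), exists M : R,
    forall x, `|monomial alpha x| * modc (Cpartials s f x) <= M.

Definition smooth_compact_support f : Prop :=
  smooth f /\ compact (closure [set x | f x != 0]).

End function_classes.

Section time_frequency.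
Variables (R : realType) (d : nat).
Implicit Types (f phi : 'rV[R]_d -> R[i]) (x omega t : 'rV[R]_d).
Local Open Scope complex_scope.

Definition dotrV x t : R := \sum_(i < d) x ord0 i * t ord0 i.

Definition translation x f : 'rV[R]_d -> R[i] := fun t => f (t - x).

Definition modulation omega f : 'rV[R]_d -> R[i] :=
  fun t => expi (2 * pi * dotrV omega t) * f t.

Definition STFT phi f x omega : R[i] :=
  Cintegral (lebesgue_rV d) (fun t =>
    f t * (phi (t - x))^* * expi (- (2 * pi * dotrV omega t))).

(* The phase space R^2d is 'rV[R]_(d + d), its points being row_mx x omega. *)
Definition localization_op (phi1 phi2 : 'rV[R]_d -> R[i])
    (a : 'rV[R]_(d + d) -> R[i]) f : 'rV[R]_d -> R[i] := fun t =>
  Cintegral (lebesgue_rV (d + d)) (fun z =>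
    a z * STFT phi1 f (lsubmx z) (rsubmx z) *
    modulation (rsubmx z) (translation (lsubmx z) phi2) t).

End time_frequency.

Section wiener_amalgam.
Variables (R : realType) (n : nat).
Local Open Scope ereal_scope.

(* k + [0, 1)^n *)
Definition unit_cube (k : 'rV[int]_n) : set 'rV[R]_n :=
  [set x | forall i, ((k ord0 i)%:~R <= x ord0 i < (k ord0 i)%:~R + 1)%R].

Definition cube_norm (p : \bar R) (f : 'rV[R]_n -> R[i]) (k : 'rV[int]_n) :
    \bar R :=
  Lnorm (lebesgue_rV n) p (fun x => (modc (f x) * \1_(unit_cube k) x)%:E).

(* for exponents in [1, +oo] *)
Definition amalgam_norm (p q : \bar R) (f : 'rV[R]_n -> R[i]) : \bar R :=
  if q is r%:E
  then (\esum_(k in [set: 'rV[int]_n]) (cube_norm p f k) `^ r) `^ r^-1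
  else ereal_sup (range (cube_norm p f)).

End wiener_amalgam.

(* Main.v *)
Require Import Defs.
From HB Require Import structures.
From mathcomp Require Import all_boot all_order all_algebra.
From mathcomp Require Import complex.
From mathcomp Require Import all_classical all_reals all_analysis.
From mathcomp Require Import measurable_realfun ess_sup_inf.
From mathcomp Require Import ring lra zify.
Import Order.TTheory GRing.Theory Num.Theory.
Import numFieldNormedType.Exports.

(* Idea. Let g be a bump so narrow that phi_1, phi_2 and the phases
   involved stay away from 0 on its support. For a frequency step L, test the
   estimate on
     f = (sum_(k < K) c_k e^(2 pi i k L t_0)) g(t)  and
     a = sum_(l < K) b_l g(x) g(omega - l L e_0).
   By covariance under modulations the pair (l, k) contributes to A_a f the
   term b_l c_k e^(2 pi i l L t_0) times an integral that depends only on
   (k - l) L: it is bounded below for k = l, and O(1/L) otherwise. Hence, for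
   L large, |A_a f| >= kappa |sum_k b_k c_k e^(2 pi i k L t_0)| - o(1) on the
   support of g, whereas ||a|| = O(K^(1/q)): the inequality compares norms of
   a trigonometric polynomial before and after multiplication of its
   coefficients by b. If r < 2, a peaked (de la Vallee-Poussin) f turned flat
   by Rudin-Shapiro signs gives 1/q >= 1/r - 1/2; if r > 2, a flat f focused
   into a peak gives 1/q >= 1/2 - 1/r. *)

Set Implicit Arguments.
Unset Strict Implicit.
Unset Printing Implicit Defensive.

Local Open Scope classical_set_scope.
Local Open Scope ring_scope.

(** The number [K] of terms is fixed before [L]: the bounds on the norms of [f] and [a] do not
    involve [L], whereas the at most K^2 pairs k <> l contribute O(K^2/L), so [L] can make them
    negligible. Since [g] lives in one unit cube and [L] is a natural number, the pieces of [a] lie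
    in K distinct unit cubes, whence K^(1/q).

    Only integrals of |P| and |P|^2 against [g], and suprema, of trigonometric polynomials P are
    ever estimated. For r < 2, the L^2 norm and the supremum bound the L^r norm from below; for r >
    2, the L^2 and L^1 norms do. The de la Vallee-Poussin kernel replaces the Dirichlet kernel
    because its L^1 norm stays bounded, while its coefficients are 1 on a whole block.

    With K = 4N, the peaked polynomial has L^r norm of order N^(1-1/r) and the flat one N^(1/2). So
    r < 2 gives 1/2 <= 1/q + 1 - 1/r, and r > 2 gives 1 - 1/r <= 1/q + 1/2. For r = +oo, the second
    inequality is obtained with every finite rho >= 2 in place of r, and rho tends to infinity. *)

Section integral_no_measurability.
Context d (T : measurableType d) (R : realType).
Variable mu : {measure set T -> \bar R}.

(** The integral of a nonnegative function is a supremum over the simple functions below it, hence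
    monotone for arbitrary functions. Powers of |A_a f| can thus be integrated without any study of
    the measurability of A_a f. *)
Lemma ge0_le_integral_nomeas (f g : T -> \bar R) :
  (forall x, 0 <= f x)%E -> (forall x, f x <= g x)%E ->
  (\int[mu]_x f x <= \int[mu]_x g x)%E.
Proof.
move=> f0 fg; have g0 x : (0 <= g x)%E by exact: le_trans (f0 x) (fg x).
rewrite !ge0_integralTE//; apply: ereal_sup_le => _ [h hf <-]; exists h => //.
by move=> x; exact: le_trans (hf x) (fg x).
Qed.

End integral_no_measurability.

(** * Lebesgue measure on row vectors *)

Section translation_invariance.
Variable R : realType.

Lemma measurable_addrR (a : R) :
  measurable_fun setT ((fun x => x + a) : measurableTypeR R -> measurableTypeR R).
Proof. exact: (@measurable_funD _ _ _ setT id (cst a)). Qed.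

(** By uniqueness of the measure that gives half-open intervals their length. *)
Lemma lebesgue_measure_shift (a : R) (A : set (measurableTypeR R)) : measurable A ->
  lebesgue_measure ((fun x : R => x + a) @^-1` A) = lebesgue_measure A.
Proof.
move=> mA; have ms := measurable_addrR a.
apply/esym; apply: (@lebesgue_measure_unique _
  (pushforward lebesgue_measure ((fun x => x + a) : measurableTypeR R -> measurableTypeR R)
   : {measure set _ -> \bar R})) => //.
move=> _ [[x y] _ <-] /=; rewrite /pushforward.
rewrite (_ : _ @^-1` _ = `](x - a), (y - a)]%classic); last first.
  by apply/seteqP; split=> z /=; rewrite !in_itv/= ltrBlDr lerBrDr.
rewrite !lebesgue_measure_itv/= !lte_fin ltrD2r.
by case: ifP => // _; rewrite -!EFinB; congr EFin; lra.
Qed.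

Lemma rV_cons_lshift n (x : 'rV[R]_n) (s : R) i j :
  rV_cons (x, s) i (@lshift 1 n j) = s.
Proof. by rewrite (ord1 i) /rV_cons (row_mxEl _ _ ord0 j) mxE. Qed.

Lemma rV_cons_rshift n (x : 'rV[R]_n) (s : R) i j :
  rV_cons (x, s) i (@rshift 1 n j) = x ord0 j.
Proof. by rewrite (ord1 i); exact: (row_mxEr _ _ ord0 j). Qed.

Lemma measurable_rV_addr n (v : 'rV[R]_n) :
  measurable_fun setT (fun x : 'rV[R]_n => x + v).
Proof.
apply: measurable_fun_rV => i.
rewrite (_ : (fun _ => _) = (fun x => @rV_coord R n i x + v ord0 i)).
  by apply: measurable_funD => //; exact: measurable_rV_coord.
by apply/funext => x; rewrite mxE.
Qed.

(** Induction on the dimension through sections: the section at [x] of a translated set is the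
    section at [x + w] translated by [a]. Invariance on the line removes [a], the induction
    hypothesis removes [w]. *)
Lemma lebesgue_rV_shift n (v : 'rV[R]_n) (A : set 'rV[R]_n) : measurable A ->
  lebesgue_rV n ((fun x => x + v) @^-1` A) = lebesgue_rV n A.
Proof.
elim: n v A => [|n IH] v A mA /=.
  congr (\d_ _ _); apply/seteqP; split=> x /=; rewrite (_ : x + v = x)//;
  by apply/rowP => -[].
have mB : measurable (@rV_cons R n @^-1` A).
  by rewrite -[X in measurable X]setTI; exact: (@measurable_rV_cons R n).
rewrite /lebesgue_rV_step /pushforward /product_measure1 /=.
pose w : 'rV[R]_n := \row_i v ord0 (rshift 1 i).
pose a := v ord0 (@lshift 1 n ord0).
have consD (x : 'rV[R]_n) (s : R) : rV_cons (x, s) + v = rV_cons (x + w, s + a).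
  apply/rowP => i; rewrite mxE; case: (@split_ordP 1 n i) => j ->.
    by rewrite !rV_cons_lshift /a [j]ord1.
  by rewrite !rV_cons_rshift !mxE.
under eq_integral => x _.
  rewrite /= (_ : xsection _ x = (fun s : R => s + a) @^-1`
     (xsection (@rV_cons R n @^-1` A) (x + w))); last first.
    by apply/seteqP; split => s /=; rewrite /xsection/= !inE /= consD.
  rewrite lebesgue_measure_shift; last exact: measurable_xsection.
  over.
have mF := @measurable_fun_xsection _ _ _ _ R lebesgue_measure _ mB.
rewrite -[LHS](@ge0_integral_pushforward _ _ _ _ _ _ (measurable_rV_addr w) _ setT
  (fun x => lebesgue_measure (xsection (@rV_cons R n @^-1` A) x)))//.
by apply: eq_measure_integral => [|? B mB2 _]; [exact: measurable_rV_addr|exact: IH].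
Qed.

Definition box n (a : 'rV[R]_n) (w : R) : set 'rV[R]_n :=
  [set x | forall i, a ord0 i <= x ord0 i < a ord0 i + w].

Lemma measurable_box n (a : 'rV[R]_n) w : measurable (box a w).
Proof.
rewrite (_ : box a w = \bigcap_(i in [set: 'I_n])
    (@rV_coord R n i @^-1` `[a ord0 i, a ord0 i + w[%classic)); last first.
  apply/seteqP; split=> x /= xb i => [_|].
    by rewrite /= in_itv/=; exact: xb.
  by have := xb i I; rewrite /= in_itv.
apply: fin_bigcap_measurable => // i _; rewrite -[X in measurable X]setTI.
exact: measurable_rV_coord.
Qed.

Lemma lebesgue_rV_box n (a : 'rV[R]_n) w : 0 <= w ->
  lebesgue_rV n (box a w) = (w ^+ n)%:E.
Proof.
move=> w0; elim: n a => [|n IH] a /=.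
  by rewrite diracE mem_set// => -[].
rewrite /lebesgue_rV_step /pushforward.
pose b : 'rV[R]_n := \row_i a ord0 (rshift 1 i).
pose s := a ord0 (@lshift 1 n ord0).
rewrite (_ : _ @^-1` _ = box b w `*` `[s, s + w[%classic); last first.
  apply/seteqP; split=> -[x t] /=.
    move=> H; split=> [i|].
      by have := H (rshift 1 i); rewrite rV_cons_rshift mxE.
    by have := H (@lshift 1 n ord0); rewrite rV_cons_lshift in_itv.
  move=> [H1 H2] i; case: (@split_ordP 1 n i) => j ->.
    by rewrite rV_cons_lshift [j]ord1; rewrite /= in_itv in H2.
  by rewrite rV_cons_rshift; have := H1 j; rewrite mxE.
rewrite product_measure1E//; last exact: measurable_box.
rewrite IH [X in (_ * X)%E](lebesgue_measure_itv `[s, s + w[) /= lte_fin.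
case: ifPn => [_|]; first by rewrite -EFinB -EFinM exprS; congr EFin; ring.
rewrite ltrDl -leNgt => w0'; have -> : w = 0 by apply/le_anti; rewrite w0 w0'.
by rewrite mule0 expr0n.
Qed.

Lemma bigcup_box n : \bigcup_k (box (const_mx (- k%:R)) (k%:R *+ 2)) = [set: 'rV[R]_n].
Proof.
apply/seteqP; split => // x _ /=.
pose M := \sum_i `|x ord0 i| + 1.
have [k Mk] : exists k : nat, M < k%:R.
  exists (Num.bound M); apply: archi_boundP.
  by rewrite addr_ge0// sumr_ge0.
exists k => // i; rewrite !mxE.
have xM : `|x ord0 i| < M.
  rewrite /M (bigD1 i)//= -addrA ltrDl; apply: ltr_wpDl => //.
  by rewrite sumr_ge0.
have /ltr_normlP[? ?] := lt_trans xM Mk.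
by apply/andP; split; [rewrite lerNl; lra|lra].
Qed.

Lemma sigma_finite_lebesgue_rV n : sigma_finite setT (@lebesgue_rV R n).
Proof.
exists (fun k => box (const_mx (- k%:R)) (k%:R *+ 2)); first by rewrite bigcup_box.
by move=> k; split; [exact: measurable_box|rewrite lebesgue_rV_box ?ltry// mulrn_wge0].
Qed.

Lemma integrable_lebesgue_rV_shift n (v : 'rV[R]_n) (f : 'rV[R]_n -> \bar R) :
  (lebesgue_rV n).-integrable setT f ->
  (lebesgue_rV n).-integrable setT (fun x => f (x + v)).
Proof.
move=> intf; have mv := measurable_rV_addr v.
have /integrableP[mf intf1] := intf.
apply/integrableP; split; first exact: measurableT_comp mf mv.
rewrite -[X in (X < _)%E](@ge0_integral_pushforward _ _ _ _ _ _ mv (lebesgue_rV n) setT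
  (fun x => `|f x|%E))//; last exact: measurableT_comp.
by rewrite (@eq_measure_integral _ _ _ _ (lebesgue_rV n))// => A mA _; exact: lebesgue_rV_shift.
Qed.

Lemma integral_lebesgue_rV_shift n (v : 'rV[R]_n) (f : 'rV[R]_n -> \bar R) :
  (lebesgue_rV n).-integrable setT f ->
  (\int[lebesgue_rV n]_x f (x + v)%R = \int[lebesgue_rV n]_x f x)%E.
Proof.
move=> intf; have mv := measurable_rV_addr v.
rewrite -[LHS](@integral_pushforward _ _ _ _ _ _ mv (lebesgue_rV n) setT f)//.
- by apply: eq_measure_integral => A mA _; exact: lebesgue_rV_shift.
- by have /integrableP[] := intf.
- exact: integrable_lebesgue_rV_shift.
Qed.

End translation_invariance.

(** * Complex-valued integration *)

Section complex_modulus.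
Variable R : realType.
Implicit Types z w : R[i].
Local Open Scope complex_scope.

Lemma cReD z w : complex.Re (z + w) = complex.Re z + complex.Re w.
Proof. by case: z; case: w. Qed.

Lemma cImD z w : complex.Im (z + w) = complex.Im z + complex.Im w.
Proof. by case: z; case: w. Qed.

Lemma cReM z w : complex.Re (z * w) =
  complex.Re z * complex.Re w - complex.Im z * complex.Im w.
Proof. by case: z; case: w. Qed.

Lemma cImM z w : complex.Im (z * w) =
  complex.Re z * complex.Im w + complex.Im z * complex.Re w.
Proof. by case: z; case: w. Qed.

Lemma modc_ge0 z : 0 <= modc z.
Proof. by case: z => a b; exact: sqrtr_ge0. Qed.

Lemma modcM z w : modc (z * w) = modc z * modc w.
Proof. exact: Normc.normcM. Qed.

Lemma modcD z w : modc (z + w) <= modc z + modc w.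
Proof. exact: le_normcD. Qed.

Lemma modcN z : modc (- z) = modc z.
Proof. exact: normcN. Qed.

Lemma modc0 : modc 0 = 0 :> R.
Proof. exact: Normc.normc0. Qed.

Lemma modc_real (x : R) : modc x%:C = `|x|.
Proof. by rewrite /modc /= expr0n/= addr0 sqrtr_sqr. Qed.

Lemma modc_sqr z : modc z ^+ 2 = complex.Re z ^+ 2 + complex.Im z ^+ 2.
Proof. by case: z => a b; rewrite /modc /= sqr_sqrtr// addr_ge0 ?sqr_ge0. Qed.

Lemma modc_expi (x : R) : modc (expi x) = 1.
Proof. by rewrite /modc /= cos2Dsin2 sqrtr1. Qed.

Lemma Re_le_modc z : `|complex.Re z| <= modc z.
Proof.
case: z => a b; rewrite /modc/= -sqrtr_sqr ler_sqrt ?addr_ge0 ?sqr_ge0//.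
by rewrite lerDl sqr_ge0.
Qed.

Lemma Im_le_modc z : `|complex.Im z| <= modc z.
Proof.
case: z => a b; rewrite /modc/= -sqrtr_sqr ler_sqrt ?addr_ge0 ?sqr_ge0//.
by rewrite lerDr sqr_ge0.
Qed.

Lemma modc_le_ReIm z : modc z <= `|complex.Re z| + `|complex.Im z|.
Proof.
rewrite -(ler_pXn2r (_ : 0 < 2)%N)// ?nnegrE ?modc_ge0 ?addr_ge0//.
rewrite modc_sqr sqrrD !real_normK ?num_real// -addrA lerD2l lerDr.
by rewrite mulrn_wge0// mulr_ge0.
Qed.

Lemma modc_sum I (s : seq I) (P : pred I) (F : I -> R[i]) :
  modc (\sum_(i <- s | P i) F i) <= \sum_(i <- s | P i) modc (F i).
Proof.
elim/big_ind2 : _ => // [|a b c e ab ce]; first by rewrite modc0.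
exact: le_trans (modcD _ _) (lerD ab ce).
Qed.

Lemma expiD (x y : R) : expi (x + y) = expi x * expi y.
Proof. by rewrite /expi cosD sinD; simpc; congr (_ +i* _); rewrite addrC. Qed.

Lemma expi0 : expi (0 : R) = 1.
Proof. by rewrite /expi cos0 sin0. Qed.

Lemma expiMn (x : R) n : expi (x *+ n) = expi x ^+ n.
Proof.
elim: n => [|n IH]; first by rewrite mulr0n expi0 expr0.
by rewrite mulrS expiD IH exprS.
Qed.

End complex_modulus.

Section continuous_measurable.
Variable R : realType.

(** The sigma-algebra is generated by the coordinates, not by the open sets. So [f] is written as
    the pointwise limit of [f \o D k], where [D k] rounds each coordinate down to a multiple of
    1/(k+1): preimages under [f \o D k] are countable unions of boxes. *)
Lemma continuous_measurable_rV n (f : 'rV[R]_n -> R) :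
  continuous f -> measurable_fun setT f.
Proof.
move=> cf.
pose D (k : nat) (x : 'rV[R]_n) : 'rV[R]_n :=
  \row_i ((Num.floor (x ord0 i * k.+1%:R))%:~R / k.+1%:R).
have k0 k : 0 < k.+1%:R :> R by [].
have stepE k (a : R) : a / k.+1%:R + k.+1%:R^-1 = (a + 1) / k.+1%:R.
  by rewrite mulrDl mul1r.
have floorE k (x : 'rV[R]_n) i : (Num.floor (x ord0 i * k.+1%:R))%:~R / k.+1%:R
    <= x ord0 i < (Num.floor (x ord0 i * k.+1%:R))%:~R / k.+1%:R + k.+1%:R^-1.
  have /andP[] := floor_itv (x ord0 i * k.+1%:R).
  by rewrite stepE ler_pdivrMr// ltr_pdivlMr// intrD => -> ->.
apply: (@measurable_fun_cvg _ _ _ _ (fun k => f \o D k)) => [k _ Y mY|x _].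
  rewrite setTI.
  rewrite (_ : _ @^-1` _ = \bigcup_(z : 'rV[int]_n)
    (if pselect (Y (f (\row_i ((z ord0 i)%:~R / k.+1%:R)))) then
       box (\row_i ((z ord0 i)%:~R / k.+1%:R)) k.+1%:R^-1 else set0)).
    apply: countable_bigcupT_measurable => // z.
    by case: pselect => Yz /=; [exact: measurable_box|].
  apply/seteqP; split=> [x /= Yx|x [z _]].
    exists (\row_i Num.floor (x ord0 i * k.+1%:R)) => //.
    case: pselect => [Yz i|nY] /=; first by rewrite !mxE; exact: floorE.
    apply: nY; congr (Y (f _)) : Yx; apply/rowP => i; rewrite !mxE//.
  case: pselect => //= Yz xz; rewrite /= (_ : D k x = \row_i ((z ord0 i)%:~R / k.+1%:R))//.
  apply/rowP => i; rewrite !mxE; congr (_%:~R / _); apply: floor_def.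
  by have := xz i; rewrite mxE stepE ler_pdivrMr// ltr_pdivlMr// intrD.
apply: (@cvg_comp _ _ _ (fun k => D k x) f _ (nbhs x)); last exact: cf.
apply/cvg_ballP => e e0.
near=> k; split=> // i j; rewrite (ord1 i) mxE /ball/=.
have /andP[le1 lt1] := floorE k x j.
have ke : k.+1%:R^-1 < e.
  by near: k; have [N _ HN] := near_infty_natSinv_lt (PosNum e0); exists N.
rewrite ger0_norm ?subr_ge0// ltrBlDr; apply: lt_trans lt1 _.
by rewrite [ltRHS]addrC ltrD2l.
Unshelve. all: by end_near. Qed.

End continuous_measurable.

Section complex_integral.
Context d (T : measurableType d) (R : realType).
Variable mu : {measure set T -> \bar R}.
Implicit Types (f g : T -> R[i]) (u : T -> R) (A : set T) (B : R).
Local Open Scope complex_scope.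

(** Most integrands below are bounded and vanish outside a box, so this criterion leaves only their
    measurability to check. *)
Lemma integrable_le_indic u A B : measurable_fun setT u -> measurable A ->
  (mu A < +oo)%E -> (forall x, `|u x| <= B * \1_A x) ->
  mu.-integrable setT (EFin \o u).
Proof.
move=> mu_ mA Afin uB.
apply: (@le_integrable _ _ _ mu setT measurableT _ (fun x => B%:E * (\1_A x)%:E)%E).
- exact/measurable_EFinP.
- move=> x _ /=; rewrite lee_fin normrM (ger0_norm (_ : 0 <= \1_A x))//.
  by apply: le_trans (uB x) _; apply: ler_wpM2r => //; exact: ler_norm.
- apply: integrableZl => //; apply/integrableP; split.
    by apply/measurable_EFinP; exact: measurable_indic.
  under eq_integral do rewrite gee0_abs ?lee_fin//.
  by rewrite integral_indic// setIT.
Qed.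

Lemma normr_Rintegral_le_indic u A B : measurable_fun setT u -> measurable A ->
  (mu A < +oo)%E -> (forall x, `|u x| <= B * \1_A x) ->
  `|\int[mu]_x u x| <= B * fine (mu A).
Proof.
move=> mu_ mA Afin uB; have iu := integrable_le_indic mu_ mA Afin uB.
have iA : mu.-integrable setT (EFin \o (\1_A : T -> R)).
  by apply: (@integrable_le_indic _ A 1) => // x; rewrite mul1r ger0_norm.
apply: (le_trans (le_normr_Rintegral measurableT iu)).
apply: (@le_trans _ _ (\int[mu]_x (B * \1_A x))).
  apply: le_Rintegral => //; first exact: integrable_norm.
  exact: (integrableZl measurableT B iA).
rewrite RintegralZl//.
by rewrite /Rintegral/= integral_indic// setIT.
Qed.

Definition Cmeasurable f :=
  measurable_fun setT (fun x => complex.Re (f x)) /\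
  measurable_fun setT (fun x => complex.Im (f x)).

Lemma Cmeasurable_real u : measurable_fun setT u -> Cmeasurable (fun x => (u x)%:C).
Proof. by move=> mu_; split => //=; exact: measurable_cst. Qed.

Lemma Cmeasurable_expi u : measurable_fun setT u -> Cmeasurable (fun x => expi (u x)).
Proof.
move=> mu_; split => /=.
- by apply: (measurableT_comp (f := cos)) => //; apply: continuous_measurable_fun; exact: continuous_cos.
- by apply: (measurableT_comp (f := sin)) => //; apply: continuous_measurable_fun; exact: continuous_sin.
Qed.

Lemma CmeasurableM f g : Cmeasurable f -> Cmeasurable g -> Cmeasurable (fun x => f x * g x).
Proof.
move=> [f1 f2] [g1 g2]; split.
- under [X in measurable_fun _ X]eq_fun do rewrite cReM.
  by apply: measurable_funB; apply: measurable_funM.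
- under [X in measurable_fun _ X]eq_fun do rewrite cImM.
  by apply: measurable_funD; apply: measurable_funM.
Qed.

Definition Cintegrable f :=
  mu.-integrable setT (fun x => (complex.Re (f x))%:E) /\
  mu.-integrable setT (fun x => (complex.Im (f x))%:E).

Lemma Cintegrable_le_indic f A B : Cmeasurable f -> measurable A ->
  (mu A < +oo)%E -> (forall x, modc (f x) <= B * \1_A x) -> Cintegrable f.
Proof.
move=> [m1 m2] mA Afin fB; split; apply: (integrable_le_indic (A := A) (B := B)) => // x.
- exact: le_trans (Re_le_modc _) (fB x).
- exact: le_trans (Im_le_modc _) (fB x).
Qed.

(** The factor 2 comes from bounding the real and imaginary parts separately; only orders of
    magnitude matter in the sequel. *)
Lemma modc_Cintegral_le_indic f A B : Cmeasurable f -> measurable A ->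
  (mu A < +oo)%E -> (forall x, modc (f x) <= B * \1_A x) ->
  modc (Cintegral mu f) <= 2 * B * fine (mu A).
Proof.
move=> [m1 m2] mA Afin fB; apply: le_trans (modc_le_ReIm _) _ => /=.
rewrite -mulrA mulr_natl mulr2n.
apply: lerD; apply: normr_Rintegral_le_indic => // x.
- exact: le_trans (Re_le_modc _) (fB x).
- exact: le_trans (Im_le_modc _) (fB x).
Qed.

Lemma eq_Cintegral f g : f =1 g -> Cintegral mu f = Cintegral mu g.
Proof. by move=> /funext ->. Qed.

Lemma Cintegrable0 : Cintegrable (fun=> 0).
Proof. by split; exact: integrable0. Qed.

Lemma CintegrableD f g : Cintegrable f -> Cintegrable g -> Cintegrable (fun x => f x + g x).
Proof.
move=> [f1 f2] [g1 g2]; split.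
- apply: eq_integrable (integrableD measurableT f1 g1) => // x _.
  by rewrite cReD EFinD.
- apply: eq_integrable (integrableD measurableT f2 g2) => // x _.
  by rewrite cImD EFinD.
Qed.

Lemma CintegralD f g : Cintegrable f -> Cintegrable g ->
  Cintegral mu (fun x => f x + g x) = Cintegral mu f + Cintegral mu g.
Proof.
move=> [f1 f2] [g1 g2]; rewrite /Cintegral; simpc; congr (_ +i* _).
- by under eq_Rintegral do rewrite cReD; rewrite RintegralD.
- by under eq_Rintegral do rewrite cImD; rewrite RintegralD.
Qed.

Lemma Cintegrable_sum I (s : seq I) (F : I -> T -> R[i]) :
  (forall i, Cintegrable (F i)) -> Cintegrable (fun x => \sum_(i <- s) F i x).
Proof.
move=> iF; elim: s => [|i s IH].
  by under eq_fun do rewrite big_nil; exact: Cintegrable0.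
by under eq_fun do rewrite big_cons; exact: CintegrableD.
Qed.

Lemma Cintegral_sum I (s : seq I) (F : I -> T -> R[i]) :
  (forall i, Cintegrable (F i)) ->
  Cintegral mu (fun x => \sum_(i <- s) F i x) = \sum_(i <- s) Cintegral mu (F i).
Proof.
move=> iF; elim: s => [|i s IH].
  rewrite big_nil; under eq_Cintegral do rewrite big_nil.
  by rewrite /Cintegral/= /Rintegral !integral0.
rewrite big_cons -IH; under eq_Cintegral do rewrite big_cons.
by rewrite CintegralD//; exact: Cintegrable_sum.
Qed.

Lemma CintegrableZ c f : Cintegrable f -> Cintegrable (fun x => c * f x).
Proof.
move=> [f1 f2]; split.
- apply: eq_integrable (integrableB measurableT
    (integrableZl measurableT (complex.Re c) f1)
    (integrableZl measurableT (complex.Im c) f2)) => // x _.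
  by rewrite cReM EFinB !EFinM.
- apply: eq_integrable (integrableD measurableT
    (integrableZl measurableT (complex.Re c) f2)
    (integrableZl measurableT (complex.Im c) f1)) => // x _.
  by rewrite cImM EFinD !EFinM.
Qed.

Lemma CintegralZ c f : Cintegrable f ->
  Cintegral mu (fun x => c * f x) = c * Cintegral mu f.
Proof.
move=> [f1 f2]; rewrite /Cintegral; case: c => a b; simpc; congr (_ +i* _).
- under eq_Rintegral do rewrite cReM/=.
  rewrite RintegralB//; last 2 first.
    exact: (integrableZl measurableT a f1).
    exact: (integrableZl measurableT b f2).
  by rewrite !RintegralZl.
- under eq_Rintegral do rewrite cImM/=.
  rewrite RintegralD//; last 2 first.
    exact: (integrableZl measurableT a f2).
    exact: (integrableZl measurableT b f1).
  by rewrite !RintegralZl.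
Qed.

End complex_integral.

Section shift_and_boxes.
Variable R : realType.
Local Open Scope complex_scope.

Lemma Cintegral_shift n (v : 'rV[R]_n) (f : 'rV[R]_n -> R[i]) :
  Cintegrable (lebesgue_rV n) f ->
  Cintegral (lebesgue_rV n) (fun x => f (x + v)) = Cintegral (lebesgue_rV n) f.
Proof.
move=> [f1 f2]; rewrite /Cintegral /Rintegral; congr (fine _ +i* fine _).
- exact: (integral_lebesgue_rV_shift v f1).
- exact: (integral_lebesgue_rV_shift v f2).
Qed.

Lemma lebesgue_rV_box_fin n (a : 'rV[R]_n) w : 0 <= w ->
  (lebesgue_rV n (box a w) < +oo)%E.
Proof. by move=> w0; rewrite lebesgue_rV_box// ltry. Qed.

End shift_and_boxes.

(** * Smooth functions *)

Section directional_derivative.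
Variable R : realType.

(** Directional derivatives become derivatives of functions of one real variable, to which the usual
    chain rule and mean value theorem apply. *)
Lemma is_derive_lineP (V : normedModType R) (f : V -> R) x v d :
  is_derive x v f d <-> is_derive (0 : R) (1 : R) (fun h : R => f (h *: v + x)) d.
Proof.
have E : (fun h : R => h^-1 *: ((f \o shift x) (h *: v) - f x)) =
  (fun h : R => h^-1 *: (((fun h : R => f (h *: v + x)) \o shift 0) (h *: 1) - f (0 *: v + x))).
  by apply/funext => h /=; rewrite addr0 scale0r add0r [_%:A]mulr1.
by split=> -[D1 D2]; apply: DeriveDef; move: D1 D2; rewrite /derivable /derive E.
Qed.

Lemma is_derive_comp_line (V W : normedModType R) (u : W -> R) (h : V -> W) x v w c d :
  (forall t : R, h (t *: v + x) = (t * c) *: w + h x) ->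
  is_derive (h x) w u d -> is_derive x v (u \o h) (d * c).
Proof.
move=> hE du; apply: (is_derive_lineP _ _ _ _).2.
have -> : (fun t : R => (u \o h) (t *: v + x)) =
    (fun h1 : R => u (h1 *: w + h x)) \o (fun t => t * c).
  by apply/funext => t /=; rewrite hE.
apply: is_derive1_comp; first by rewrite mul0r; exact: ((is_derive_lineP _ _ _ _).1 du).
have -> : (fun t : R => t * c) = c *: (id : R -> R).
  by apply/funext => t; rewrite mulrC.
by apply: is_derive_eq; rewrite [_ *: _]mulr1.
Qed.

End directional_derivative.

Section smooth_closure.
Variable R : realType.

(** Each coordinate direction is mapped to a multiple of a single coordinate direction, so a partial
    derivative of [u \o h] is a multiple of one partial derivative of [u]: the chain rule stays
    one-dimensional. *)
Definition coord_affine m n (h : 'rV[R]_m -> 'rV[R]_n) :=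
  continuous h /\ forall i, exists c j, forall x (t : R),
    h (t *: delta_mx ord0 i + x) = (t * c) *: delta_mx ord0 j + h x.

Lemma smoothR_partial n (u : 'rV[R]_n -> R) j : smoothR u -> smoothR (partial j u).
Proof. by move=> su s; have := su (rcons s j); rewrite /partials foldr_rcons. Qed.

(** [smoothR] speaks of all iterated partial derivatives at once and does not lend itself to a
    direct induction on products. This class is stable under partial differentiation and made of
    continuous, derivable functions, so its members are smooth. *)
Inductive smgen m : ('rV[R]_m -> R) -> Prop :=
| smgen_comp n (u : 'rV[R]_n -> R) h :
    smoothR u -> coord_affine h -> smgen (fun x : 'rV[R]_m => u (h x))
| smgen_cos i c : smgen (fun x : 'rV[R]_m => cos (c * x ord0 i))
| smgen_sin i c : smgen (fun x : 'rV[R]_m => sin (c * x ord0 i))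
| smgen_cst c : smgen (fun x : 'rV[R]_m => c)
| smgen_add u v : smgen u -> smgen v -> smgen (fun x => u x + v x)
| smgen_mul u v : smgen u -> smgen v -> smgen (fun x => u x * v x).

Lemma is_derive_line_coord m (x : 'rV[R]_m) (i j : 'I_m) (c : R) :
  is_derive (0 : R) (1 : R)
    (fun t : R => c * (t *: delta_mx ord0 i + x) ord0 j) (c * (i == j)%:R).
Proof.
have -> : (fun t : R => c * (t *: delta_mx ord0 i + x) ord0 j) =
    (c * (i == j)%:R) *: (id : R -> R) + cst (c * x ord0 j).
  apply/funext => t; rewrite !mxE eqxx/= eq_sym -[RHS]/(_ * t + _).
  by rewrite mulrDr; congr (_ + _); rewrite mulrCA mulrC.
by apply: is_derive_eq; rewrite addr0 [_ *: _]mulr1.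
Qed.

Lemma is_derive_smgen m (u : 'rV[R]_m -> R) : smgen u ->
  continuous u /\ forall i, exists2 v, smgen v &
    forall x, is_derive x (delta_mx ord0 i) u (v x).
Proof.
elim=> {u}.
- move=> n u h su [ch ha]; have [cu du] := su [::]; split.
    by move=> x; apply: (@continuous_comp _ _ _ h u); [exact: ch|exact: cu].
  move=> i; have [c [j hE]] := ha i.
  exists (fun x => (partial j u) (h x) * c).
    apply: (@smgen_mul m (fun x => partial j u (h x))); last exact: smgen_cst.
    exact: (@smgen_comp m n (partial j u) h (smoothR_partial j su) (conj ch ha)).
  move=> x; apply: is_derive_comp_line (hE x) _; exact/derivableP/du.
- move=> j c; split.
    move=> x; apply: (@continuous_comp _ _ _ (fun x : 'rV[R]_m => c * x ord0 j) cos).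
      by apply: continuousM; [exact: cst_continuous|exact: coord_continuous].
    exact: continuous_cos.
  move=> i; exists (fun x => (- (c * (i == j)%:R)) * sin (c * x ord0 j)).
    exact: (smgen_mul (smgen_cst m (- (c * (i == j)%:R))) (smgen_sin j c)).
  move=> x; apply: (is_derive_lineP _ _ _ _).2.
  apply: is_derive_eq.
    apply: (@is_derive1_comp R cos) (is_derive_line_coord x i j c).
  by rewrite /= scale0r add0r; ring.
- move=> j c; split.
    move=> x; apply: (@continuous_comp _ _ _ (fun x : 'rV[R]_m => c * x ord0 j) sin).
      by apply: continuousM; [exact: cst_continuous|exact: coord_continuous].
    exact: continuous_sin.
  move=> i; exists (fun x => (c * (i == j)%:R) * cos (c * x ord0 j)).
    exact: (smgen_mul (smgen_cst m (c * (i == j)%:R)) (smgen_cos j c)).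
  move=> x; apply: (is_derive_lineP _ _ _ _).2.
  apply: is_derive_eq.
    apply: (@is_derive1_comp R sin) (is_derive_line_coord x i j c).
  by rewrite /= scale0r add0r; ring.
- move=> c; split; first exact: cst_continuous.
  by move=> i; exists (fun=> 0); [exact: smgen_cst|move=> x; exact: is_derive_cst].
- move=> u v _ [cu du] _ [cv dv]; split.
    by move=> x; apply: continuousD; [exact: cu|exact: cv].
  move=> i; have [u' su' du'] := du i; have [v' sv' dv'] := dv i.
  exists (fun x => u' x + v' x); first exact: smgen_add.
  by move=> x; exact: is_deriveD.
- move=> u v su [cu du] sv [cv dv]; split.
    by move=> x; apply: continuousM; [exact: cu|exact: cv].
  move=> i; have [u' su' du'] := du i; have [v' sv' dv'] := dv i.
  exists (fun x => u x * v' x + v x * u' x); first by apply: smgen_add; exact: smgen_mul.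
  by move=> x; exact: is_deriveM.
Qed.

Lemma smgen_smoothR m (u : 'rV[R]_m -> R) : smgen u -> smoothR u.
Proof.
move=> su s; have {}su : smgen (partials s u).
  elim: s => //= i s /is_derive_smgen[_ /(_ i)[v sv dv]].
  by rewrite (_ : partial _ _ = v)//; apply/funext => x; have [_ <-] := dv x.
have [cu du] := is_derive_smgen su; split=> // i x.
by have [v _ dv] := du i; have [] := dv x.
Qed.

Lemma smgen_sum m I (s : seq I) (F : I -> 'rV[R]_m -> R) :
  (forall i, smgen (F i)) -> smgen (fun x => \sum_(i <- s) F i x).
Proof.
move=> sF; elim: s => [|i s IH].
  by under eq_fun do rewrite big_nil; exact: smgen_cst.
by under eq_fun do rewrite big_cons; exact: smgen_add.
Qed.

End smooth_closure.

Section compact_support.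
Variables (R : realType) (n : nat).
Implicit Types (u v F : 'rV[R]_n -> R).

Definition supported u (B : R) := forall x, u x != 0 -> forall i, `|x ord0 i| <= B.

Lemma supported_bounded F B : continuous F -> supported F B ->
  exists2 M, 0 <= M & forall x, `|F x| <= M.
Proof.
move=> cF sF.
have cK : compact [set x : 'rV[R]_n | forall i, x ord0 i \in `[- B, B]].
  by apply: (@rV_compact _ _ (fun=> `[- B, B]%classic)) => i; exact: segment_compact.
have /compact_bounded[M0 [_ HM]] : compact (F @` [set x : 'rV[R]_n | forall i, x ord0 i \in `[- B, B]]).
  by apply: continuous_compact => //; exact: continuous_subspaceT.
exists (`|M0| + 1); first by rewrite addr_ge0.
move=> x; have [->|Fx0] := eqVneq (F x) 0; first by rewrite normr0 addr_ge0.
apply: (HM (`|M0| + 1)); first by rewrite (le_lt_trans (ler_norm _))// ltrDl.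
by exists x => // i; rewrite in_itv/= -ler_norml; exact: sF.
Qed.

(** Where some coordinate exceeds [B] in absolute value, [u] vanishes on a whole neighbourhood, and
    so does its derivative at the point. *)
Lemma supported_partial u B i : supported u B -> supported (partial i u) B.
Proof.
move=> su x pux j; rewrite leNgt; apply: contra_neqN pux => Bx.
suff : \near x, u x = cst 0 x by move/near_eq_derive => E; rewrite /partial E derive_cst.
have cn : (fun y : 'rV[R]_n => `|y ord0 j|) @ x --> `|x ord0 j|.
  apply: (@continuous_comp _ _ _ (fun y : 'rV[R]_n => y ord0 j) Num.norm).
    exact: coord_continuous.
  exact: norm_continuous.
near=> y.
have By : B < `|y ord0 j| by near: y; exact: (cvgr_gt _ cn).
by have [//|uy0] := eqVneq (u y) 0; have := su _ uy0 j; rewrite leNgt By.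
Unshelve. all: by end_near. Qed.

Lemma supported_partials u B s : supported u B -> supported (partials s u) B.
Proof. by move=> su; elim: s => //= i s; exact: supported_partial. Qed.

Lemma continuous_monomial (alpha : 'I_n -> nat) : continuous (@monomial R n alpha).
Proof.
rewrite /monomial => x; elim: (index_enum _) => [|i s IH].
  by under eq_fun do rewrite big_nil; exact: cst_continuous.
under eq_fun do rewrite big_cons.
apply: (@continuousM _ _ (fun x : 'rV[R]_n => x ord0 i ^+ alpha i)) => //.
apply: (@continuous_comp _ _ _ (fun x : 'rV[R]_n => x ord0 i) (fun y => y ^+ alpha i)).
  exact: coord_continuous.
exact: exprn_continuous.
Qed.

Lemma supported_schwartz u v B : smoothR u -> smoothR v ->
  supported u B -> supported v B -> schwartz (fun x => (u x +i* v x)%C).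
Proof.
move=> smu smv su sv; split; first exact: (conj smu smv).
move=> alpha s.
have bnd w : smoothR w -> supported w B ->
    exists2 M, 0 <= M & forall x, `|monomial alpha x * partials s w x| <= M.
  move=> smw sw; apply: (@supported_bounded _ B).
    move=> x; apply: continuousM; [exact: continuous_monomial|].
    by have [+ _] := smw s; exact.
  by move=> x; rewrite mulf_eq0 negb_or => /andP[_]; exact: supported_partials.
have [M1 _ H1] := bnd _ smu su; have [M2 _ H2] := bnd _ smv sv.
exists (M1 + M2) => x.
apply: (@le_trans _ _ (`|monomial alpha x| * (`|partials s u x| + `|partials s v x|))).
  by apply: ler_wpM2l => //; exact: (modc_le_ReIm (Cpartials s _ x)).
by rewrite mulrDr -!normrM; apply: lerD.
Qed.

(** Mean value theorem on the line through [x]; the partial derivative is bounded, being continuous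
    with bounded support. *)
Lemma smooth_supported_lipschitz u B i : smoothR u -> supported u B ->
  exists2 M, 0 <= M & forall x (t : R), `|u (t *: delta_mx ord0 i + x) - u x| <= M * `|t|.
Proof.
move=> smu su.
have [M M0 HM] : exists2 M, 0 <= M & forall x, `|partial i u x| <= M.
  apply: (@supported_bounded _ B); last exact: supported_partial.
  by have [+ _] := smu [:: i].
exists M => // x t.
pose F (h : R) := u (h *: delta_mx ord0 i + x).
have dF h : is_derive h (1 : R) F (partial i u (h *: delta_mx ord0 i + x)).
  have [_ du] := smu [::].
  have /derivableP D := du i (h *: delta_mx ord0 i + x).
  apply: (is_derive_lineP _ _ _ _).2.
  rewrite (_ : (fun s : R => _) =
    (fun s : R => u (s *: delta_mx ord0 i + (h *: delta_mx ord0 i + x)))); last first.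
    by apply/funext => s; rewrite /F addrA -scalerDl [_%:A]mulr1.
  exact: ((is_derive_lineP _ _ _ _).1 D).
have cF : continuous F.
  by move=> h; apply: differentiable_continuous; apply/derivable1_diffP; have [] := dF h.
have lip (a b : R) : a <= b -> `|F b - F a| <= M * (b - a).
  move=> ab; have [c _ ->] := MVT_segment ab (fun x _ => dF x) (continuous_subspaceT cF).
  by rewrite normrM (ger0_norm (_ : 0 <= b - a)) ?subr_ge0// ler_wpM2r ?subr_ge0.
have -> : u x = F 0 by rewrite /F scale0r add0r.
rewrite -/(F t); have [t0|/ltW t0] := leP 0 t.
  by rewrite (ger0_norm t0) -[X in M * X]subr0; exact: lip.
by rewrite (ler0_norm t0) distrC -[X in M * X]add0r; exact: lip.
Qed.

Lemma compact_supported (f : 'rV[R]_n -> R[i]) : compact (closure [set x | f x != 0]) ->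
  exists2 B, 0 <= B & forall x, f x != 0 -> forall i, `|x ord0 i| <= B.
Proof.
move=> /compact_bounded[M [_ HM]]; exists (`|M| + 1); first by rewrite addr_ge0.
move=> x fx i.
have : `|x| <= `|M| + 1.
  apply: HM; first by rewrite (le_lt_trans (ler_norm _))// ltrDl.
  exact: subset_closure.
apply: le_trans; rewrite [leRHS]/Num.norm /= mx_normrE.
by apply/bigmax_geP; right => /=; exists (ord0, i).
Qed.

End compact_support.

(** * Measurability of parametric integrals, and Fourier decay *)

Section measurable_rV_functions.
Variable R : realType.
Context d (T : measurableType d).

Lemma measurable_rVB n (f g : T -> 'rV[R]_n) :
  measurable_fun setT f -> measurable_fun setT g ->
  measurable_fun setT (fun x => f x - g x).
Proof.
move=> mf mg; apply: measurable_fun_rV => i.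
under [X in measurable_fun _ X]eq_fun do rewrite !mxE.
by apply: measurable_funB; [exact: (measurableT_comp (@measurable_rV_coord R n i) mf)
  |exact: (measurableT_comp (@measurable_rV_coord R n i) mg)].
Qed.

Lemma measurable_lsubmx m n (f : T -> 'rV[R]_(m + n)) :
  measurable_fun setT f -> measurable_fun setT (fun x => lsubmx (f x)).
Proof.
move=> mf; apply: measurable_fun_rV => i.
under [X in measurable_fun _ X]eq_fun do rewrite mxE.
exact: (measurableT_comp (@measurable_rV_coord R _ (lshift n i)) mf).
Qed.

Lemma measurable_rsubmx m n (f : T -> 'rV[R]_(m + n)) :
  measurable_fun setT f -> measurable_fun setT (fun x => rsubmx (f x)).
Proof.
move=> mf; apply: measurable_fun_rV => i.
under [X in measurable_fun _ X]eq_fun do rewrite mxE.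
exact: (measurableT_comp (@measurable_rV_coord R _ (rshift m i)) mf).
Qed.

Lemma measurable_dotrV n (f g : T -> 'rV[R]_n) :
  measurable_fun setT f -> measurable_fun setT g ->
  measurable_fun setT (fun x => dotrV (f x) (g x)).
Proof.
move=> mf mg; apply: measurable_sum => i; apply: measurable_funM.
  exact: (measurableT_comp (@measurable_rV_coord R n i) mf).
exact: (measurableT_comp (@measurable_rV_coord R n i) mg).
Qed.

End measurable_rV_functions.

(** Applied to the integral in the STFT, to obtain measurability in time and frequency jointly.
    Tonelli's theorem provides it for the positive and negative parts. *)
Lemma measurable_fun_Rintegral d1 d2 (T1 : measurableType d1) (T2 : measurableType d2)
  (R : realType) (m : {measure set T2 -> \bar R}) (f : T1 * T2 -> R) :
  sigma_finite setT m -> measurable_fun setT f ->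
  measurable_fun setT (fun x => \int[m]_y f (x, y)).
Proof.
move=> sfm mf.
(* Sigma-finiteness is a hypothesis on [m] here, not part of its structure, so the structure that
   Tonelli's theorem expects is packed locally. *)
pose msf : isSigmaFinite _ _ _ m := isSigmaFinite.Build _ _ _ m sfm.
pose msft : isSFinite _ _ _ m := isSFinite.Build _ _ _ m (sfinite_measure_sigma_finite sfm).
pose m2 : {sigma_finite_measure set T2 -> \bar R} := HB.pack (m : set T2 -> \bar R) (Measure.on m) msft msf.
apply: (@measurableT_comp _ _ _ _ _ _ fine); first exact: fine_measurable.
under [X in measurable_fun _ X]eq_fun do rewrite (@eq_measure_integral _ _ _ _ m2)// integralE.
have mE : measurable_fun setT (EFin \o f) by exact/measurable_EFinP.
apply: emeasurable_funB.
- rewrite [X in measurable_fun _ X](_ : _ = fubini_F m2 ((EFin \o f)^\+)%E).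
    exact: measurable_fun_fubini_tonelli_F (measurable_funepos mE) (funepos_ge0 _).
  by apply/funext => x; rewrite -[LHS]/(\int[m2]_y ((EFin \o f \o pair x)^\+ y))%E funepos_comp.
- rewrite [X in measurable_fun _ X](_ : _ = fubini_F m2 ((EFin \o f)^\-)%E).
    exact: measurable_fun_fubini_tonelli_F (measurable_funeneg mE) (funeneg_ge0 _).
  by apply/funext => x; rewrite -[LHS]/(\int[m2]_y ((EFin \o f \o pair x)^\- y))%E funeneg_comp.
Qed.

Lemma measurable_fun_Cintegral d1 d2 (T1 : measurableType d1) (T2 : measurableType d2)
  (R : realType) (m : {measure set T2 -> \bar R}) (f : T1 * T2 -> R[i]) :
  sigma_finite setT m -> Cmeasurable f ->
  Cmeasurable (fun x => Cintegral m (fun y => f (x, y))).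
Proof.
by move=> sfm [f1 f2]; split; [exact: (measurable_fun_Rintegral sfm f1)
  |exact: (measurable_fun_Rintegral sfm f2)].
Qed.

Section fourier_decay.
Variables (R : realType) (n : nat).
Local Open Scope complex_scope.
Local Notation e0 := (delta_mx ord0 ord0 : 'rV[R]_n.+1).
Implicit Types (x u w t : 'rV[R]_n.+1).

Definition wave w u : R[i] := expi (- (2 * pi * dotrV w u)).

Lemma dotrVDl m (x y t : 'rV[R]_m) : dotrV (x + y) t = dotrV x t + dotrV y t.
Proof. by rewrite /dotrV -big_split/=; apply: eq_bigr => i _; rewrite mxE mulrDl. Qed.

Lemma dotrVDr m (x y t : 'rV[R]_m) : dotrV t (x + y) = dotrV t x + dotrV t y.
Proof. by rewrite /dotrV -big_split/=; apply: eq_bigr => i _; rewrite mxE mulrDr. Qed.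

Lemma dotrV_e0l (c : R) t : dotrV (c *: e0) t = c * t ord0 ord0.
Proof.
rewrite /dotrV (bigD1 ord0)//= big1 ?addr0 ?mxE ?eqxx ?mulr1// => i i0.
by rewrite !mxE eqxx (negPf i0) mulr0 mul0r.
Qed.

Lemma dotrV_e0r (c : R) t : dotrV t (c *: e0) = t ord0 ord0 * c.
Proof.
rewrite /dotrV (bigD1 ord0)//= big1 ?addr0 ?mxE ?eqxx ?mulr1// => i i0.
by rewrite !mxE eqxx (negPf i0) !mulr0.
Qed.

Lemma expi_Npi : expi (- pi) = -1 :> R[i].
Proof. by rewrite /expi cosN sinN cospi sinpi oppr0; apply/eqP; rewrite eq_complex/= oppr0 !eqxx. Qed.

Lemma Cmeasurable_wave d (T : measurableType d) (f g : T -> 'rV[R]_n.+1) :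
  measurable_fun setT f -> measurable_fun setT g ->
  Cmeasurable (fun y => wave (f y) (g y)).
Proof.
move=> mf mg; apply: Cmeasurable_expi; apply: measurable_funN.
by apply: measurable_funM => //; exact: measurable_dotrV.
Qed.

Lemma modc_wave w u : modc (wave w u) = 1.
Proof. exact: modc_expi. Qed.

(* Translating by half a period of the wave flips its sign, so twice the
   integral is the integral of a difference of F. *)
Lemma fourier_decay (F : 'rV[R]_n.+1 -> R) B L w : measurable_fun setT F ->
  (forall x, `|F x| <= B * \1_(box 0 1) x) -> 0 <= L ->
  (forall x (s : R), `|F (s *: e0 + x) - F x| <= L * `|s|) ->
  1 <= `|w ord0 ord0| ->
  modc (Cintegral (lebesgue_rV n.+1) (fun u => (F u)%:C * wave w u))
    <= L * 3 ^+ n.+1 / `|w ord0 ord0|.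
Proof.
move=> mF FB L0 lipF w1; set w0 := w ord0 ord0 in w1 *.
have w0n : w0 != 0 by rewrite -normr_gt0 (lt_le_trans _ w1).
pose s : R := (2 * w0)^-1.
have sn : `|s| = (2 * `|w0|)^-1 by rewrite /s normfV normrM ger0_norm.
have s1 : `|s| <= 1.
  by rewrite sn invf_le1 ?mulr_gt0 ?(lt_le_trans _ w1)//; lra.
pose G u := (F u)%:C * wave w u.
have mW : Cmeasurable (wave w) by apply: Cmeasurable_wave.
have mG : Cmeasurable G by apply: CmeasurableM => //; exact: Cmeasurable_real.
have iG : Cintegrable (lebesgue_rV n.+1) G.
  apply: (@Cintegrable_le_indic _ _ _ _ _ (box 0 1) B) => //; [exact: measurable_box|exact: lebesgue_rV_box_fin|].
  by move=> x; rewrite modcM modc_wave mulr1 modc_real.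
have GE u : G (u + s *: e0) = - ((F (u + s *: e0))%:C * wave w u).
  rewrite /G /wave dotrVDr dotrV_e0r -/w0 mulrDr.
  have -> : 2 * pi * (w0 * s) = pi.
    by rewrite /s; field.
  by rewrite opprD expiD expi_Npi mulrN1 mulrN.
have iGs : Cintegrable (lebesgue_rV n.+1) (fun u => G (u + s *: e0)).
  by case: iG => i1 i2; split; [exact: (integrable_lebesgue_rV_shift (s *: e0) i1)
    |exact: (integrable_lebesgue_rV_shift (s *: e0) i2)].
have E : 2%:C * Cintegral (lebesgue_rV n.+1) G =
    Cintegral (lebesgue_rV n.+1) (fun u => (F u - F (u + s *: e0))%:C * wave w u).
  transitivity (Cintegral (lebesgue_rV n.+1) (fun u => G u + G (u + s *: e0))).
    by rewrite CintegralD// Cintegral_shift// rmorph_nat mulr_natl mulr2n.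
  by apply: eq_Cintegral => u; rewrite GE rmorphB/= mulrBl.
(* As |s| <= 1, the cube with corner (-1, ..., -1) and side 3 contains the supports of [F] and of
   its translate. *)
have Bd : modc (2%:C * Cintegral (lebesgue_rV n.+1) G) <=
    2 * (L * `|s|) * fine (lebesgue_rV n.+1 (box (const_mx (-1)) 3)).
  rewrite E; apply: modc_Cintegral_le_indic; [|exact: measurable_box|exact: lebesgue_rV_box_fin|].
    apply: CmeasurableM => //; apply: Cmeasurable_real; apply: measurable_funB => //.
    by apply: (measurableT_comp mF); exact: measurable_rV_addr.
  move=> x; rewrite modcM modc_wave mulr1 modc_real indicE.
  have [_|xb] := boolP (x \in _); first by rewrite mulr1 distrC (addrC x); exact: lipF.
  have F0 y : ~ box 0 1 y -> F y = 0.
    move=> yb; apply/normr0_eq0/le_anti; rewrite normr_ge0 andbT.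
    by apply: le_trans (FB y) _; rewrite indicE memNset// mulr0.
  rewrite !F0 ?subrr ?normr0 ?mulr0// => yb; move/negP: xb; apply; apply/mem_set => i;
    have := yb i; rewrite !mxE => /andP[y0 y1]; move: s1; rewrite ler_norml => /andP[? ?].
    move: y0 y1; case: (_ && _); rewrite ?mulr1 ?mulr0 => ? ?.
      by apply/andP; split; lra.
    by apply/andP; split; lra.
  by apply/andP; split; lra.
move: Bd; rewrite modcM modc_real ger0_norm// lebesgue_rV_box//= sn.
rewrite -/G => Bd.
rewrite -(ler_pM2l (_ : 0 < 2))//; apply: le_trans Bd _.
rewrite invfM.
have -> : 2 * (L * (2^-1 / `|w0|)) * 3 ^+ n.+1 = L * 3 ^+ n.+1 / `|w0|.
  by field; rewrite normr_eq0.
rewrite ler_peMl ?ler1n// divr_ge0// mulr_ge0// exprn_ge0//.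
Qed.

End fourier_decay.

Lemma Rintegral_gt0_box (R : realType) m (h : 'rV[R]_m -> R) (a : 'rV[R]_m) (e c : R) : 0 < c -> 0 < e ->
  (lebesgue_rV m).-integrable setT (EFin \o h) -> (forall x, 0 <= h x) ->
  (forall x, box a e x -> c <= h x) -> 0 < \int[lebesgue_rV m]_x h x.
Proof.
move=> c0 e0' ih h0 hc.
have i1 : (lebesgue_rV m).-integrable setT (EFin \o (\1_(box a e) : 'rV[R]_m -> R)).
  apply: (@integrable_le_indic _ _ _ _ _ (box a e) 1) => //.
  - by apply: measurable_indic; exact: measurable_box.
  - exact: measurable_box.
  - by apply: lebesgue_rV_box_fin; exact: ltW.
  - by move=> x; rewrite mul1r ger0_norm.
apply: (@lt_le_trans _ _ (\int[lebesgue_rV m]_x (c * \1_(box a e) x))).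
  rewrite RintegralZl// /Rintegral/= integral_indic//; last exact: measurable_box.
  by rewrite setIT lebesgue_rV_box ?ltW//= mulr_gt0// exprn_gt0.
apply: le_Rintegral => //; first exact: (integrableZl measurableT c i1).
move=> x _; rewrite indicE; have [/set_mem xb|_] := boolP (x \in _).
  by rewrite mulr1; exact: hc.
by rewrite mulr0.
Qed.

(** * Localization operators on modulated bumps *)

Section local_model.
Variables (R : realType) (n : nat).
Local Open Scope complex_scope.
Local Notation d := n.+1.
Local Notation e0 := (delta_mx ord0 ord0 : 'rV[R]_d).
Implicit Types (x w t v : 'rV[R]_d) (z : 'rV[R]_(d + d)).

Variables (g p1 p2 : 'rV[R]_d -> R) (Bg B1 B2 Lg L1 : R).
Hypotheses (mg : measurable_fun setT g) (mp1 : measurable_fun setT p1)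
  (mp2 : measurable_fun setT p2).
Hypotheses (Bg0 : 0 <= Bg) (B10 : 0 <= B1) (B20 : 0 <= B2) (Lg0 : 0 <= Lg) (L10 : 0 <= L1).
Hypotheses (g0 : forall x, 0 <= g x) (gB : forall x, g x <= Bg * \1_(box 0 1) x).
Hypotheses (p1B : forall x, `|p1 x| <= B1) (p2B : forall x, `|p2 x| <= B2).
Hypotheses (lipg : forall x (s : R), `|g (s *: e0 + x) - g x| <= Lg * `|s|)
  (lip1 : forall x (s : R), `|p1 (s *: e0 + x) - p1 x| <= L1 * `|s|).

Let gBg x : g x <= Bg.
Proof.
apply: le_trans (gB x) _; rewrite indicE; case: (_ \in _); first by rewrite mulr1.
by rewrite mulr0.
Qed.

Let box01E m : fine (lebesgue_rV m (box (0 : 'rV[R]_m) 1)) = 1.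
Proof. by rewrite lebesgue_rV_box// expr1n. Qed.

Definition localSTFT x w : R[i] :=
  Cintegral (lebesgue_rV d) (fun t => (g t * p1 (t - x))%:C * wave w t).

Let Vmeas x w : Cmeasurable (fun t => (g t * p1 (t - x))%:C * wave w t).
Proof.
apply: CmeasurableM; last exact: Cmeasurable_wave.
apply: Cmeasurable_real; apply: measurable_funM => //.
by apply: (measurableT_comp mp1); exact: measurable_rVB.
Qed.

Let Vle x w t : modc ((g t * p1 (t - x))%:C * wave w t) <= (Bg * B1) * \1_(box 0 1) t.
Proof.
rewrite modcM modc_wave mulr1 modc_real normrM (ger0_norm (g0 _)).
apply: (@le_trans _ _ ((Bg * \1_(box 0 1) t) * B1)); last by rewrite mulrAC.
by apply: ler_pM.
Qed.

Lemma Cintegrable_localSTFT x w :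
  Cintegrable (lebesgue_rV d) (fun t => (g t * p1 (t - x))%:C * wave w t).
Proof.
by apply: (Cintegrable_le_indic (A := box 0 1) (B := Bg * B1)) => //;
  [exact: measurable_box|exact: lebesgue_rV_box_fin].
Qed.

Lemma localSTFT_le x w : modc (localSTFT x w) <= 2 * (Bg * B1).
Proof.
apply: le_trans (modc_Cintegral_le_indic _ _ _ (Vle x w)) _ => //.
- exact: measurable_box.
- exact: lebesgue_rV_box_fin.
- by rewrite box01E mulr1.
Qed.

(** Uniform in [x]: by the product rule, [g t * p1 (t - x)] is Lipschitz in [t] along the first axis
    with constant [Lg * B1 + Bg * L1]. *)
Lemma localSTFT_decay x w : 1 <= `|w ord0 ord0| ->
  modc (localSTFT x w) <= (Lg * B1 + Bg * L1) * 3 ^+ d / `|w ord0 ord0|.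
Proof.
apply: (@fourier_decay _ _ _ (Bg * B1)).
- by apply: measurable_funM => //; apply: (measurableT_comp mp1); exact: measurable_rVB.
- by move=> t; have := Vle x 0 t; rewrite modcM modc_wave mulr1 modc_real.
- by rewrite addr_ge0// mulr_ge0.
- move=> t s; rewrite -addrA.
  set a := g (s *: e0 + t); set b := g t; set c := p1 (s *: e0 + (t - x)); set e := p1 (t - x).
  have -> : a * c - b * e = (a - b) * c + b * (c - e) by ring.
  apply: le_trans (ler_normD _ _) _; rewrite !normrM mulrDl; apply: lerD.
    by rewrite mulrAC; apply: ler_pM (normr_ge0 _) (normr_ge0 _) (lipg _ _) (p1B _).
  rewrite -mulrA; apply: ler_pM (normr_ge0 _) (normr_ge0 _) _ (lip1 _ _).
  by rewrite ger0_norm ?g0 ?gBg.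
Qed.

Lemma Cmeasurable_localSTFT dT (T : measurableType dT) (f h : T -> 'rV[R]_d) :
  measurable_fun setT f -> measurable_fun setT h ->
  Cmeasurable (fun y => localSTFT (f y) (h y)).
Proof.
move=> mf mh.
apply: (measurable_fun_Cintegral (f := fun q => (g q.2 * p1 (q.2 - f q.1))%:C * wave (h q.1) q.2)).
  exact: sigma_finite_lebesgue_rV.
have m1 : measurable_fun setT (fun q : T * 'rV[R]_d => f q.1).
  by apply: (measurableT_comp mf); exact: measurable_fst.
have m2 : measurable_fun setT (fun q : T * 'rV[R]_d => h q.1).
  by apply: (measurableT_comp mh); exact: measurable_fst.
have m3 : measurable_fun setT (fun q : T * 'rV[R]_d => q.2) by exact: measurable_snd.
apply: CmeasurableM; last exact: Cmeasurable_wave.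
apply: Cmeasurable_real; apply: measurable_funM; first exact: (measurableT_comp mg m3).
by apply: (measurableT_comp mp1); exact: measurable_rVB.
Qed.

(** Integrated in [z], this is A_a f(t) for the symbol g(x) g(omega) and f = e^(2 pi i m t_0) g(t):
    the modulation of f shifts the frequency variable of its STFT by [m]. *)
Definition loc_integrand (m : R) t z : R[i] :=
  (g (lsubmx z) * g (rsubmx z))%:C * localSTFT (lsubmx z) (rsubmx z - m *: e0) *
  (expi (2 * pi * dotrV (rsubmx z) t) * (p2 (t - lsubmx z))%:C).

Definition loc_integral (m : R) t : R[i] := Cintegral (lebesgue_rV (d + d)) (loc_integrand m t).

Lemma Cmeasurable_loc_integrand m t : Cmeasurable (loc_integrand m t).
Proof.
have ml : measurable_fun setT (fun z => lsubmx z) by exact: measurable_lsubmx.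
have mr : measurable_fun setT (fun z => rsubmx z) by exact: measurable_rsubmx.
apply: CmeasurableM.
  apply: CmeasurableM.
    by apply: Cmeasurable_real; apply: measurable_funM; apply: (measurableT_comp mg).
  by apply: Cmeasurable_localSTFT => //; exact: measurable_rVB.
apply: CmeasurableM.
  by apply: Cmeasurable_expi; apply: measurable_funM => //; exact: measurable_dotrV.
by apply: Cmeasurable_real; apply: (measurableT_comp mp2); exact: measurable_rVB.
Qed.

Lemma loc_integrand_le m t D : 0 <= D ->
  (forall z, box 0 1 z -> modc (localSTFT (lsubmx z) (rsubmx z - m *: e0)) <= D) ->
  forall z, modc (loc_integrand m t z) <= (Bg ^+ 2 * D * B2) * \1_(box 0 1) z.
Proof.
move=> D0 HD z; rewrite !modcM !modc_real modc_expi mul1r.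
have [zb|zb] := pselect (box 0 1 z).
  rewrite indicE mem_set// mulr1; apply: ler_pM => //; rewrite ?mulr_ge0 ?modc_ge0//.
  apply: ler_pM => //; rewrite ?modc_ge0//; last exact: HD.
  by rewrite normrM !ger0_norm// expr2; apply: ler_pM.
suff -> : g (lsubmx z) * g (rsubmx z) = 0 by rewrite normr0 !mul0r indicE memNset// mulr0.
have gz x : ~ box 0 1 x -> g x = 0.
  move=> xb; apply/le_anti; rewrite g0 andbT; apply: le_trans (gB _) _.
  by rewrite indicE memNset// mulr0.
have [lb|lb] := pselect (box 0 1 (lsubmx z)); last by rewrite gz// mul0r.
rewrite [X in _ * X]gz ?mulr0// => rb; apply: zb => i.
by case: (split_ordP i) => j ->; [have := lb j|have := rb j]; rewrite !mxE.
Qed.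

Lemma Cintegrable_loc_integrand m t : Cintegrable (lebesgue_rV (d + d)) (loc_integrand m t).
Proof.
apply: (Cintegrable_le_indic (A := box 0 1) (B := Bg ^+ 2 * (2 * (Bg * B1)) * B2)).
- exact: Cmeasurable_loc_integrand.
- exact: measurable_box.
- exact: lebesgue_rV_box_fin.
- by apply: loc_integrand_le => *; [rewrite !mulr_ge0|exact: localSTFT_le].
Qed.

(** The frequency lies in the unit cube, so for |m| >= 2 its first coordinate is at distance at
    least |m|/2 >= 1 from [m], and the decay of [localSTFT] applies on the whole domain. The
    constant is independent of [t]. *)
Lemma loc_integral_decay : exists2 K, 0 <= K & forall (m : R) t, 2 <= `|m| ->
  modc (loc_integral m t) <= K / `|m|.
Proof.
pose K := (Lg * B1 + Bg * L1) * 3 ^+ d.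
have K0 : 0 <= K by rewrite mulr_ge0 ?exprn_ge0// addr_ge0// mulr_ge0.
exists (2 * (Bg ^+ 2 * (2 * K) * B2)); first by do !apply: mulr_ge0 => //; exact: exprn_ge0.
move=> m t m2; have m0 : 0 < `|m| by lra.
apply: (@le_trans _ _ (2 * (Bg ^+ 2 * (K * 2 / `|m|) * B2) * 1)); last first.
  by rewrite mulr1 le_eqVlt; apply/orP; left; apply/eqP; field; rewrite gt_eqF.
rewrite -[X in _ <= _ * X](box01E (d + d)); apply: modc_Cintegral_le_indic.
- exact: Cmeasurable_loc_integrand.
- exact: measurable_box.
- exact: lebesgue_rV_box_fin.
- apply: loc_integrand_le => [|z zb]; first by apply: divr_ge0 => //; apply: mulr_ge0.
  set w := rsubmx z - m *: e0.
  have wE : w ord0 ord0 = z ord0 (rshift d ord0) - m.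
    by rewrite /w !mxE !eqxx mulr1.
  have /andP[] := zb (rshift d ord0); rewrite !mxE add0r => z0 z1.
  have wm : `|m| / 2 <= `|w ord0 ord0|.
    rewrite wE; have := ler_normB (z ord0 (rshift d ord0)) (z ord0 (rshift d ord0) - m).
    by rewrite subKr (ger0_norm z0) => ?; lra.
  apply: le_trans (localSTFT_decay _ _) _; first by lra.
  rewrite -/K -mulrA ler_wpM2l// -invf_div lef_pV2// ?posrE; lra.
Qed.

Variables (K : nat) (L : R).
Implicit Types b c : nat -> R.

Definition trig c (theta : R) : R[i] := \sum_(k < K) (c k)%:C * expi (theta *+ k).

Definition test_fun c t : R[i] := trig c (2 * pi * L * t ord0 ord0) * (g t)%:C.

Definition test_symbol b z : R[i] :=
  \sum_(l < K) (b l)%:C * (g (lsubmx z) * g (rsubmx z - (L * l%:R) *: e0))%:C.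

Local Notation phi1 := (fun x => (p1 x)%:C).
Local Notation phi2 := (fun x => (p2 x)%:C).

Let shiftE (s : R) w t : expi (2 * pi * dotrV (w + s *: e0) t) =
  expi (2 * pi * dotrV w t) * expi (2 * pi * s * t ord0 ord0).
Proof. by rewrite -expiD dotrVDl dotrV_e0l mulrDr !mulrA. Qed.

Lemma waveB_e0 (s : R) w t : wave (w - s *: e0) t = wave w t * expi (2 * pi * s * t ord0 ord0).
Proof.
rewrite -[w - _](congr1 (+%R w) (scaleNr s e0)) /wave -expiD dotrVDl dotrV_e0l; congr expi.
by rewrite mulrDr opprD mulNr mulrN opprK !mulrA.
Qed.

Lemma STFT_test_fun c x w :
  STFT phi1 (test_fun c) x w = \sum_(k < K) (c k)%:C * localSTFT x (w - (L * k%:R) *: e0).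
Proof.
rewrite /STFT (@eq_Cintegral _ _ _ _ _ (fun t => \sum_(k < K) (c k)%:C *
    ((g t * p1 (t - x))%:C * wave (w - (L * k%:R) *: e0) t))); last first.
  move=> t; rewrite [X in _ * X * _](_ : _ = (p1 (t - x))%:C); last first.
    by apply/eqP; rewrite eq_complex/= oppr0 !eqxx.
  rewrite /test_fun /trig !mulr_suml; apply: eq_bigr => k _.
  rewrite waveB_e0 /wave rmorphM/= (_ : 2 * pi * (L * k%:R) * t ord0 ord0 =
    2 * pi * L * t ord0 ord0 *+ k); last by rewrite -[RHS]mulr_natr; ring.
  ring.
rewrite Cintegral_sum; last by move=> k; apply: CintegrableZ; exact: Cintegrable_localSTFT.
by apply: eq_bigr => k _; rewrite CintegralZ//; exact: Cintegrable_localSTFT.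
Qed.

Let shift (s : R) : 'rV[R]_(d + d) := row_mx 0 (s *: e0).

Let lsub_shift z s : lsubmx (z + shift s) = lsubmx z.
Proof. by rewrite -{1}[z]hsubmxK add_row_mx row_mxKl addr0. Qed.

Let rsub_shift z s : rsubmx (z + shift s) = rsubmx z + s *: e0.
Proof. by rewrite -{1}[z]hsubmxK add_row_mx row_mxKr. Qed.

Lemma localization_op_test b c t :
  localization_op phi1 phi2 (test_symbol b) (test_fun c) t =
  \sum_(l < K) \sum_(k < K) (b l * c k)%:C * (expi (2 * pi * L * t ord0 ord0 *+ l) *
    loc_integral (L * (k%:R - l%:R)) t).
Proof.
(* [H l k] is the contribution of the pair, read after centring the l-th bump of the symbol at the
   origin; the phase [expi (theta *+ l)] is what this translation extracts from the synthesis
   factor. *)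
pose H (l k : nat) z := (b l * c k)%:C * (expi (2 * pi * L * t ord0 ord0 *+ l) *
  loc_integrand (L * (k%:R - l%:R)) t (z + shift (- (L * l%:R)))).
have iH1 l k : Cintegrable (lebesgue_rV (d + d))
    (fun z => loc_integrand (L * (k%:R - l%:R)) t (z + shift (- (L * l%:R)))).
  have [i1 i2] := Cintegrable_loc_integrand (L * (k%:R - l%:R)) t.
  by split; [exact: (integrable_lebesgue_rV_shift _ i1)
    |exact: (integrable_lebesgue_rV_shift _ i2)].
have iH l k : Cintegrable (lebesgue_rV (d + d)) (H l k).
  by apply: CintegrableZ; apply: CintegrableZ; exact: iH1.
rewrite /localization_op (@eq_Cintegral _ _ _ _ _ (fun z => \sum_(l < K) \sum_(k < K) H l k z)).
  rewrite Cintegral_sum; last by move=> l; apply: Cintegrable_sum => k; exact: iH.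
  apply: eq_bigr => l _; rewrite Cintegral_sum; last by move=> k; exact: iH.
  apply: eq_bigr => k _; rewrite /H CintegralZ; last by apply: CintegrableZ; exact: iH1.
  rewrite CintegralZ; last exact: iH1.
  by rewrite Cintegral_shift//; exact: Cintegrable_loc_integrand.
move=> z; rewrite STFT_test_fun /test_symbol mulr_suml mulr_suml; apply: eq_bigr => l _.
rewrite mulr_sumr mulr_suml; apply: eq_bigr => k _.
rewrite /H /loc_integrand lsub_shift rsub_shift /modulation /translation.
rewrite scaleNr -addrA -opprD -scalerDl.
have -> : L * l%:R + L * (k%:R - l%:R) = L * k%:R by ring.
rewrite (_ : expi (2 * pi * dotrV (rsubmx z) t) =
  expi (2 * pi * dotrV (rsubmx z - (L * l%:R) *: e0) t) *
  expi (2 * pi * (L * l%:R) * t ord0 ord0)); last by rewrite -shiftE subrK.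
rewrite (_ : 2 * pi * (L * l%:R) * t ord0 ord0 =
    2 * pi * L * t ord0 ord0 *+ l); last by rewrite -[RHS]mulr_natr; ring.
rewrite [(b l * c k)%:C]rmorphM/=; ring.
Qed.

Variables (a0 : 'rV[R]_d) (wd : R).
Hypotheses (wd0 : 0 < wd) (g_half : forall x, box a0 wd x -> 1 / 2 <= g x).
Hypotheses (p1_half : forall x v, g x != 0 -> g v != 0 -> 1 / 2 <= p1 (v - x))
  (p2_half : forall x v, g x != 0 -> g v != 0 -> 1 / 2 <= p2 (v - x))
  (cos_half : forall w t v, g w != 0 -> g t != 0 -> g v != 0 ->
     1 / 2 <= cos (2 * pi * dotrV w t - 2 * pi * dotrV w v)).

Let integrable_g : (lebesgue_rV d).-integrable setT (EFin \o g).
Proof.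
apply: (@integrable_le_indic _ _ _ _ _ (box 0 1) Bg) => //.
- exact: measurable_box.
- exact: lebesgue_rV_box_fin.
- by move=> x; rewrite ger0_norm.
Qed.

Let mgg : measurable_fun setT (fun z => g (lsubmx z) * g (rsubmx z)).
Proof.
apply: measurable_funM; apply: (measurableT_comp mg).
- exact: measurable_lsubmx.
- exact: measurable_rsubmx.
Qed.

Let gg_le z : `|g (lsubmx z) * g (rsubmx z)| <= Bg ^+ 2 * \1_(box 0 1) z.
Proof.
rewrite ger0_norm ?mulr_ge0//.
have -> : \1_(box 0 1) z = \1_(box 0 1) (lsubmx z) * \1_(box 0 1) (rsubmx z) :> R.
  rewrite -natrM !indicE; congr (_%:R); rewrite mulnb; congr nat_of_bool.
  apply/idP/andP => [/set_mem zb|[/set_mem lb /set_mem rb]].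
    by split; apply/mem_set => i; have := zb (lshift d i); have := zb (rshift d i); rewrite !mxE.
  apply/mem_set => i.
  by case: (split_ordP i) => j ->; [have := lb j|have := rb j]; rewrite !mxE.
by rewrite expr2 mulrACA; apply: ler_pM.
Qed.

Let integrable_gg : (lebesgue_rV (d + d)).-integrable setT
  (EFin \o (fun z => g (lsubmx z) * g (rsubmx z))).
Proof.
apply: (integrable_le_indic mgg _ _ gg_le).
- exact: measurable_box.
- exact: lebesgue_rV_box_fin.
Qed.

Lemma Rintegral_g_gt0 : 0 < \int[lebesgue_rV d]_x g x.
Proof. by apply: (Rintegral_gt0_box (a := a0) (e := wd) (c := 1 / 2)) => //; lra. Qed.

Lemma Rintegral_gg_gt0 : 0 < \int[lebesgue_rV (d + d)]_z (g (lsubmx z) * g (rsubmx z)).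
Proof.
apply: (Rintegral_gt0_box (a := row_mx a0 a0) (e := wd) (c := 1 / 2 * (1 / 2))) => //.
- by move=> z; rewrite mulr_ge0.
- move=> z zb; apply: ler_pM; rewrite ?divr_ge0//; apply: g_half => i.
    by have := zb (lshift d i); rewrite row_mxEl mxE.
  by have := zb (rshift d i); rewrite row_mxEr mxE.
Qed.

(** The factor 1/8 is made of three halves: the lower bounds for [p1], for [p2] and for the cosine
    of the phase. *)
Definition kappa : R := 1 / 8 * (\int[lebesgue_rV d]_x g x) *
  (\int[lebesgue_rV (d + d)]_z (g (lsubmx z) * g (rsubmx z))).

Lemma kappa_gt0 : 0 < kappa.
Proof. by rewrite !mulr_gt0 ?Rintegral_g_gt0 ?Rintegral_gg_gt0. Qed.

(** The phases combine into 2 pi (w . t - w . v), where [w], [t] and the integration point [v] all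
    lie in the support of [g]: nothing cancels, and the real part of the integrand is at least
    g/4. *)
Let Re_localSTFT x w t : g x != 0 -> g w != 0 -> g t != 0 ->
  1 / 4 * (\int[lebesgue_rV d]_x g x) <=
  complex.Re (localSTFT x w * expi (2 * pi * dotrV w t)).
Proof.
move=> gx gw gt; rewrite (mulrC (localSTFT x w)) /localSTFT -CintegralZ; last exact: Cintegrable_localSTFT.
have [i1 _] := CintegrableZ (expi (2 * pi * dotrV w t)) (Cintegrable_localSTFT x w).
rewrite -RintegralZl//; apply: le_Rintegral => //.
  exact: (integrableZl measurableT (1 / 4) integrable_g).
move=> v _; rewrite mulrCA /wave -expiD cReM/= mul0r subr0.
have [->|gv] := eqVneq (g v) 0; first by rewrite mulr0 !mul0r.
rewrite [leLHS]mulrC -mulrA; apply: ler_wpM2l => //.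
rewrite (_ : 1 / 4 = 1 / 2 * (1 / 2)); last by lra.
by apply: ler_pM; rewrite ?divr_ge0//; [exact: p1_half|exact: cos_half].
Qed.

Lemma Re_loc_integral0 t : g t != 0 -> kappa <= complex.Re (loc_integral 0 t).
Proof.
move=> gt; rewrite /kappa -RintegralZl//.
have [i1 _] := Cintegrable_loc_integrand 0 t.
apply: le_Rintegral => //; first exact: (integrableZl measurableT _ integrable_gg).
move=> z _; rewrite /loc_integrand scale0r subr0.
set V := localSTFT _ _; set E := expi _; set G := g _ * g _.
rewrite (_ : G%:C * V * (E * _) = (G * p2 (t - lsubmx z))%:C * (V * E)); last first.
  by rewrite [(G * p2 _)%:C]rmorphM; ring.
rewrite cReM/= mul0r subr0.
have [->|G0] := eqVneq G 0; first by rewrite mulr0 !mul0r.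
have gl : g (lsubmx z) != 0 by apply: contraNneq G0 => gl; rewrite /G gl mul0r.
have gr : g (rsubmx z) != 0 by apply: contraNneq G0 => gr; rewrite /G gr mulr0.
rewrite [leLHS]mulrC -[leRHS]mulrA; apply: ler_wpM2l; first by rewrite mulr_ge0.
rewrite (_ : 1 / 8 = 1 / 2 * (1 / 4)); last by lra.
rewrite -mulrA; apply: ler_pM; rewrite ?divr_ge0//.
- by apply: mulr_ge0; rewrite ?divr_ge0// ltW// Rintegral_g_gt0.
- exact: p2_half.
- exact: Re_localSTFT.
Qed.

Lemma localization_op_lower Kd b c t : 0 <= Kd ->
  (forall (m : R) v, 2 <= `|m| -> modc (loc_integral m v) <= Kd / `|m|) ->
  2 <= L -> (forall l, `|b l| <= 1) -> (forall k, `|c k| <= 1) -> g t != 0 ->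
  kappa * modc (trig (fun l => b l * c l) (2 * pi * L * t ord0 ord0)) <=
  modc (localization_op phi1 phi2 (test_symbol b) (test_fun c) t) + K%:R ^+ 2 * Kd / L.
Proof.
move=> Kd0 HKd L2 b1 c1 gt; rewrite localization_op_test.
set theta := 2 * pi * L * _.
pose F (l k : 'I_K) := (b l * c k)%:C * (expi (theta *+ l) * loc_integral (L * (k%:R - l%:R)) t).
(* Off the diagonal, [k] and [l] differ by at least 1, so the offset is at least L >= 2 in modulus,
   and each of these at most K^2 terms is bounded by Kd/L. *)
pose Err := \sum_(l < K) \sum_(k < K | k != l) F l k.
have -> : \sum_(l < K) \sum_(k < K) F l k =
    trig (fun l => b l * c l) theta * loc_integral 0 t + Err.
  rewrite /trig mulr_suml -big_split/=; apply: eq_bigr => l _.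
  by rewrite (bigD1 l)//=; congr (_ + _); rewrite /F subrr mulr0 mulrA.
have ErrB : modc Err <= K%:R ^+ 2 * Kd / L.
  apply: (le_trans (modc_sum _ _ _)).
  apply: (@le_trans _ _ (\sum_(l < K) (K%:R * Kd / L))); last first.
    by rewrite sumr_const card_ord -mulr_natl le_eqVlt; apply/orP; left; apply/eqP; ring.
  apply: ler_sum => l _; apply: (le_trans (modc_sum _ _ _)).
  apply: (@le_trans _ _ (\sum_(k < K | k != l) (Kd / L))); last first.
    rewrite big_mkcond/= -mulrA mulr_natl -[in leRHS](card_ord K) -sumr_const.
    by apply: ler_sum => k _; case: ifP => // _; rewrite divr_ge0//; lra.
  apply: ler_sum => k kl; rewrite !modcM modc_real modc_expi mul1r.
  have kl1 : 1 <= `|k%:R - l%:R : R|.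
    have : (0 < `|k%:Z - l%:Z|)%R by rewrite normr_gt0 subr_eq0.
    by rewrite gtz0_ge1 -(ler1z R) intr_norm intrB.
  have Lk : L <= `|L * (k%:R - l%:R)|.
    by rewrite normrM (ger0_norm (_ : 0 <= L)) ?ler_peMr//; lra.
  rewrite -[leRHS]mul1r; apply: ler_pM; rewrite ?modc_ge0//.
    by rewrite normrM -[leRHS]mulr1; apply: ler_pM.
  apply: le_trans (HKd _ _ _) _; first by lra.
  by rewrite ler_wpM2l// lef_pV2// posrE; lra.
rewrite -lerBlDr; set D := _ * loc_integral 0 t.
apply: (@le_trans _ _ (modc D - modc Err)).
  apply: lerB => //; rewrite /D modcM mulrC; apply: ler_wpM2l; first exact: modc_ge0.
  apply: le_trans (Re_loc_integral0 gt) _.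
  by apply: le_trans (Re_le_modc _); exact: ler_norm.
rewrite lerBlDr; have := modcD (D + Err) (- Err).
by rewrite addrK modcN.
Qed.

End local_model.

(** * Amalgam norms *)

Section amalgam_norms.
Variables (R : realType) (n : nat).
Implicit Types (f : 'rV[R]_n -> R[i]) (k : 'rV[int]_n) (M : R) (p q : \bar R).
Local Open Scope ereal_scope.

Lemma ler_poweR_nneg (r : R) (x y : \bar R) : (0 <= r)%R -> 0 <= x -> x <= y -> x `^ r <= y `^ r.
Proof.
move=> r0 x0 xy; apply: gt0_ler_poweR => //; rewrite in_itv/= leey andbT//.
exact: le_trans xy.
Qed.

Lemma poweRK (r : R) (x : \bar R) : r != 0%R -> 0 <= x -> (x `^ r) `^ r^-1 = x.
Proof. by move=> r0 x0; rewrite -poweRrM mulfV// poweRe1. Qed.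

Lemma unit_cubeE k : unit_cube k = box (\row_i (k ord0 i)%:~R : 'rV[R]_n) 1.
Proof. by apply/seteqP; split=> x xk i; have := xk i; rewrite mxE. Qed.

Lemma measurable_unit_cube k : measurable (unit_cube k : set 'rV[R]_n).
Proof. by rewrite unit_cubeE; exact: measurable_box. Qed.

Lemma lebesgue_unit_cube k : lebesgue_rV n (unit_cube k : set 'rV[R]_n) = 1.
Proof. by rewrite unit_cubeE lebesgue_rV_box// expr1n. Qed.

(** The norm with exponent [+oo] unfolds to an essential supremum under the condition that the whole
    space has positive measure. *)
Lemma lebesgue_rV_setT_gt0 : 0 < lebesgue_rV n [set: 'rV[R]_n].
Proof.
apply: (@lt_le_trans _ _ (lebesgue_rV n (unit_cube 0 : set 'rV[R]_n))).
  by rewrite lebesgue_unit_cube.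
by apply: le_measure; rewrite ?inE//; exact: measurable_unit_cube.
Qed.

Let abs_cube f k x : `|(modc (f x) * \1_(unit_cube k) x)%:E| = (modc (f x) * \1_(unit_cube k) x)%:E.
Proof. by rewrite gee0_abs// lee_fin mulr_ge0// modc_ge0. Qed.

Lemma cube_norm_fin r f k : cube_norm r%:E f k =
  (\int[lebesgue_rV n]_x ((modc (f x) * \1_(unit_cube k) x) `^ r)%:E) `^ r^-1.
Proof.
rewrite /cube_norm unlock; congr (_ `^ _).
by apply: eq_integral => x _; rewrite abs_cube poweR_EFin.
Qed.

Lemma cube_norm_y f k : cube_norm +oo f k =
  ess_sup (lebesgue_rV n) (fun x => (modc (f x) * \1_(unit_cube k) x)%:E).
Proof.
rewrite /cube_norm unlock lebesgue_rV_setT_gt0; apply: eq_ess_sup.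
by apply: aeW => x /=; exact: abs_cube.
Qed.

Lemma cube_norm_ge0 p f k : 0 <= cube_norm p f k.
Proof. exact: Lnorm_ge0. Qed.

(** A unit cube has mass 1, so a pointwise bound on it passes to every L^p norm without a
    constant. *)
Lemma cube_norm_le p f k M : 1 <= p -> (0 <= M)%R ->
  (forall x, unit_cube k x -> (modc (f x) <= M)%R) -> cube_norm p f k <= M%:E.
Proof.
move=> p1 M0 fM.
have fM1 x : (modc (f x) * \1_(unit_cube k) x <= M * \1_(unit_cube k) x)%R.
  rewrite indicE; have [/set_mem xk|_] := boolP (x \in _); last by rewrite !mulr0.
  by rewrite !mulr1; exact: fM.
case: p p1 => [r||]// r1; last first.
  rewrite cube_norm_y; apply/ess_supP; apply: aeW => x; rewrite lee_fin.
  apply: le_trans (fM1 x) _; rewrite indicE; case: (_ \in _); first by rewrite mulr1.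
  by rewrite mulr0.
rewrite lee_fin in r1; have r0 : r != 0%R by rewrite gt_eqF// (lt_le_trans _ r1).
rewrite cube_norm_fin -[leRHS](poweRK r0)//; apply: ler_poweR_nneg.
- by rewrite invr_ge0; lra.
- by apply: integral_ge0 => x _; rewrite lee_fin powR_ge0.
apply: (@le_trans _ _ (\int[lebesgue_rV n]_x ((M `^ r)%:E * (\1_(unit_cube k) x)%:E))).
  apply: ge0_le_integral_nomeas => x; first by rewrite lee_fin powR_ge0.
  rewrite -EFinM lee_fin; have := fM1 x; rewrite indicE; case: (_ \in _).
    rewrite !mulr1 => H; apply: ge0_ler_powR; rewrite ?nnegrE ?modc_ge0//; lra.
  by rewrite !mulr0 powR0.
rewrite ge0_integralZl//; last 2 first.
- by apply/measurable_EFinP; apply: measurable_indic; exact: measurable_unit_cube.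
- by rewrite lee_fin powR_ge0.
rewrite integral_indic//; last exact: measurable_unit_cube.
by rewrite setIT [X in _ * X]lebesgue_unit_cube mule1 poweR_EFin.
Qed.

Lemma cube_norm_eq0 p f k : 1 <= p -> (forall x, unit_cube k x -> f x = 0%R) ->
  cube_norm p f k = 0.
Proof.
move=> p1 f0; apply/le_anti; rewrite cube_norm_ge0 andbT; apply: cube_norm_le => // x xk.
by rewrite f0// modc0.
Qed.

(** The l^q norm of a sequence of [K] ones. *)
Definition card_pow (K : nat) q : R := if q is r%:E then (K%:R `^ r^-1)%R else 1%R.

Lemma amalgam_norm_le p q f M (s : seq 'rV[int]_n) : 1 <= p -> 1 <= q -> (0 <= M)%R ->
  (0 < size s)%N ->
  (forall k, cube_norm p f k <= M%:E) ->
  (forall k x, unit_cube k x -> f x != 0%R -> k \in s) ->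
  amalgam_norm p q f <= (M * card_pow (size s) q)%:E.
Proof.
move=> p1 q1 M0 s0 fM fs; case: q q1 => [r||]// r1; last first.
  by rewrite /= mulr1; apply: ge_ereal_sup => _ [k _ <-].
rewrite lee_fin in r1; have r0 : r != 0%R by rewrite gt_eqF// (lt_le_trans _ r1).
rewrite /amalgam_norm /card_pow.
have -> : (M * (size s)%:R `^ r^-1)%:E = ((M `^ r)%:E * (size s)%:R%:E) `^ r^-1.
  rewrite poweRM ?lee_fin ?powR_ge0//.
  by rewrite !poweR_EFin -powRrM mulfV// powRr1.
apply: ler_poweR_nneg; first by rewrite invr_ge0; lra.
  by apply: esum_ge0 => k _; exact: poweR_ge0.
have E : \esum_(k in [set: 'rV[int]_n]) cube_norm p f k `^ r =
    \esum_(k in [set` undup s]) cube_norm p f k `^ r.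
  rewrite [RHS]esum_mkcond; apply: eq_esum => k _.
  case: ifPn => // ks; rewrite cube_norm_eq0// ?poweR0r// => x xk.
  apply/eqP; apply: contraNT ks => fx0; apply/mem_set => /=.
  by rewrite mem_undup; exact: fs fx0.
rewrite E esum_fset; [|exact: finite_seq|by move=> k _; exact: poweR_ge0].
rewrite -fsbig_seq ?undup_uniq//.
apply: (@le_trans _ _ (\sum_(k <- undup s) (M `^ r)%:E)).
  apply: lee_sum => k _; rewrite -poweR_EFin; apply: ler_poweR_nneg => //; first lra.
  exact: cube_norm_ge0.
rewrite sumEFin -EFinM lee_fin big_const_seq count_predT iter_addr_0 -[X in (X <= _)%R]mulr_natr.
by rewrite ler_wpM2l ?powR_ge0// ler_nat size_undup.
Qed.

(** One term of an l^q norm is at most the norm. The output A_a f is bounded below only on the cube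
    that carries [g], so this single term is all that is kept of its norm. *)
Lemma cube_norm_le_amalgam p q f k : 1 <= q -> cube_norm p f k <= amalgam_norm p q f.
Proof.
case: q => [r||]// r1; last by apply: ereal_sup_ubound; exists k.
rewrite lee_fin in r1; have r0 : r != 0%R by rewrite gt_eqF// (lt_le_trans _ r1).
rewrite /amalgam_norm -[leLHS](poweRK r0) ?cube_norm_ge0//.
apply: ler_poweR_nneg; [by rewrite invr_ge0; lra|exact: poweR_ge0|].
apply: esum_ge; exists [set k]; first by split.
by rewrite fsbig_set1.
Qed.

End amalgam_norms.

(** * Trigonometric polynomials *)

Section trigonometric_polynomials.
Variable R : realType.
Implicit Types (c : nat -> R) (theta : R).
Local Open Scope complex_scope.

Lemma trigE K c theta : trig K c theta = \sum_(k < K) (c k)%:C * expi theta ^+ k.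
Proof. by apply: eq_bigr => k _; rewrite expiMn. Qed.

Lemma modc_trig_le K c theta : (forall k, `|c k| <= 1) -> modc (trig K c theta) <= K%:R.
Proof.
move=> c1; apply: le_trans (modc_sum _ _ _) _.
rewrite -[X in _ <= X%:R](card_ord K) -sum1_card natr_sum; apply: ler_sum => k _.
by rewrite modcM modc_real modc_expi mulr1.
Qed.

Lemma trig_cat N M (a b c : nat -> R) theta :
  (forall k, (k < N)%N -> c k = a k) -> (forall k, c (N + k)%N = b k) ->
  trig (N + M) c theta = trig N a theta + expi theta ^+ N * trig M b theta.
Proof.
move=> ca cb; rewrite !trigE big_split_ord/=; congr (_ + _).
  by apply: eq_bigr => k _; rewrite ca.
by rewrite mulr_sumr; apply: eq_bigr => k _; rewrite cb exprD mulrCA.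
Qed.

Lemma modcX (z : R[i]) k : modc (z ^+ k) = modc z ^+ k.
Proof.
elim: k => [|k IH]; first by rewrite !expr0; exact: Normc.normc1.
by rewrite !exprS modcM IH.
Qed.

Lemma parallelogram (u v : R[i]) :
  modc (u + v) ^+ 2 + modc (u - v) ^+ 2 = 2 * (modc u ^+ 2 + modc v ^+ 2).
Proof. by rewrite !modc_sqr; case: u => a b; case: v => e f /=; ring. Qed.

(** The pair (p, q) is replaced by p + z^(2^n) q and p - z^(2^n) q. Coefficients remain signs, and
    by the parallelogram law |p|^2 + |q|^2 doubles at every point of the circle. *)
Lemma rudin_shapiro n : exists2 e : nat -> R, (forall k, e k ^+ 2 = 1) &
  forall theta, modc (trig (2 ^ n) e theta) ^+ 2 <= 2 * 2 ^+ n.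
Proof.
suff [p [q [p1 q1 pq]]] : exists p q : nat -> R, [/\ forall k, p k ^+ 2 = 1, forall k, q k ^+ 2 = 1 &
    forall theta, modc (trig (2 ^ n) p theta) ^+ 2 + modc (trig (2 ^ n) q theta) ^+ 2 = 2 * 2 ^+ n].
  by exists p => // theta; rewrite -(pq theta) lerDl sqr_ge0.
elim: n => [|n [p [q [p1 q1 pq]]]].
  exists (fun=> 1), (fun=> 1); split=> [k|k|theta]; rewrite ?expr1n//.
  by rewrite expn0 trigE big_ord1 !expr0 !mulr1 modc_real normr1 expr1n mulr2n.
pose h (s : R) k := if (k < 2 ^ n)%N then p k else s * q (k - 2 ^ n)%N.
have hE s theta : trig (2 ^ n.+1) (h s) theta =
    trig (2 ^ n) p theta + s%:C * (expi theta ^+ (2 ^ n) * trig (2 ^ n) q theta).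
  rewrite expnS mul2n -addnn (@trig_cat _ _ p (fun k => s * q k)); last 2 first.
  - by move=> k kn; rewrite /h kn.
  - by move=> k; rewrite /h ltnNge leq_addr/= addKn.
  congr (_ + _); rewrite mulrCA; congr (_ * _); rewrite !trigE mulr_sumr.
  by apply: eq_bigr => k _; rewrite rmorphM/= mulrA.
exists (h 1), (h (- 1)); split.
- by move=> k; rewrite /h; case: ifP => _; rewrite ?p1// mul1r q1.
- by move=> k; rewrite /h; case: ifP => _; rewrite ?p1// mulN1r sqrrN q1.
move=> theta; rewrite !hE rmorphN !mul1r mulNr mul1r parallelogram modcM modcX modc_expi expr1n mul1r.
by rewrite pq exprS.
Qed.

Lemma modc_trig_sqr K c theta : modc (trig K c theta) ^+ 2 =
  \sum_(k < K) \sum_(l < K) c k * c l * cos (theta *+ k - theta *+ l).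
Proof.
rewrite modc_sqr.
have -> : complex.Re (trig K c theta) = \sum_(k < K) c k * cos (theta *+ k).
  rewrite /trig; elim/big_ind2 : _ => //= [x1 x2 y1 y2 <- <-|k _]; first by rewrite cReD.
  by rewrite mul0r subr0.
have -> : complex.Im (trig K c theta) = \sum_(k < K) c k * sin (theta *+ k).
  rewrite /trig; elim/big_ind2 : _ => //= [x1 x2 y1 y2 <- <-|k _]; first by rewrite cImD.
  by rewrite mul0r addr0.
rewrite !expr2 !mulr_suml -big_split/=; apply: eq_bigr => k _.
rewrite !mulr_sumr -big_split/=; apply: eq_bigr => l _.
by rewrite cosB; ring.
Qed.

(* Coefficients of the de la Vallee-Poussin kernel D_N D_{2N} / N. *)
Definition vp (N : nat) (k : nat) : R :=
  (\sum_(a < N) ((a <= k < a + 2 * N)%N)%:R) / N%:R.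

Lemma vp_ge0 N k : 0 <= vp N k.
Proof. by rewrite divr_ge0// sumr_ge0. Qed.

Lemma vp_le1 N k : (0 < N)%N -> vp N k <= 1.
Proof.
move=> N0; rewrite ler_pdivrMr ?ltr0n// mul1r -[X in _ <= X%:R](card_ord N) -sum1_card natr_sum.
by apply: ler_sum => a _; rewrite ler_nat leq_b1.
Qed.

(** On this plateau every [a < N] is counted, as a < N <= k < 2N <= a + 2N. *)
Lemma vp_eq1 N k : (N <= k < 2 * N)%N -> vp N k = 1.
Proof.
move=> Nk; have N0 : (0 < N)%N by lia.
rewrite /vp (eq_bigr (fun=> 1)) => [|a _]; last by rewrite (_ : (_ <= _ < _)%N)//; have := ltn_ord a; lia.
by rewrite sumr_const card_ord divff// pnatr_eq0 -lt0n.
Qed.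

(** The coefficient of z^k in the product of the two Dirichlet kernels is the number of a < N with a
    <= k < a + 2N. *)
Lemma trig_vp N theta : (0 < N)%N ->
  trig (4 * N) (vp N) theta = (N%:R^-1)%:C * (trig N (fun=> 1) theta * trig (2 * N) (fun=> 1) theta).
Proof.
move=> N0; rewrite !trigE.
have vpE k : (vp N k)%:C = (N%:R^-1)%:C * \sum_(a < N) ((a <= k < a + 2 * N)%N)%:R.
  rewrite /vp mulrC rmorphM rmorph_sum/=; congr (_ * _); apply: eq_bigr => a _.
  by rewrite rmorph_nat.
under eq_bigr => k _ do rewrite vpE -mulrA mulr_suml.
rewrite -mulr_sumr; congr (_ * _); rewrite mulr_suml exchange_big/=; apply: eq_bigr => a _.
rewrite mulr_sumr mul1r.
(* Since a < N, the shifted range a, ..., a + 2N - 1 stays below 4N, so no coefficient is cut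
   off. *)
rewrite (@big_ord_widen _ _ _ (2 * N) (4 * N - a)
  (fun b => expi theta ^+ a * (1%:C * expi theta ^+ b))); last by have := ltn_ord a; lia.
rewrite -(big_mkord xpredT (fun k => ((a <= k < a + 2 * N)%N)%:R * expi theta ^+ k)).
rewrite (@big_cat_nat _ _ _ (nat_of_ord a))/=; [|by []|by have := ltn_ord a; lia].
rewrite big_nat_cond big1 ?add0r => [|k]; last first.
  by rewrite andbT => /andP[_ ka]; rewrite leqNgt ka/= mul0r.
rewrite -{1}(add0n a) big_addn big_mkord big_mkcond/=.
rewrite [RHS]big_mkcond/=; apply: eq_bigr => k _.
rewrite addnC leq_addr ltn_add2l /=; case: ifP => _; last by rewrite mul0r.
by rewrite !mul1r exprD.
Qed.

(** The signs are put on the plateau of [vp N], where its coefficients are 1: multiplying [vp N] by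
    [block N e] gives [block N e] back. *)
Definition block (N : nat) (e : nat -> R) (l : nat) : R :=
  if (N <= l < 2 * N)%N then e (l - N)%N else 0.

Lemma trig_block N e theta : trig (4 * N) (block N e) theta = expi theta ^+ N * trig N e theta.
Proof.
have -> : (4 * N = N + (N + 2 * N))%N by lia.
rewrite (@trig_cat _ _ (fun=> 0) (fun k => if (k < N)%N then e k else 0)); last 2 first.
- by move=> k kN; rewrite /block leqNgt kN.
- by move=> k; rewrite /block leq_addr/= mul2n -addnn ltn_add2l addKn.
rewrite [trig N (fun=> 0) _]big1 ?add0r => [|k _]; last by rewrite mul0r.
rewrite (@trig_cat _ _ e (fun=> 0)); last 2 first.
- by move=> k ->.
- by move=> k; rewrite ltnNge leq_addr.
by rewrite [trig (2 * N) _ _]big1 ?mulr0 ?addr0 => [|k _]; last rewrite mul0r.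
Qed.

Lemma sum_sqr_ge N c : (forall k, (N <= k < 2 * N)%N -> c k ^+ 2 = 1) ->
  N%:R <= \sum_(k < 4 * N) c k ^+ 2.
Proof.
move=> c1; rewrite -(big_mkord xpredT (fun k => c k ^+ 2)) (@big_cat_nat _ _ _ N)//=; last by lia.
apply: ler_wpDl; first by apply: sumr_ge0 => k _; exact: sqr_ge0.
rewrite (@big_cat_nat _ _ _ (2 * N))/=; [|lia|lia].
apply: ler_wpDr; first by apply: sumr_ge0 => k _; exact: sqr_ge0.
by rewrite (eq_big_nat _ _ c1) sumr_const_nat mul2n -addnn addnK.
Qed.

End trigonometric_polynomials.

(** * Trigonometric polynomials integrated against the bump *)

Lemma Rintegral_sum d (T : measurableType d) (R : realType) (mu : {measure set T -> \bar R})
  I (s : seq I) (F : I -> T -> R) :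
  (forall i, mu.-integrable setT (EFin \o F i)) ->
  mu.-integrable setT (EFin \o (fun x => \sum_(i <- s) F i x)) /\
  \int[mu]_x (\sum_(i <- s) F i x) = \sum_(i <- s) \int[mu]_x F i x.
Proof.
move=> iF; elim: s => [|i s [IH1 IH2]].
  split; first by under [X in _.-integrable _ X]eq_fun do rewrite /= big_nil; exact: integrable0.
  by under eq_Rintegral do rewrite big_nil; rewrite big_nil /Rintegral integral0.
split.
  by under [X in _.-integrable _ X]eq_fun do rewrite /= big_cons EFinD; exact: (integrableD measurableT (iF i) IH1).
by under eq_Rintegral do rewrite big_cons; rewrite big_cons -IH2 RintegralD.
Qed.

Section weighted_trigonometric_integrals.
Variables (R : realType) (n : nat).
Local Open Scope complex_scope.
Local Notation d := n.+1.
Local Notation e0 := (delta_mx ord0 ord0 : 'rV[R]_d).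
Local Notation mu := (@lebesgue_rV R d).
Implicit Types (t : 'rV[R]_d) (c : nat -> R).
Variables (g : 'rV[R]_d -> R) (Bg Lg : R).
Hypotheses (mg : measurable_fun setT g) (Bg0 : 0 <= Bg) (Lg0 : 0 <= Lg).
Hypotheses (g0 : forall x, 0 <= g x) (gB : forall x, g x <= Bg * \1_(box 0 1) x).
Hypothesis lipg : forall x (s : R), `|g (s *: e0 + x) - g x| <= Lg * `|s|.

Let G0 := \int[mu]_t g t.

Lemma integrable_g_bounded (h : 'rV[R]_d -> R) M : measurable_fun setT h ->
  (forall t, `|h t| <= M) -> mu.-integrable setT (EFin \o (fun t => g t * h t)).
Proof.
move=> mh hM; apply: (@integrable_le_indic _ _ _ _ _ (box 0 1) (Bg * M)).
- exact: measurable_funM.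
- exact: measurable_box.
- exact: lebesgue_rV_box_fin.
- move=> t; rewrite normrM (ger0_norm (g0 t)) -mulrA (mulrC M) mulrA.
  by apply: ler_pM.
Qed.

Lemma measurable_coord0 : measurable_fun setT (fun t => t ord0 ord0 : R).
Proof. exact: measurable_rV_coord. Qed.

Lemma integrable_g_cos (s : R) :
  mu.-integrable setT (EFin \o (fun t => g t * cos (2 * pi * s * t ord0 ord0))).
Proof.
apply: (@integrable_g_bounded _ 1) => [|t]; last by rewrite ler_norml cos_geN1 cos_le1.
apply: (measurableT_comp (f := cos)).
  by apply: continuous_measurable_fun; exact: continuous_cos.
by apply: measurable_funM => //; exact: measurable_coord0.
Qed.

Lemma Rintegral_g_cos (s : R) : 1 <= `|s| ->
  `|\int[mu]_t (g t * cos (2 * pi * s * t ord0 ord0))| <= Lg * 3 ^+ d / `|s|.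
Proof.
move=> s1; pose w := s *: e0.
have w0 : w ord0 ord0 = s by rewrite !mxE !eqxx mulr1.
have gle x : `|g x| <= Bg * \1_(box 0 1) x by rewrite ger0_norm.
have := @fourier_decay R n g Bg Lg w mg gle Lg0 lipg; rewrite w0 => /(_ s1).
apply: le_trans; apply: le_trans (Re_le_modc _); rewrite /=.
rewrite [X in `|X|](_ : _ = \int[mu]_t (complex.Re ((g t)%:C * wave w t)))//.
apply: eq_Rintegral => t _; rewrite cReM /wave/= mul0r subr0 cosN /w dotrV_e0l.
by rewrite !mulrA.
Qed.

Lemma measurable_modc_trig K c (a : R) :
  measurable_fun setT (fun t => modc (trig K c (a * t ord0 ord0))).
Proof.
rewrite [X in measurable_fun _ X](_ : _ = (fun y : R => Num.sqrt y) \o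
    (fun t => \sum_(k < K) \sum_(l < K)
      c k * c l * cos (a * t ord0 ord0 *+ k - a * t ord0 ord0 *+ l))); last first.
  by apply/funext => t /=; rewrite -modc_trig_sqr sqrtr_sqr ger0_norm// modc_ge0.
apply: (measurableT_comp (f := fun y : R => Num.sqrt y)).
  by apply: continuous_measurable_fun; exact: sqrt_continuous.
apply: measurable_sum => k; apply: measurable_sum => l; apply: measurable_funM => //.
apply: (measurableT_comp (f := cos)).
  by apply: continuous_measurable_fun; exact: continuous_cos.
have m0 j : measurable_fun setT (fun t => a * t ord0 ord0 *+ j).
  under [X in measurable_fun _ X]eq_fun do rewrite -mulr_natr.
  by apply: measurable_funM => //; apply: measurable_funM => //; exact: measurable_coord0.
exact: measurable_funB.
Qed.

(** Approximate Parseval identity for the weight [g]. After expanding the square, the term (k, l) is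
    a Fourier coefficient of [g] at frequency L (k - l): it is [G0] on the diagonal, and O(1/L) for
    each of the remaining pairs. *)
Lemma Rintegral_g_trig_sqr K c (L : R) : 1 <= L -> (forall k, `|c k| <= 1) ->
  `|\int[mu]_t (g t * modc (trig K c (2 * pi * L * t ord0 ord0)) ^+ 2) -
    (\sum_(k < K) c k ^+ 2) * G0| <= K%:R ^+ 2 * (Lg * 3 ^+ d) / L.
Proof.
move=> L1 c1; have L0 : 0 < L by lra.
pose F (k l : 'I_K) t := c k * c l * (g t * cos (2 * pi * (L * (k%:R - l%:R)) * t ord0 ord0)).
have iF k l : mu.-integrable setT (EFin \o F k l).
  exact: (integrableZl measurableT (c k * c l) (integrable_g_cos _)).
have -> : \int[mu]_t (g t * modc (trig K c (2 * pi * L * t ord0 ord0)) ^+ 2) =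
    \sum_(k < K) \sum_(l < K) \int[mu]_t F k l t.
  transitivity (\int[mu]_t (\sum_(k < K) \sum_(l < K) F k l t)).
    apply: eq_Rintegral => t _; rewrite modc_trig_sqr mulr_sumr; apply: eq_bigr => k _.
    rewrite mulr_sumr; apply: eq_bigr => l _; rewrite /F mulrCA; congr (_ * (_ * cos _)).
    rewrite -[X in X - _ = _]mulr_natr -[X in _ - X = _]mulr_natr; ring.
  have [_ ->] := Rintegral_sum (index_enum 'I_K) (F := fun k t => \sum_(l < K) F k l t)
    (fun k => (Rintegral_sum (index_enum 'I_K) (iF k)).1).
  by apply: eq_bigr => k _; have [_ ->] := Rintegral_sum (index_enum 'I_K) (iF k).
have -> : \sum_(k < K) \sum_(l < K) \int[mu]_t F k l t =
    (\sum_(k < K) c k ^+ 2) * G0 + \sum_(k < K) \sum_(l < K | l != k) \int[mu]_t F k l t.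
  rewrite mulr_suml -big_split/=; apply: eq_bigr => k _; rewrite (bigD1 k)//=; congr (_ + _).
  rewrite -RintegralZl//; last first.
    apply: (@integrable_le_indic _ _ _ _ _ (box 0 1) Bg) => //.
    - exact: measurable_box.
    - exact: lebesgue_rV_box_fin.
    - by move=> t; rewrite ger0_norm.
  by apply: eq_Rintegral => t _; rewrite /F subrr mulr0 mulr0 mul0r cos0 mulr1 expr2.
rewrite addrC addKr.
apply: (le_trans (ler_norm_sum _ _ _)).
apply: (@le_trans _ _ (\sum_(k < K) (K%:R * (Lg * 3 ^+ d) / L))); last first.
  by rewrite sumr_const card_ord -mulr_natl le_eqVlt; apply/orP; left; apply/eqP; ring.
have Kd0 : 0 <= Lg * 3 ^+ d / L by rewrite divr_ge0 ?(ltW L0)// mulr_ge0// exprn_ge0.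
apply: ler_sum => k _; apply: (le_trans (ler_norm_sum _ _ _)).
apply: (@le_trans _ _ (\sum_(l < K | l != k) (Lg * 3 ^+ d / L))); last first.
  rewrite big_mkcond/= -[leRHS]mulrA mulr_natl -[in leRHS](card_ord K) -sumr_const.
  by apply: ler_sum => l _; case: ifP.
apply: ler_sum => l lk.
have kl1 : 1 <= `|k%:R - l%:R : R|.
  have : (0 < `|k%:Z - l%:Z|)%R by rewrite normr_gt0 subr_eq0 eq_sym.
  by rewrite gtz0_ge1 -(ler1z R) intr_norm intrB.
have Lk : L <= `|L * (k%:R - l%:R)|.
  by rewrite normrM (ger0_norm (_ : 0 <= L)) ?ler_peMr//; lra.
rewrite /F RintegralZl//; last exact: integrable_g_cos.
rewrite normrM -[leRHS]mul1r; apply: ler_pM => //.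
  by rewrite normrM -[leRHS]mulr1; apply: ler_pM.
apply: (le_trans (Rintegral_g_cos _)); first by lra.
by rewrite ler_wpM2l ?mulr_ge0 ?exprn_ge0// lef_pV2// posrE; lra.
Qed.

(** The kernel is D_N D_(2N) / N, of modulus at most (|D_N|^2 + |D_(2N)|^2) / N. By the approximate
    Parseval identity the integrals of the two squares are at most N G0 + G0/2 and 2 N G0 + G0/2,
    with sum at most 4 N G0. *)
Lemma Rintegral_g_vp N (L : R) : (0 < N)%N -> 1 <= L ->
  (4 * N)%:R ^+ 2 * (Lg * 3 ^+ d) / L <= G0 / 2 ->
  \int[mu]_t (g t * modc (trig (4 * N) (vp R N) (2 * pi * L * t ord0 ord0))) <= 4 * G0.
Proof.
move=> N0 L1 errL; have NR0 : 0 < N%:R :> R by rewrite ltr0n.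
have L0 : 0 < L by lra.
have Kd0 : 0 <= Lg * 3 ^+ d by rewrite mulr_ge0// exprn_ge0.
pose D M t : R := modc (trig M (fun=> 1) (2 * pi * L * t ord0 ord0)).
have c1 : forall k : nat, `|1 : R| <= 1 by rewrite normr1.
have D_le M t : D M t <= M%:R by exact: modc_trig_le.
have D0 M t : 0 <= D M t by exact: modc_ge0.
have mD M : measurable_fun setT (D M) by exact: measurable_modc_trig.
have mul_le_sqrD (x y : R) : x * y <= x ^+ 2 + y ^+ 2.
  rewrite -subr_ge0 (_ : _ - _ = ((x - y) ^+ 2 + x ^+ 2 + y ^+ 2) / 2); last by field.
  by rewrite divr_ge0// !addr_ge0 ?sqr_ge0.
have iD M : mu.-integrable setT (EFin \o (fun t => g t * D M t ^+ 2)).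
  apply: (@integrable_g_bounded _ (M%:R ^+ 2)) => [|t]; first exact: measurable_funX.
  by rewrite ger0_norm ?sqr_ge0// lerXn2r ?nnegrE.
have ID M : (M <= 4 * N)%N -> \int[mu]_t (g t * D M t ^+ 2) <= M%:R * G0 + G0 / 2.
  move=> M4; have := Rintegral_g_trig_sqr M L1 c1.
  rewrite (eq_bigr (fun=> 1)); last by move=> k _; rewrite expr1n.
  rewrite sumr_const card_ord => /(le_trans (ler_norm _)); rewrite lerBlDl => /le_trans; apply.
  rewrite lerD2l; apply: le_trans errL; rewrite ler_wpM2r ?invr_ge0 ?(ltW L0)//.
  by rewrite ler_wpM2r// lerXn2r ?nnegrE// ler_nat.
apply: (@le_trans _ _ (\int[mu]_t (N%:R^-1 * (g t * D N t ^+ 2 + g t * D (2 * N)%N t ^+ 2)))).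
  have iDD : mu.-integrable setT (EFin \o (fun t => g t * D N t ^+ 2 + g t * D (2 * N)%N t ^+ 2)).
    exact: (integrableD measurableT (iD N) (iD (2 * N)%N)).
  apply: le_Rintegral => //.
  - apply: (@integrable_g_bounded _ (4 * N)%:R) => [|t]; first exact: measurable_modc_trig.
    rewrite ger0_norm ?modc_ge0//; apply: modc_trig_le => k.
    by rewrite ger0_norm ?vp_ge0// vp_le1.
  - exact: (integrableZl measurableT N%:R^-1 iDD).
  move=> t _; rewrite trig_vp// !modcM modc_real -/(D N t) -/(D (2 * N)%N t).
  rewrite ger0_norm ?invr_ge0// -mulrDr mulrCA; apply: ler_wpM2l; first by rewrite invr_ge0.
  apply: ler_wpM2l => //; exact: mul_le_sqrD.
rewrite RintegralZl//; last first.
  exact: (integrableD measurableT (iD N) (iD (2 * N)%N)).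
rewrite RintegralD// mulrC ler_pdivrMr//.
have := ID N; have := ID (2 * N)%N.
have G00 : 0 <= G0 by apply: Rintegral_ge0.
have N1 : 1 <= N%:R :> R by rewrite ler1n.
rewrite natrM => /(_ _)/le_trans H2 /(_ _)/le_trans H1.
apply: (@le_trans _ _ ((N%:R * G0 + G0 / 2) + (2 * N%:R * G0 + G0 / 2))).
  by apply: lerD; [exact: (H1 _ (leq_pmull N (isT : 0 < 4)%N) (lexx _))|apply: H2; [lia|exact: lexx]].
rewrite (_ : 4 * G0 * N%:R = N%:R * G0 + G0 / 2 + (2 * N%:R * G0 + G0 / 2) +
  (N%:R * G0 - G0)); last by field.
by rewrite lerDl subr_ge0 ler_peMl.
Qed.

End weighted_trigonometric_integrals.

Section weighted_lower_bound.
Variables (R : realType) (n : nat).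
Local Notation mu := (@lebesgue_rV R n).
Implicit Types (t : 'rV[R]_n).
Variables (g : 'rV[R]_n -> R) (Bg : R).
Hypotheses (mg : measurable_fun setT g) (Bg0 : 0 < Bg).
Hypotheses (g0 : forall x, 0 <= g x) (gB : forall x, g x <= Bg * \1_(box 0 1) x).

Lemma unit_cube0 : unit_cube 0 = box 0 1 :> set 'rV[R]_n.
Proof. by rewrite unit_cubeE; congr box; apply/rowP => i; rewrite !mxE. Qed.

(** [G] is a measurable minorant standing in for |A|^rho, so [A] itself is never asked to be
    measurable. For r = +oo any finite rho is allowed: |A|^rho <= S^rho almost everywhere on a cube
    of mass 1. *)
Lemma Rintegral_le_cube_norm (r : \bar R) (rho : R) (A : 'rV[R]_n -> R[i])
    (G : 'rV[R]_n -> R) (M S : R) :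
  (r = rho%:E \/ r = +oo%E) -> 1 <= rho -> 0 <= S -> measurable_fun setT G ->
  (forall t, `|G t| <= M) ->
  (forall t, g t != 0 -> G t <= modc (A t) `^ rho) ->
  (cube_norm r A 0 <= S%:E)%E -> \int[mu]_t (g t * G t) <= Bg * S `^ rho.
Proof.
move=> rE rho1 S0 mG GM GA AS; have rho0 : rho != 0 by rewrite gt_eqF//; lra.
(* The weight [g / Bg] is at most the indicator of the unit cube, and the positive part keeps [F]
   nonnegative; hence [F] is below |A|^rho on the cube and 0 elsewhere. *)
pose F t := Bg^-1 * (g t * Num.max (G t) 0).
have F0 t : 0 <= F t.
  apply: mulr_ge0; first by rewrite invr_ge0 ltW.
  by apply: mulr_ge0 => //; rewrite le_max lexx orbT.
have mF : measurable_fun setT F.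
  by apply: measurable_funM => //; apply: measurable_funM => //; exact: measurable_maxr.
have FA t : F t <= (modc (A t) * \1_(unit_cube 0) t) `^ rho.
  have [gt0|gt0] := eqVneq (g t) 0; first by rewrite /F gt0 mul0r mulr0 powR_ge0.
  have gtp : 0 < g t by rewrite lt0r gt0 g0.
  rewrite unit_cube0; have := gB t; rewrite indicE; case: (_ \in _) => gtB; last first.
    by move: gtB; rewrite mulr0 leNgt gtp.
  rewrite mulr1 in gtB *; rewrite /F mulrA -[leRHS]mul1r; apply: ler_pM.
  - by rewrite mulr_ge0 ?invr_ge0// ltW.
  - by rewrite le_max lexx orbT.
  - by rewrite mulrC ler_pdivrMr// mul1r.
  - by rewrite ge_max powR_ge0 andbT; rewrite mulr1; exact: GA.
have IF : (\int[mu]_t (F t)%:E <= (S `^ rho)%:E)%E.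
  case: rE => rE; rewrite {}rE in AS.
    apply: (@le_trans _ _ (\int[mu]_t ((modc (A t) * \1_(unit_cube 0) t) `^ rho)%:E)%E).
      by apply: ge0_le_integral_nomeas => t; rewrite lee_fin.
    rewrite -poweR_EFin.
    have -> : (\int[mu]_t ((modc (A t) * \1_(unit_cube 0) t) `^ rho)%:E)%E =
        (cube_norm rho%:E A 0 `^ rho)%E.
      rewrite cube_norm_fin -[in RHS](invrK rho) -poweRrM invrK mulVf// poweRe1//.
      by apply: integral_ge0 => t _; rewrite lee_fin powR_ge0.
    by apply: ler_poweR_nneg => //; [lra|exact: cube_norm_ge0].
  rewrite cube_norm_y in AS; have {}AS := ess_supP AS.
  apply: (@le_trans _ _ (\int[mu]_t ((S `^ rho)%:E * (\1_(unit_cube 0) t)%:E))%E).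
    apply: ae_ge0_le_integral => //.
    - by move=> t _; rewrite lee_fin.
    - exact/measurable_EFinP.
    - by move=> t _; rewrite -EFinM lee_fin mulr_ge0// powR_ge0.
    - apply/measurable_EFinP; apply: measurable_funM => //.
      by apply: measurable_indic; exact: measurable_unit_cube.
    apply: filterS AS => t; rewrite lee_fin => At _; rewrite -EFinM lee_fin.
    apply: le_trans (FA t) _; move: At; rewrite indicE; case: (_ \in _).
      by rewrite !mulr1 => At; apply: ge0_ler_powR; rewrite ?nnegrE ?modc_ge0//; lra.
    by rewrite !mulr0 powR0.
  rewrite ge0_integralZl ?lee_fin ?powR_ge0//; last first.
    by apply/measurable_EFinP; apply: measurable_indic; exact: measurable_unit_cube.
  rewrite integral_indic//; last exact: measurable_unit_cube.
  by rewrite setIT [X in (_ * X)%E]lebesgue_unit_cube mule1.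
have igb (h : 'rV[R]_n -> R) : measurable_fun setT h -> (forall t, `|h t| <= M) ->
    mu.-integrable setT (EFin \o (fun t => g t * h t)).
  move=> mh hM; apply: (@integrable_le_indic _ _ _ _ _ (box 0 1) (Bg * M)).
  - exact: measurable_funM.
  - exact: measurable_box.
  - exact: lebesgue_rV_box_fin.
  - move=> t; rewrite normrM (ger0_norm (g0 t)) -mulrA (mulrC M) mulrA.
    by apply: ler_pM.
have im : mu.-integrable setT (EFin \o (fun t => g t * Num.max (G t) 0)).
  apply: igb; first exact: measurable_maxr.
  move=> t; rewrite ger0_norm ?le_max ?lexx ?orbT// ge_max.
  by rewrite (le_trans (ler_norm _) (GM t)) (le_trans (normr_ge0 (G t))).
apply: (@le_trans _ _ (\int[mu]_t (g t * Num.max (G t) 0))).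
  apply: le_Rintegral => //; first exact: igb.
  by move=> t _; apply: ler_wpM2l => //; rewrite le_max lexx.
rewrite -ler_pdivrMl// -RintegralZl// -lee_fin.
apply: le_trans IF; rewrite /Rintegral fineK//.
exact: integrable_fin_num (integrableZl measurableT Bg^-1 im).
Qed.

End weighted_lower_bound.

Section growth_comparison.
Variable R : realType.

(** Powers of two are the lengths of the Rudin-Shapiro polynomials. If a > b, all powers of 2^(a-b)
    > 1 would be at most [K], against Bernoulli's inequality. *)
Lemma powR_pow2_le (K a b : R) :
  (forall n : nat, (2 ^+ n) `^ a <= K * (2 ^+ n) `^ b) -> a <= b.
Proof.
move=> H; rewrite leNgt; apply/negP => ba.
have e0 : 0 < a - b by rewrite subr_gt0.
have p2 (x : R) k : (2 ^+ k) `^ x = (2 `^ x) ^+ k.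
  by rewrite -powR_mulrn// -powRrM mulrC powRrM powR_mulrn// powR_ge0.
pose y : R := 2 `^ (a - b).
have y1 : 1 < y.
  have : (1 : R) `^ (a - b) < 2 `^ (a - b).
    by apply: gt0_ltr_powR; rewrite ?nnegrE//; lra.
  by rewrite powR1.
have Hy k : y ^+ k <= K.
  have := H k; rewrite !p2 -ler_pdivrMr; last by rewrite exprn_gt0// powR_gt0.
  by rewrite -expr_div_n /y powRB ?pnatr_eq0 ?implybT.
have K0 : 0 < K by apply: lt_le_trans (Hy 0); rewrite expr0.
have bern k : 1 + k%:R * (y - 1) <= y ^+ k.
  elim: k => [|k IH]; first by rewrite expr0 mul0r addr0.
  rewrite exprS; apply: (@le_trans _ _ (y * (1 + k%:R * (y - 1)))); last first.
    by rewrite ler_pM2l//; lra.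
  have k0 : 0 <= k%:R :> R by []. 
  rewrite -subr_ge0 (_ : _ - _ = k%:R * (y - 1) ^+ 2).
    by rewrite mulr_ge0 ?sqr_ge0.
  by rewrite -natr1; ring.
have y10 : 0 < y - 1 by lra.
have := archi_boundP (ltW (divr_gt0 K0 y10)); rewrite ltr_pdivrMr// => Kk.
have := le_trans (bern _) (Hy (Num.bound (K / (y - 1)))); rewrite leNgt => /negP; apply.
by rewrite (lt_le_trans Kk)// lerDr.
Qed.

End growth_comparison.

(** * Test functions and symbols: Schwartz class and amalgam norms *)

Section test_functions.
Variables (R : realType) (n : nat).
Local Open Scope complex_scope.
Local Notation d := n.+1.
Local Notation e0 := (delta_mx ord0 ord0 : 'rV[R]_d).
Implicit Types (t : 'rV[R]_d) (z : 'rV[R]_(d + d)) (b c : nat -> R).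
Variables (g : 'rV[R]_d -> R) (Bg : R).
Hypotheses (smg : smoothR g) (Bg0 : 0 <= Bg).
Hypotheses (g0 : forall x, 0 <= g x) (gB : forall x, g x <= Bg * \1_(box 0 1) x).

Lemma weight_neq0_box t : g t != 0 -> box 0 1 t.
Proof.
move=> gt; apply: contrapT => tb; have := gB t; rewrite indicE memNset// mulr0 => gt0.
by move/eqP: gt; apply; apply/le_anti; rewrite gt0 g0.
Qed.

Let gBg t : g t <= Bg.
Proof.
apply: le_trans (gB t) _; rewrite indicE; case: (_ \in _); first by rewrite mulr1.
by rewrite mulr0.
Qed.

Lemma continuous_rV m1 m2 (h : 'rV[R]_m1 -> 'rV[R]_m2) :
  (forall j, continuous (fun x => h x ord0 j)) -> continuous h.
Proof.
move=> hc x A /(nbhs_ballP (h x))[e e_gt0 eA].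
have : \forall y \near nbhs x, forall j : 'I_m2, ball (h x ord0 j) e (h y ord0 j).
  apply: (@filter_forall _ _ _ (nbhs x) (nbhs_filter x)) => j.
  by apply: (hc j x); apply/nbhs_ballP; exists e.
apply: (@filterS _ (nbhs x) (nbhs_filter x)) => y H.
by apply: eA; split=> // i j; rewrite (ord1 i).
Qed.

Lemma coord_affine_id m : coord_affine (@id 'rV[R]_m).
Proof.
split; first by move=> x; exact: cvg_id.
by move=> i; exists 1, i => x s; rewrite mulr1.
Qed.

Lemma coord_affine_lsubmx : coord_affine (fun z => lsubmx z).
Proof.
split.
  apply: continuous_rV => j; rewrite (_ : (fun _ => _) = (fun z => z ord0 (lshift d j))).
    exact: coord_continuous.
  by apply/funext => z; rewrite mxE.
move=> i; case: (split_ordP i) => j ->.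
  exists 1, j => z s; apply/rowP => k; by rewrite !mxE mulr1 (inj_eq (@lshift_inj _ _)).
exists 0, ord0 => z s; apply/rowP => k; rewrite !mxE mulr0 mul0r add0r.
by rewrite eq_lrshift andbF mulr0 add0r.
Qed.

Lemma coord_affine_rsubmxB (v : 'rV[R]_d) : coord_affine (fun z => rsubmx z - v).
Proof.
split.
  apply: continuous_rV => j; rewrite (_ : (fun _ => _) = (fun z => z ord0 (rshift d j) - v ord0 j)).
    by move=> z; apply: continuousB; [exact: coord_continuous|exact: cst_continuous].
  by apply/funext => z; rewrite !mxE.
move=> i; case: (split_ordP i) => j ->.
  exists 0, ord0 => z s; apply/rowP => k; rewrite !mxE mulr0 mul0r add0r.
  by rewrite eq_rlshift andbF mulr0 add0r.
exists 1, j => z s; apply/rowP => k; rewrite !mxE mulr1 addrA.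
by rewrite (inj_eq (@rshift_inj _ _)).
Qed.

Variables (K L : nat).
Hypothesis L1 : (0 < L)%N.

Let smgen_g : smgen g.
Proof. exact: (smgen_comp smg (coord_affine_id d)). Qed.

Lemma schwartz_test_fun c : schwartz (test_fun g K L%:R c).
Proof.
have E (t : 'rV[R]_d) k : 2 * pi * L%:R * t ord0 ord0 *+ k = 2 * pi * L%:R * k%:R * t ord0 ord0.
  by rewrite -mulr_natr mulrAC.
rewrite (_ : test_fun _ _ _ _ = (fun t =>
  ((\sum_(k < K) c k * cos (2 * pi * L%:R * k%:R * t ord0 ord0)) * g t) +i*
  ((\sum_(k < K) c k * sin (2 * pi * L%:R * k%:R * t ord0 ord0)) * g t))); last first.
  apply/funext => t; apply/eqP; rewrite eq_complex /test_fun cReM cImM/= !mulr0 subr0 add0r.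
  have -> : complex.Re (trig K c (2 * pi * L%:R * t ord0 ord0)) =
      \sum_(k < K) c k * cos (2 * pi * L%:R * k%:R * t ord0 ord0).
    rewrite /trig; elim/big_ind2 : _ => //= [x1 x2 y1 y2 <- <-|k _]; first by rewrite cReD.
    by rewrite mul0r subr0 E.
  have -> : complex.Im (trig K c (2 * pi * L%:R * t ord0 ord0)) =
      \sum_(k < K) c k * sin (2 * pi * L%:R * k%:R * t ord0 ord0).
    rewrite /trig; elim/big_ind2 : _ => //= [x1 x2 y1 y2 <- <-|k _]; first by rewrite cImD.
    by rewrite mul0r addr0 E.
  by rewrite !eqxx.
have sup (h : 'rV[R]_d -> R) : supported (fun t => h t * g t) 1.
  move=> t; rewrite mulf_eq0 negb_or => /andP[_ /weight_neq0_box tb] i.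
  by have := tb i; rewrite mxE add0r => /andP[t0 /ltW t1]; rewrite ger0_norm.
apply: (@supported_schwartz _ _ _ _ 1) => //.
- apply: smgen_smoothR; apply: smgen_mul => //; apply: smgen_sum => k.
  by apply: smgen_mul; [exact: smgen_cst|exact: smgen_cos].
- apply: smgen_smoothR; apply: smgen_mul => //; apply: smgen_sum => k.
  by apply: smgen_mul; [exact: smgen_cst|exact: smgen_sin].
Qed.

Let term (l : nat) z : R := g (lsubmx z) * g (rsubmx z - (L%:R * l%:R) *: e0).

Let term_neq0 l z : term l z != 0 ->
  box 0 1 (lsubmx z) /\ box 0 1 (rsubmx z - (L%:R * l%:R) *: e0).
Proof. by rewrite /term mulf_eq0 negb_or => /andP[/weight_neq0_box ? /weight_neq0_box ?]. Qed.

(** As [L] is a natural number, the l-th bump of the symbol lies in exactly one integer cube, the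
    one with this corner. *)
Let cell (l : nat) : 'rV[int]_(d + d) := row_mx 0 ((L * l)%N%:Z *: delta_mx ord0 ord0).

Let unit_cube_cell l z : term l z != 0 -> unit_cube (cell l) z.
Proof.
move=> /term_neq0[lb rb] i; case: (split_ordP i) => j ->.
  by have := lb j; rewrite /cell row_mxEl !mxE.
have := rb j; rewrite /cell row_mxEr !mxE eqxx/=; case: (j == ord0).
  by rewrite !mulr1 add0r subr_ge0 ltrBlDr -!natrM addrC.
by rewrite !mulr0 subr0.
Qed.

Lemma unit_cube_inj m (k k' : 'rV[int]_m) (x : 'rV[R]_m) :
  unit_cube k x -> unit_cube k' x -> k = k'.
Proof.
move=> xk xk'; apply/rowP => i.
have fl (j : 'rV[int]_m) : unit_cube j x -> Num.floor (x ord0 i) = j ord0 i.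
  by move=> xj; apply: floor_def; rewrite intrD; exact: xj.
by rewrite -(fl _ xk) -(fl _ xk').
Qed.

Let cell_inj : injective cell.
Proof.
move=> l l' /rowP/(_ (rshift d ord0)); rewrite /cell !row_mxEr !mxE !eqxx !mulr1 => -[].
by move/eqP; rewrite eqn_pmul2l// => /eqP.
Qed.

Lemma test_symbolE b z : test_symbol g K L%:R b z = (\sum_(l < K) b l * term l z)%:C.
Proof. by rewrite /test_symbol rmorph_sum/=; apply: eq_bigr => l _; rewrite [RHS]rmorphM. Qed.

Lemma schwartz_test_symbol b : schwartz (test_symbol g K L%:R b).
Proof.
rewrite (_ : test_symbol _ _ _ _ = (fun z => (\sum_(l < K) b l * term l z) +i* 0)); last first.
  by apply/funext => z; rewrite test_symbolE.
apply: (@supported_schwartz _ _ _ _ (L%:R * K%:R + 1)).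
- apply: smgen_smoothR; apply: smgen_sum => l; apply: smgen_mul; first exact: smgen_cst.
  apply: smgen_mul; first exact: (smgen_comp smg coord_affine_lsubmx).
  exact: (smgen_comp smg (coord_affine_rsubmxB _)).
- exact: smgen_smoothR (smgen_cst _ _).
- move=> z sz; have [l tl] : exists l : 'I_K, term l z != 0.
    apply: contrapT => /forallNP H; move/eqP: sz; apply; apply: big1 => l _.
    by have /negP/negPn/eqP -> := H l; rewrite mulr0.
  have [lb rb] := term_neq0 tl; move=> i; case: (split_ordP i) => j ->.
    have := lb j; rewrite !mxE => /andP[z0 z1]; rewrite ger0_norm//.
    by rewrite ltW// (lt_le_trans z1)// add0r lerDr mulr_ge0.
  have := rb j; rewrite !mxE eqxx/= => /andP[].
  have LlK : L%:R * l%:R <= L%:R * K%:R :> R by rewrite ler_wpM2l// ler_nat ltnW.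
  have Ll0 : 0 <= L%:R * l%:R :> R by rewrite mulr_ge0.
  by case: (j == ord0); rewrite ?mulr1 ?mulr0 => z0 z1; rewrite ger0_norm; lra.
- by move=> z /eqP.
Qed.

(** Distinct bumps lie in distinct cubes, so at most one term is nonzero at each point: the symbol
    is bounded by [Bg ^+ 2], uniformly in [K], and meets only [K] cubes. *)
Lemma amalgam_norm_test_symbol b (p q : \bar R) : (1 <= p)%E -> (1 <= q)%E -> (0 < K)%N ->
  (forall l, `|b l| <= 1) ->
  (amalgam_norm p q (test_symbol g K L%:R b) <= (Bg ^+ 2 * card_pow K q)%:E)%E.
Proof.
move=> p1 q1 K0 b1; pose s := [seq cell l | l <- iota 0 K].
have sK : size s = K by rewrite size_map size_iota.
rewrite -sK; apply: amalgam_norm_le => //; rewrite ?sqr_ge0 ?sK//.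
- move=> k; apply: cube_norm_le => //; first exact: sqr_ge0.
  move=> z _; rewrite test_symbolE modc_real.
  have [[l tl]|Nex] := pselect (exists l : 'I_K, term l z != 0).
    rewrite (bigD1 l)//= big1 ?addr0.
      rewrite normrM -[leRHS]mul1r; apply: ler_pM => //.
      by rewrite /term normrM !ger0_norm// expr2; apply: ler_pM.
    move=> l' l'l; have [->|tl'] := eqVneq (term l' z) 0; first by rewrite mulr0.
    have := unit_cube_inj (unit_cube_cell tl) (unit_cube_cell tl') => /cell_inj/val_inj ll'.
    by rewrite ll' eqxx in l'l.
  rewrite big1 ?normr0 ?sqr_ge0// => l _.
  move/forallNP: Nex => /(_ l)/negP/negPn/eqP ->; by rewrite mulr0.
- move=> k z kz; rewrite test_symbolE => nz.
  have [l tl] : exists l : 'I_K, term l z != 0.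
    apply: contrapT => /forallNP H; move/eqP: nz; apply; rewrite big1// => l _.
    by have /negP/negPn/eqP -> := H l; rewrite mulr0.
  rewrite (unit_cube_inj kz (unit_cube_cell tl)).
  by apply/mapP; exists (l : nat) => //; rewrite mem_iota/=.
Qed.

Lemma card_pow1 (q : \bar R) : card_pow 1 q = 1.
Proof. by case: q => //= r; rewrite powR1. Qed.

Lemma amalgam_norm_test_fun c (r s : \bar R) M : (1 <= r)%E -> (1 <= s)%E -> 0 <= M ->
  (cube_norm r (test_fun g K L%:R c) 0 <= M%:E)%E ->
  (amalgam_norm r s (test_fun g K L%:R c) <= M%:E)%E.
Proof.
move=> r1 s1 M0 fM.
have nz k x : unit_cube k x -> test_fun g K L%:R c x != 0 -> k = 0.
  move=> kx fx; apply: unit_cube_inj kx _; rewrite unit_cube0; apply: weight_neq0_box.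
  by apply: contraNneq fx => gx; rewrite /test_fun gx mulr0.
have -> : M%:E = (M * card_pow (size [:: 0 : 'rV[int]_d]) s)%:E by rewrite card_pow1 mulr1.
apply: amalgam_norm_le => // [k|k x kx fx]; last by rewrite (nz _ _ kx fx) mem_head.
have [->//|k0] := eqVneq k 0; rewrite cube_norm_eq0 ?lee_fin// => x kx.
by apply/eqP; apply: contraNT k0 => fx; apply/eqP; exact: nz fx.
Qed.

Lemma cube_norm_test_fun_flat c (r : \bar R) W : (1 <= r)%E -> 0 <= W ->
  (forall theta, modc (trig K c theta) <= W) ->
  (cube_norm r (test_fun g K L%:R c) 0 <= (W * Bg)%:E)%E.
Proof.
move=> r1 W0 cW; apply: cube_norm_le => //; first exact: mulr_ge0.
move=> t _; rewrite /test_fun modcM modc_real ger0_norm//.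
by apply: ler_pM; rewrite ?modc_ge0.
Qed.

End test_functions.

(** * The two families of test pairs *)

Section powR_inequalities.
Variable R : realType.
Implicit Types (x y rho lam : R).

(** If e <= y then x <= 2y; otherwise x/2 <= e and the left side is nonpositive. This passes an
    additive error through the power rho. *)
Lemma powR_half_sub rho x y e : 1 <= rho -> 0 <= x -> 0 <= y -> 0 <= e -> x <= y + e ->
  (x / 2) `^ rho - e `^ rho <= y `^ rho.
Proof.
move=> rho1 x0 y0 e0 xye; have rho0 : 0 <= rho by lra.
have [ey|ye] := leP e y.
  rewrite lerBlDr; apply: (@le_trans _ _ (y `^ rho)); last by rewrite lerDl powR_ge0.
  by apply: ge0_ler_powR; rewrite ?nnegrE ?divr_ge0//; lra.
apply: (@le_trans _ _ 0); last exact: powR_ge0.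
rewrite subr_le0; apply: ge0_ler_powR; rewrite ?nnegrE ?divr_ge0//; lra.
Qed.

(** As rho/2 - 1 <= 0, replacing x^2 by its upper bound [lam] decreases the power. Integrated, this
    bounds an L^rho norm from below by the L^2 norm and the supremum. *)
Lemma sqrM_powR_le rho x lam : 0 < rho <= 2 -> 0 <= x -> x ^+ 2 <= lam ->
  x ^+ 2 * lam `^ (rho / 2 - 1) <= x `^ rho.
Proof.
move=> /andP[rho0 rho2]; rewrite le_eqVlt => /predU1P[<- _|x0 xl].
  by rewrite expr0n mul0r powR_ge0.
have x20 : 0 < x ^+ 2 by rewrite exprn_gt0.
have l0 : 0 < lam by exact: lt_le_trans xl.
have -> : x `^ rho = x ^+ 2 * (x ^+ 2) `^ (rho / 2 - 1).
  rewrite mulr_powRB1; [|exact: ltW|by rewrite divr_gt0].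
  by rewrite -powR_mulrn ?(ltW x0)// -powRrM; congr (_ `^ _); field.
rewrite ler_wpM2l ?(ltW x20)// -(opprB 1) !powRN lef_pV2 ?posrE ?powR_gt0//.
by apply: ge0_ler_powR; rewrite ?nnegrE ?(ltW x20) ?(ltW l0)//; lra.
Qed.

(** The left side is nonpositive for x <= lam; beyond, x^(rho-2) >= lam^(rho-2). Integrated, this
    bounds an L^rho norm from below by the L^2 and L^1 norms. *)
Lemma powR_ge_quadratic rho x lam : 2 <= rho -> 0 <= x -> 0 < lam ->
  lam `^ (rho - 2) * (x ^+ 2 - lam * x) <= x `^ rho.
Proof.
move=> rho2 x0 l0; have [xl|lx] := leP x lam.
  apply: (@le_trans _ _ 0); last exact: powR_ge0.
  by rewrite mulr_ge0_le0 ?powR_ge0// subr_le0 expr2 ler_wpM2r.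
have x0' : 0 < x by exact: lt_trans lx.
have -> : x `^ rho = x `^ (rho - 2) * x ^+ 2.
  rewrite -powR_mulrn// -powRD; first by congr (_ `^ _); lra.
  by rewrite (gt_eqF x0') implybT.
apply: ler_pM; rewrite ?powR_ge0//.
- by rewrite subr_ge0 expr2 ler_wpM2r// ltW.
- by apply: ge0_ler_powR; rewrite ?nnegrE//; lra.
- by rewrite gerBl mulr_ge0// ltW.
Qed.

(** The main term is at least (c G/4)(2 N T), and the error at most (c G/8)(2 N T): half of it is
    left. *)
Lemma subr_main_le (c G T N I e U : R) : 0 < c -> 0 < G -> 0 <= T -> N / 2 * G <= I ->
  e <= c / 8 -> 1 <= 2 * N * T -> c * T * I - e * G <= U -> c * G / 8 * (2 * N * T) <= U.
Proof.
move=> c0 G1 T0 NI ec NT; apply: le_trans.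
have H1 : c * T * (N / 2 * G) <= c * T * I by rewrite ler_wpM2l// mulr_ge0// ltW.
have H2 : e * G <= c / 8 * G by rewrite ler_wpM2r// ltW.
have H3 : c / 8 * G <= c / 8 * G * (2 * N * T).
  by rewrite ler_peMr// mulr_ge0 ?divr_ge0// ltW.
have -> : c * G / 8 * (2 * N * T) = c * T * (N / 2 * G) - c / 8 * G * (2 * N * T) by field.
by apply: lerB => //; exact: le_trans H3.
Qed.

(** The main term is at least 4 c G lam T since 8 - 4 = 4, and the error takes away at most an
    eighth of c G lam T. *)
Lemma subr_main_quadratic_le (c G T lam I2 I1 e U : R) : 0 < c -> 0 < G -> 0 <= T ->
  0 <= lam -> 8 * lam * G <= I2 -> I1 <= 4 * G -> e <= c / 8 -> 1 <= lam * T ->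
  c * (T * (I2 - lam * I1)) - e * G <= U -> c * G * (lam * T) <= U.
Proof.
move=> c0 G1 T0 l0 HI2 HI1 ec lT; apply: le_trans.
have H1 : c * (T * (8 * lam * G - lam * (4 * G))) <= c * (T * (I2 - lam * I1)).
  by rewrite ler_wpM2l ?(ltW c0)// ler_wpM2l// lerB// ler_wpM2l.
have H2 : e * G <= c / 8 * G by rewrite ler_wpM2r// ltW.
have cG : 0 <= c / 8 * G by rewrite mulr_ge0 ?divr_ge0// ltW.
have H3 : c / 8 * G <= c / 8 * G * (lam * T) by rewrite ler_peMr.
have H4 : 0 <= c / 8 * G * (lam * T) by rewrite mulr_ge0//; exact: le_trans lT.
apply: le_trans (lerB H1 (le_trans H2 H3)).
rewrite -subr_ge0 (_ : _ - _ = 23 * (c / 8 * G * (lam * T))); last by field.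
by rewrite mulr_ge0.
Qed.

(** [fine] of the inverse of [+oo] is 0, so a single real exponent covers both cases. *)
Lemma card_powE K (q : \bar R) : (0 < K)%N -> (1 <= q)%E ->
  card_pow K q = K%:R `^ fine (q^-1)%E.
Proof.
case: q => [r||]// K0 r1 /=; last by rewrite powRr0.
by rewrite inver gt_eqF//; rewrite lee_fin in r1; lra.
Qed.

End powR_inequalities.

Section necessary_condition.
Variables (R : realType) (n : nat).
Local Notation d := n.+1.
Local Notation e0 := (delta_mx ord0 ord0 : 'rV[R]_d).
Local Notation mu := (@lebesgue_rV R d).
Implicit Types (t : 'rV[R]_d) (b c : nat -> R).
Variables (g p1 p2 : 'rV[R]_d -> R) (Bg B1 B2 Lg L1 : R).
Hypotheses (smg : smoothR g) (mg : measurable_fun setT g) (mp1 : measurable_fun setT p1)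
  (mp2 : measurable_fun setT p2).
Hypotheses (Bg0 : 0 < Bg) (B10 : 0 <= B1) (B20 : 0 <= B2) (Lg0 : 0 <= Lg) (L10 : 0 <= L1).
Hypotheses (g0 : forall x, 0 <= g x) (gB : forall x, g x <= Bg * \1_(box 0 1) x).
Hypotheses (p1B : forall x, `|p1 x| <= B1) (p2B : forall x, `|p2 x| <= B2).
Hypotheses (lipg : forall x (s : R), `|g (s *: e0 + x) - g x| <= Lg * `|s|)
  (lip1 : forall x (s : R), `|p1 (s *: e0 + x) - p1 x| <= L1 * `|s|).
Variables (a0 : 'rV[R]_d) (wd : R).
Hypotheses (wd0 : 0 < wd) (g_half : forall x, box a0 wd x -> 1 / 2 <= g x).
Hypotheses (p1_half : forall x v, g x != 0 -> g v != 0 -> 1 / 2 <= p1 (v - x))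
  (p2_half : forall x v, g x != 0 -> g v != 0 -> 1 / 2 <= p2 (v - x))
  (cos_half : forall w t v, g w != 0 -> g t != 0 -> g v != 0 ->
     1 / 2 <= cos (2 * pi * dotrV w t - 2 * pi * dotrV w v)).
Variables (p q r s : \bar R) (C : R).
Hypotheses (hp : (1 <= p)%E) (hq : (1 <= q)%E) (hr : (1 <= r)%E) (hs : (1 <= s)%E)
  (hC : 0 < C).
Local Notation locop := (localization_op (fun x => (p1 x)%:C%C) (fun x => (p2 x)%:C%C)).
Hypothesis hbound : forall f a, schwartz f -> schwartz a ->
  (amalgam_norm r s (locop a f) <= C%:E * amalgam_norm p q a * amalgam_norm r s f)%E.

Let G0 := \int[mu]_t g t.
Let kap := kappa g.

Let G0_gt0 : 0 < G0.
Proof. exact: (Rintegral_g_gt0 mg g0 gB wd0 g_half). Qed.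

Let kap_gt0 : 0 < kap.
Proof. exact: (kappa_gt0 mg g0 gB wd0 g_half). Qed.

Let integrable_g : mu.-integrable setT (EFin \o g).
Proof.
apply: (@integrable_le_indic _ _ _ _ _ (box 0 1) Bg) => //.
- exact: measurable_box.
- exact: lebesgue_rV_box_fin.
- by move=> t; rewrite ger0_norm.
Qed.

Lemma cube_norm_locop K L b c M : (0 < K)%N -> (0 < L)%N -> (forall l, `|b l| <= 1) ->
  0 <= M -> (cube_norm r (test_fun g K L%:R c) 0 <= M%:E)%E ->
  (cube_norm r (locop (test_symbol g K L%:R b) (test_fun g K L%:R c)) 0 <=
   (C * (Bg ^+ 2 * K%:R `^ fine (q^-1)%E) * M)%:E)%E.
Proof.
move=> K0 L0 b1 M0 fM; apply: (le_trans (cube_norm_le_amalgam _ _ _ hs)).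
apply: (le_trans (hbound (schwartz_test_fun smg g0 gB K L c) (schwartz_test_symbol smg g0 gB K L b))).
have amalgam_ge0 m (p' q' : \bar R) (f : 'rV[R]_m -> R[i]) : (1 <= q')%E -> (0 <= amalgam_norm p' q' f)%E.
  by move=> q1; apply: le_trans (cube_norm_le_amalgam p' f 0 q1); exact: cube_norm_ge0.
rewrite !EFinM; apply: lee_pmul => //.
- by apply: mule_ge0; [rewrite lee_fin ltW|exact: amalgam_ge0].
- exact: amalgam_ge0.
- rewrite -EFinM; apply: lee_pmul; rewrite ?lee_fin ?(ltW hC)//; first exact: amalgam_ge0.
  by rewrite -card_powE//; exact: (amalgam_norm_test_symbol (ltW Bg0) g0 gB).
- exact: (amalgam_norm_test_fun g0 gB).
Qed.

(** [L] depends on [K] alone: exceeding [X] it brings the off-diagonal error below kap/16, exceeding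
    [Y] it brings the Parseval error below G0/2, and L >= 2 is the range of the decay estimate.
    Uniformity in [b] and [c] leaves the coefficients free. *)
Lemma exists_frequency K : exists2 L : nat, (0 < L)%N &
  [/\ 1 <= L%:R :> R, K%:R ^+ 2 * (Lg * 3 ^+ d) / L%:R <= G0 / 2 &
   forall b c t, (forall l, `|b l| <= 1) -> (forall k, `|c k| <= 1) -> g t != 0 ->
    kap * modc (trig K (fun l => b l * c l) (2 * pi * L%:R * t ord0 ord0)) <=
    modc (locop (test_symbol g K L%:R b) (test_fun g K L%:R c) t) + kap / 16].
Proof.
have [Kd Kd0 HKd] := loc_integral_decay mg mp1 mp2 (ltW Bg0) B10 B20 Lg0 L10 g0 gB p1B p2B lipg lip1.
pose X := K%:R ^+ 2 * Kd / (kap / 16); pose Y := K%:R ^+ 2 * (Lg * 3 ^+ d) / (G0 / 2).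
have X0 : 0 <= X by apply: divr_ge0; [rewrite mulr_ge0 ?sqr_ge0|rewrite divr_ge0// ltW].
have Y0 : 0 <= Y.
  by apply: divr_ge0; [rewrite mulr_ge0 ?sqr_ge0// mulr_ge0 ?exprn_ge0|rewrite divr_ge0// ltW].
have XY2 : 0 <= X + Y + 2 by rewrite !addr_ge0.
pose L := Num.bound (X + Y + 2).
have HL : X + Y + 2 < L%:R by exact: archi_boundP.
have L2 : 2 <= L%:R :> R by lra.
have L0 : 0 < L%:R :> R by lra.
exists L; first by rewrite -(ltr0n R).
have XL : K%:R ^+ 2 * Kd / L%:R <= kap / 16.
  rewrite ler_pdivrMr// [leRHS]mulrC -ler_pdivrMr ?divr_gt0//; rewrite -/X; lra.
split; first by lra.
  rewrite ler_pdivrMr// [leRHS]mulrC -ler_pdivrMr ?divr_gt0//; rewrite -/Y; lra.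
move=> b c t b1 c1 gt; apply: le_trans (localization_op_lower mg mp1 mp2 (ltW Bg0) B10 g0 gB
  p1B p2B K wd0 g_half p1_half p2_half cos_half Kd0 HKd L2 b1 c1 gt) _.
by rewrite lerD2l.
Qed.

Lemma Rintegral_g_trig_sqr_ge K c (L N : R) : 1 <= L -> (forall k, `|c k| <= 1) ->
  K%:R ^+ 2 * (Lg * 3 ^+ d) / L <= G0 / 2 -> 1 <= N -> N <= \sum_(k < K) c k ^+ 2 ->
  N / 2 * G0 <= \int[mu]_t (g t * modc (trig K c (2 * pi * L * t ord0 ord0)) ^+ 2).
Proof.
move=> LR c1 errL N1 Nc.
have := Rintegral_g_trig_sqr mg Lg0 g0 gB lipg K LR c1.
rewrite ler_norml => /andP[+ _]; rewrite -/G0 lerBrDr => H.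
apply: le_trans H; rewrite addrC.
have GN : N * G0 <= (\sum_(k < K) c k ^+ 2) * G0 by rewrite ler_wpM2r// ltW.
have G0N : G0 <= N * G0 by rewrite ler_peMl// ltW.
apply: le_trans (lerB GN errL); rewrite lerBrDr.
rewrite (_ : N * G0 = N / 2 * G0 + N * G0 / 2); last by field.
by rewrite lerD2l ler_wpM2r.
Qed.

Let measurable_mod K c (a : R) :
  measurable_fun setT (fun t => modc (trig K c (a * t ord0 ord0))).
Proof. exact: measurable_modc_trig. Qed.

(** Explains the choice of kap/16 as error: it is an eighth of kap/2, and (1/8)^rho <= 1/8. *)
Let c1_G0 rho : 1 <= rho -> (kap / 16) `^ rho <= (kap / 2) `^ rho / 8.
Proof.
move=> rho1; rewrite (_ : kap / 16 = kap / 2 * (1 / 8)); last by field.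
rewrite powRM ?divr_ge0 ?(ltW kap_gt0)//.
    apply: ler_wpM2l; first exact: powR_ge0.
rewrite -[leRHS]mul1r; apply: le_trans (ge1r_powR _ rho1) _ => //; lra.
Qed.

(* r < 2: a peaked function is spread out by a symbol with Rudin-Shapiro signs *)
Lemma necessary_condition_lt2 (rho : R) : r = rho%:E -> rho < 2 ->
  rho^-1 - 1 / 2 <= fine (q^-1)%E.
Proof.
move=> rE rho2; have rho1 : 1 <= rho by move: hr; rewrite rE lee_fin.
have rho0 : 0 < rho by lra.
set qi := fine (q^-1)%E.
have c1p : 0 < (kap / 2) `^ rho by rewrite powR_gt0// divr_gt0.
(* Both sides are raised to the power rho: N^(rho/2) is the growth of the spread-out output, and
   N^(rho qi + rho - 1) that of the bound. *)
suff : rho / 2 <= rho * qi + (rho - 1).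
  move=> H; rewrite -(ler_pM2l rho0) mulrBr divff ?gt_eqF//; lra.
pose Kst := 8 * (Bg * ((C * Bg ^+ 2) `^ rho * (4 `^ (rho * qi) * ((Bg * 4) `^ (rho - 1) * (4 * G0))))) /
  ((kap / 2) `^ rho * G0).
apply: (@powR_pow2_le _ Kst) => m.
have [eps eps1] := rudin_shapiro R m.
have NE : 2 ^+ m = (2 ^ m)%N%:R :> R by rewrite natrX.
have : (0 < 2 ^ m)%N by rewrite expn_gt0.
move: (2 ^ m)%N NE => N NE N0; rewrite NE => epsB.
have NR : 1 <= N%:R :> R by rewrite ler1n.
have [L L0 [LR errL HL]] := exists_frequency (4 * N).
pose b := block N eps.
have eps_le l : `|eps l| <= 1.
  by rewrite -(ler_pXn2r (_ : 0 < 2)%N)// ?nnegrE// real_normK ?num_real// eps1 expr1n.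
have b1 l : `|b l| <= 1 by rewrite /b /block; case: ifP => // _; rewrite normr0.
have v1 k : `|vp R N k| <= 1 by rewrite ger0_norm ?vp_ge0// vp_le1.
pose V t := modc (trig (4 * N) (vp R N) (2 * pi * L%:R * t ord0 ord0)).
pose W t := modc (trig (4 * N) (fun l => b l * vp R N l) (2 * pi * L%:R * t ord0 ord0)).
have bv l : b l * vp R N l = b l.
  by rewrite /b /block; case: ifP => [/vp_eq1 ->|_]; rewrite ?mulr1 ?mul0r.
have W2 t : W t ^+ 2 <= 2 * N%:R.
  rewrite /W (_ : trig _ _ _ = trig (4 * N) b (2 * pi * L%:R * t ord0 ord0)); last first.
    by apply: eq_bigr => l _; rewrite bv.
  by rewrite trig_block modcM modcX modc_expi expr1n mul1r; exact: epsB.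
have W0 t : 0 <= W t by exact: modc_ge0.
have V0 t : 0 <= V t by exact: modc_ge0.
have VN t : V t <= (4 * N)%:R by exact: modc_trig_le.
have IW : N%:R / 2 * G0 <= \int[mu]_t (g t * W t ^+ 2).
  apply: Rintegral_g_trig_sqr_ge => // [l|]; first by rewrite bv.
  by apply: (@sum_sqr_ge _ N (fun k => b k * vp R N k)) => k kN; rewrite bv /b /block kN eps1.
have IV : \int[mu]_t (g t * V t) <= 4 * G0.
  exact: (Rintegral_g_vp mg (ltW Bg0) Lg0 g0 gB lipg N0 LR errL).
(* [Y] bounds the rho-th power of the norm of f by its supremum, at most 4 N Bg, to the power rho -
   1, times its L^1 norm, at most 4 G0. *)
pose Y := (Bg * 4 * N%:R) `^ (rho - 1) * (4 * G0).
have Y0 : 0 <= Y by rewrite mulr_ge0 ?powR_ge0// mulr_ge0// ltW.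
have fM : (cube_norm r (test_fun g (4 * N) L%:R (vp R N)) 0 <= (Y `^ rho^-1)%:E)%E.
  rewrite rE cube_norm_fin -poweR_EFin; apply: ler_poweR_nneg.
  - by rewrite invr_ge0 ltW.
  - by apply: integral_ge0 => t _; rewrite lee_fin powR_ge0.
  apply: (@le_trans _ _ (\int[mu]_t ((Bg * 4 * N%:R) `^ (rho - 1) * (g t * V t))%:E)%E).
    apply: ge0_le_integral_nomeas => t; rewrite lee_fin ?powR_ge0//.
    have -> : modc (test_fun g (4 * N) L%:R (vp R N) t) = g t * V t.
      by rewrite /test_fun modcM modc_real ger0_norm// mulrC.
    have gV0 : 0 <= g t * V t by rewrite mulr_ge0.
    rewrite unit_cube0; have [gt|gt] := eqVneq (g t) 0.
      by rewrite gt !mul0r mulr0 powR0 ?gt_eqF.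
    rewrite indicE mem_set ?mulr1; last exact: (weight_neq0_box g0 gB gt).
    rewrite -(mulr_powRB1 gV0 rho0) mulrC; apply: ler_wpM2r => //.
    apply: ge0_ler_powR; rewrite ?nnegrE//; first by lra.
      by rewrite !mulr_ge0// ltW.
    rewrite -mulrA; apply: ler_pM => //; last by rewrite -natrM.
    by apply: le_trans (gB t) _; rewrite indicE; case: (_ \in _); rewrite ?mulr1 ?mulr0// ltW.
  have iV : mu.-integrable setT (EFin \o (fun t => g t * V t)).
    apply: (integrable_g_bounded mg g0 gB (M := (4 * N)%:R)) => [|t]; first exact: measurable_mod.
    by rewrite ger0_norm.
  have iV' := integrableZl measurableT ((Bg * 4 * N%:R) `^ (rho - 1)) iV.
  rewrite -(fineK (integrable_fin_num measurableT iV')) lee_fin.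
  rewrite -[leLHS]/(\int[mu]_t ((Bg * 4 * N%:R) `^ (rho - 1) * (g t * V t))) RintegralZl//.
  by apply: ler_wpM2l => //; exact: powR_ge0.
have := cube_norm_locop (K := 4 * N) (c := vp R N) (b := b) _ L0 b1 (powR_ge0 _ _) fM.
rewrite muln_gt0 N0 => /(_ isT); set S := C * _ * _ => AS.
have S0 : 0 <= S.
  apply: mulr_ge0; last exact: powR_ge0.
  apply: mulr_ge0; [exact: ltW|].
  by apply: mulr_ge0; [exact: sqr_ge0|exact: powR_ge0].
(* Minorant of |A_a f|^rho on the support of [g]: [powR_half_sub] produces kap/2 and the error
   kap/16, and [sqrM_powR_le] is used with the Rudin-Shapiro bound 2N for W^2. *)
pose G t := (kap / 2) `^ rho * (W t ^+ 2 * (2 * N%:R) `^ (rho / 2 - 1)) - (kap / 16) `^ rho.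
have mG : measurable_fun setT G.
  apply: measurable_funB => //; apply: measurable_funM => //; apply: measurable_funM => //.
  by apply: measurable_funX; exact: measurable_mod.
have GA t : g t != 0 ->
    G t <= modc (locop (test_symbol g (4 * N) L%:R b) (test_fun g (4 * N) L%:R (vp R N)) t) `^ rho.
  move=> gt; have := HL b (vp R N) t b1 v1 gt; rewrite -/(W t) => H.
  apply: le_trans (powR_half_sub rho1 _ (modc_ge0 _) _ H).
  - rewrite lerD2r [X in _ <= X `^ _]mulrAC [leRHS]powRM ?divr_ge0 ?(ltW kap_gt0)//.
    apply: ler_wpM2l; first exact: powR_ge0.
    by apply: sqrM_powR_le => //; rewrite rho0/= ltW.
  - by rewrite mulr_ge0// ltW.
  - by rewrite divr_ge0// ltW.
pose MG := (kap / 2) `^ rho * (2 * N%:R * (2 * N%:R) `^ (rho / 2 - 1)) + (kap / 16) `^ rho.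
have GM t : `|G t| <= MG.
  apply: le_trans (ler_normB _ _) _; rewrite !ger0_norm ?powR_ge0// ?mulr_ge0 ?powR_ge0 ?sqr_ge0//.
  by rewrite lerD2r; apply: ler_wpM2l; rewrite ?powR_ge0//; apply: ler_wpM2r; rewrite ?powR_ge0.
have := Rintegral_le_cube_norm mg Bg0 g0 gB (or_introl rE) rho1 S0 mG GM GA AS.
have iW : mu.-integrable setT (EFin \o (fun t => g t * W t ^+ 2)).
  apply: (integrable_g_bounded mg g0 gB (M := 2 * N%:R)) => [|t].
    by apply: measurable_funX; exact: measurable_mod.
  by rewrite ger0_norm ?sqr_ge0.
have -> : \int[mu]_t (g t * G t) =
    (kap / 2) `^ rho * (2 * N%:R) `^ (rho / 2 - 1) * \int[mu]_t (g t * W t ^+ 2) -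
    (kap / 16) `^ rho * G0.
  rewrite -RintegralZl// -RintegralZl// -RintegralB//; last 2 first.
  - exact: (integrableZl measurableT _ iW).
  - exact: (integrableZl measurableT _ integrable_g).
  by apply: eq_Rintegral => t _; rewrite /G; ring.
have T1 : 2 * N%:R * (2 * N%:R) `^ (rho / 2 - 1) = (2 * N%:R) `^ (rho / 2) :> R.
  by rewrite mulr_powRB1// divr_gt0.
have N21 : 1 <= 2 * N%:R :> R by rewrite -natrM ler1n muln_gt0.
have T2 : 1 <= (2 * N%:R) `^ (rho / 2) :> R.
  by rewrite -[leLHS](powRr0 (2 * N%:R)); apply: ler_powR => //; rewrite divr_ge0// ltW.
move/(subr_main_le c1p G0_gt0 (powR_ge0 _ _) IW (c1_G0 rho1)); rewrite T1 => /(_ T2) main.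
have {}main : (kap / 2) `^ rho * G0 / 8 * N%:R `^ (rho / 2) <= Bg * S `^ rho.
  apply: le_trans main; apply: ler_wpM2l.
    by rewrite divr_ge0// mulr_ge0 ?powR_ge0// ltW.
  by apply: ge0_ler_powR; rewrite ?nnegrE ?divr_ge0 ?(ltW rho0)//; rewrite -natrM ler_nat leq_pmull.
have SE : S `^ rho = (C * Bg ^+ 2) `^ rho * (4 `^ (rho * qi) * ((Bg * 4) `^ (rho - 1) * (4 * G0)))
    * N%:R `^ (rho * qi + (rho - 1)).
  have CB : 0 <= C * Bg ^+ 2 by rewrite mulr_ge0 ?sqr_ge0// ltW.
  have B4 : 0 <= Bg * 4 by rewrite mulr_ge0// ltW.
  have P1 : 0 <= (4 * N%:R) `^ qi :> R by exact: powR_ge0.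
  rewrite /S (mulrA C) natrM powRM; [|exact: mulr_ge0|exact: powR_ge0].
  rewrite [(C * Bg ^+ 2 * _) `^ rho]powRM//.
  rewrite -[(Y `^ _) `^ _]powRrM mulVf ?gt_eqF// powRr1//.
  rewrite -[((4 * N%:R) `^ _) `^ _]powRrM -/qi (mulrC qi) [(4 * N%:R) `^ _]powRM//.
  rewrite /Y [(Bg * 4 * N%:R) `^ _]powRM// [N%:R `^ (rho * qi + _)]powRD; last first.
    by rewrite pnatr_eq0 -lt0n N0 implybT.
  by ring.
move: main; rewrite SE mulrAC ler_pdivrMr// -ler_pdivlMl ?mulr_gt0// => /le_trans; apply.
by rewrite /Kst le_eqVlt; apply/orP; left; apply/eqP; field; rewrite !gt_eqF.
Qed.

(* r > 2: a flat Rudin-Shapiro function is focused into a peak *)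
Lemma necessary_condition_ge2 (rho : R) : r = rho%:E \/ r = +oo%E -> 2 <= rho ->
  1 / 2 - rho^-1 <= fine (q^-1)%E.
Proof.
move=> rE rho2; have rho1 : 1 <= rho by lra.
have rho0 : 0 < rho by lra.
set qi := fine (q^-1)%E.
have c1p : 0 < (kap / 2) `^ rho by rewrite powR_gt0// divr_gt0.
(* Growth after raising to the power rho: lam^(rho-1) for the peak, lam^(rho qi + rho/2) for the
   bound. *)
suff : rho - 1 <= rho * qi + rho / 2.
  move=> H; rewrite -(ler_pM2l rho0) mulrBr divff ?gt_eqF//; lra.
pose Kst := Bg * ((C * Bg ^+ 2) `^ rho * (64 `^ (rho * qi) * (128 `^ (rho / 2) * Bg `^ rho))) /
  ((kap / 2) `^ rho * G0).
apply: (@powR_pow2_le _ Kst) => m.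
(* With lam = 2^m and N = 16 lam, the length is 4N = 2^(m+6). The choice of 16 makes the integral of
   g V^2, at least (N/2) G0 = 8 lam G0, twice the bound 4 lam G0 for lam times the integral of g
   V. *)
have [eps eps1] := rudin_shapiro R (m + 6).
have NE : 2 ^+ m = (2 ^ m)%N%:R :> R by rewrite natrX.
have : (0 < 2 ^ m)%N by rewrite expn_gt0.
rewrite expnD exprD NE (_ : 2 ^ m * 2 ^ 6 = 4 * (16 * 2 ^ m))%N; last by rewrite mulnC mulnA.
move: (2 ^ m)%N => l0 {NE} l00 epsB.
pose lam : R := l0%:R; rewrite -/lam in epsB *.
have lam1 : 1 <= lam by rewrite ler1n.
have lam0 : 0 < lam by exact: lt_le_trans lam1.
have N0 : (0 < 16 * l0)%N by rewrite muln_gt0.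
have NE : (16 * l0)%:R = 16 * lam :> R by rewrite natrM.
have N4E : (4 * (16 * l0))%:R = 64 * lam :> R by rewrite mulnA natrM.
move: (16 * l0)%N N0 NE N4E epsB => N N0 NE N4E epsB.
have NR : 1 <= N%:R :> R by rewrite ler1n.
have [L L0 [LR errL HL]] := exists_frequency (4 * N).
(* As eps^2 = 1, multiplying the flat coefficients [eps] by [b] yields exactly [vp N]. *)
pose b l := eps l * vp R N l.
have eps_le l : `|eps l| <= 1.
  by rewrite -(ler_pXn2r (_ : 0 < 2)%N)// ?nnegrE// real_normK ?num_real// eps1 expr1n.
have v1 k : `|vp R N k| <= 1 by rewrite ger0_norm ?vp_ge0// vp_le1.
have b1 l : `|b l| <= 1.
  by rewrite /b normrM -[leRHS]mulr1; apply: ler_pM.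
pose V t := modc (trig (4 * N) (vp R N) (2 * pi * L%:R * t ord0 ord0)).
have be theta : trig (4 * N) (fun l => b l * eps l) theta = trig (4 * N) (vp R N) theta.
  by apply: eq_bigr => l _; rewrite /b mulrAC -expr2 eps1 mul1r.
have V0 t : 0 <= V t by exact: modc_ge0.
have VN t : V t <= (4 * N)%:R by exact: modc_trig_le.
have IV2 : 8 * lam * G0 <= \int[mu]_t (g t * V t ^+ 2).
  rewrite (_ : 8 * lam = N%:R / 2); last by rewrite NE; field.
  apply: Rintegral_g_trig_sqr_ge => //.
  by apply: sum_sqr_ge => k kN; rewrite vp_eq1// expr1n.
have IV : \int[mu]_t (g t * V t) <= 4 * G0.
  exact: (Rintegral_g_vp mg (ltW Bg0) Lg0 g0 gB lipg N0 LR errL).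
pose Y := (128 * lam) `^ 2^-1.
have Y0 : 0 <= Y by exact: powR_ge0.
have fM : (cube_norm r (test_fun g (4 * N) L%:R eps) 0 <= (Y * Bg)%:E)%E.
  apply: (cube_norm_test_fun_flat (ltW Bg0) g0 gB) => // theta.
  rewrite /Y powR12_sqrt ?mulr_ge0 ?(ltW lam0)// -[leLHS]ger0_norm ?modc_ge0// -sqrtr_sqr.
  rewrite ler_sqrt ?mulr_ge0 ?(ltW lam0)//; apply: le_trans (epsB theta) _.
  by rewrite le_eqVlt; apply/orP; left; apply/eqP; ring.
have YB0 : 0 <= Y * Bg by rewrite mulr_ge0// ltW.
have := cube_norm_locop (K := 4 * N) (c := eps) (b := b) _ L0 b1 YB0 fM.
rewrite muln_gt0 N0 => /(_ isT); set S := C * _ * _ => AS.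
have S0 : 0 <= S.
  apply: mulr_ge0 => //.
  apply: mulr_ge0; [exact: ltW|].
  by apply: mulr_ge0; [exact: sqr_ge0|exact: powR_ge0].
(* Same scheme as for r < 2, with [powR_ge_quadratic] at threshold [lam], far below the height of
   the peak. *)
pose G t := (kap / 2) `^ rho * (lam `^ (rho - 2) * (V t ^+ 2 - lam * V t)) - (kap / 16) `^ rho.
have mV : measurable_fun setT V by exact: measurable_mod.
have mG : measurable_fun setT G.
  apply: measurable_funB => //; apply: measurable_funM => //; apply: measurable_funM => //.
  by apply: measurable_funB; [exact: measurable_funX|exact: measurable_funM].
have GA t : g t != 0 ->
    G t <= modc (locop (test_symbol g (4 * N) L%:R b) (test_fun g (4 * N) L%:R eps) t) `^ rho.
  move=> gt; have := HL b eps t b1 eps_le gt; rewrite be -/(V t) => H.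
  apply: le_trans (powR_half_sub rho1 _ (modc_ge0 _) _ H).
  - rewrite lerD2r [X in _ <= X `^ _]mulrAC [leRHS]powRM ?divr_ge0 ?(ltW kap_gt0)//.
    apply: ler_wpM2l; first exact: powR_ge0.
    exact: powR_ge_quadratic.
  - by rewrite mulr_ge0// ltW.
  - by rewrite divr_ge0// ltW.
pose MG := (kap / 2) `^ rho * (lam `^ (rho - 2) * ((4 * N)%:R ^+ 2 + lam * (4 * N)%:R)) + (kap / 16) `^ rho.
have GM t : `|G t| <= MG.
  apply: le_trans (ler_normB _ _) _; rewrite [X in _ + X]ger0_norm ?powR_ge0// lerD2r.
  rewrite normrM ger0_norm ?powR_ge0//; apply: ler_wpM2l; first exact: powR_ge0.
  rewrite normrM ger0_norm ?powR_ge0//; apply: ler_wpM2l; first exact: powR_ge0.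
  apply: le_trans (ler_normB _ _) _; rewrite !ger0_norm ?sqr_ge0 ?mulr_ge0 ?(ltW lam0)//.
  by apply: lerD; [rewrite lerXn2r ?nnegrE|rewrite ler_wpM2l// ltW].
have := Rintegral_le_cube_norm mg Bg0 g0 gB rE rho1 S0 mG GM GA AS.
have iV : mu.-integrable setT (EFin \o (fun t => g t * V t)).
  by apply: (integrable_g_bounded mg g0 gB (M := (4 * N)%:R)) => // t; rewrite ger0_norm.
have iV2 : mu.-integrable setT (EFin \o (fun t => g t * V t ^+ 2)).
  apply: (integrable_g_bounded mg g0 gB (M := (4 * N)%:R ^+ 2)) => [|t].
    exact: measurable_funX.
  by rewrite ger0_norm ?sqr_ge0// lerXn2r ?nnegrE.
have -> : \int[mu]_t (g t * G t) =
    (kap / 2) `^ rho * (lam `^ (rho - 2) *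
      (\int[mu]_t (g t * V t ^+ 2) - lam * \int[mu]_t (g t * V t))) - (kap / 16) `^ rho * G0.
  have ilV := integrableZl measurableT lam iV.
  have iD : mu.-integrable setT (EFin \o (fun t => g t * V t ^+ 2 - lam * (g t * V t))).
    exact: (integrableB measurableT iV2 ilV).
  have iTD := integrableZl measurableT (lam `^ (rho - 2)) iD.
  have icTD := integrableZl measurableT ((kap / 2) `^ rho) iTD.
  have ieg := integrableZl measurableT ((kap / 16) `^ rho) integrable_g.
  rewrite -(RintegralZl _ measurableT iV) -(RintegralB measurableT iV2 ilV).
  rewrite -(RintegralZl _ measurableT iD) -(RintegralZl _ measurableT iTD).
  rewrite -(RintegralZl _ measurableT integrable_g) -(RintegralB measurableT icTD ieg).
  by apply: eq_Rintegral => t _; rewrite /G; ring.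
have T1 : lam * lam `^ (rho - 2) = lam `^ (rho - 1).
  rewrite -[X in X * _](powRr1 (ltW lam0)) -powRD ?(gt_eqF lam0) ?implybT//.
  by congr (_ `^ _); ring.
have T2 : 1 <= lam `^ (rho - 1).
  by rewrite -[leLHS](powRr0 lam); apply: ler_powR => //; rewrite subr_ge0.
move/(subr_main_quadratic_le c1p G0_gt0 (powR_ge0 _ _) (ltW lam0) IV2 IV (c1_G0 rho1)).
rewrite T1 => /(_ T2) main.
have SE : S `^ rho = (C * Bg ^+ 2) `^ rho * (64 `^ (rho * qi) * (128 `^ (rho / 2) * Bg `^ rho))
    * lam `^ (rho * qi + rho / 2).
  have CB : 0 <= C * Bg ^+ 2 by rewrite mulr_ge0 ?sqr_ge0// ltW.
  have P1 : 0 <= (64 * lam) `^ qi by exact: powR_ge0.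
  rewrite /S (mulrA C) N4E powRM; [|exact: mulr_ge0|exact: YB0].
  rewrite [(C * Bg ^+ 2 * _) `^ rho]powRM// [(Y * Bg) `^ _]powRM ?(ltW Bg0)//.
  rewrite -[(Y `^ _)]powRrM -[((64 * lam) `^ _) `^ _]powRrM -/qi (mulrC qi) (mulrC 2^-1).
  rewrite [(64 * lam) `^ _]powRM ?(ltW lam0)// [(128 * lam) `^ _]powRM ?(ltW lam0)//.
  rewrite [lam `^ (rho * qi + _)]powRD; last by rewrite (gt_eqF lam0) implybT.
  by ring.
move: main; rewrite SE -ler_pdivlMl ?mulr_gt0// => /le_trans; apply.
by rewrite /Kst le_eqVlt; apply/orP; left; apply/eqP; field; rewrite !gt_eqF.
Qed.

End necessary_condition.

(** * Construction of the bump and choice of its width *)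

Section weight.
Variables (R : realType) (n : nat).
Implicit Types (u : 'rV[R]_n -> R).

Lemma continuous_half u : continuous u -> u 0 = 1 ->
  exists2 delta : R, 0 < delta & forall x : 'rV[R]_n, (forall i, `|x ord0 i| < delta) -> 1 / 2 <= u x.
Proof.
move=> cu u0; have : \forall x \near (0 : 'rV[R]_n), 1 / 2 < u x.
  by apply: (cvgr_gt _ (cu 0)); rewrite u0; lra.
move=> /nbhs_ballP[e e0 He]; exists e => // x xe; apply: ltW; apply: He.
by split=> // i j; rewrite (ord1 i) /ball/= mxE sub0r normrN.
Qed.

(** The bump is a shrunken copy of [u] itself, centred at (1/2, ..., 1/2) so as to fit in the unit
    cube when h is small; the factor (B + 1)/h brings the support within h of the centre. In the
    application [u] is the first window. *)
Lemma exists_weight u B (h : R) : smoothR u -> 0 <= B -> supported u B ->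
    (forall x, 0 <= u x) -> u 0 = 1 -> 0 < h ->
  exists g : 'rV[R]_n -> R, [/\ smoothR g, (forall x, 0 <= g x),
    (forall x, g x != 0 -> forall i, `|x ord0 i - 1 / 2| <= h) &
    exists a, exists2 w, 0 < w & forall x, box a w x -> 1 / 2 <= g x].
Proof.
move=> su B0 supu u_ge0 u0 h0; pose M := (B + 1) / h.
have M0 : 0 < M by rewrite divr_gt0// ltr_wpDl.
pose c : 'rV[R]_n := const_mx (1 / 2).
have [cu _] := su [::].
have [delta delta0 Hdelta] := continuous_half cu u0.
exists (fun x => u (M *: (x - c))); split=> // [|x /supu Hx i|].
- apply: smgen_smoothR; apply: (smgen_comp (h := fun x => M *: (x - c)) su); split.
    apply: continuous_rV => j; rewrite (_ : (fun x => _) = (fun x : 'rV[R]_n => M * (x ord0 j - 1 / 2))).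
      move=> x; apply: (@continuousM _ _ (cst M) (fun x : 'rV[R]_n => x ord0 j - 1 / 2)); first exact: cst_continuous.
      by apply: continuousB; [exact: coord_continuous|exact: cst_continuous].
    by apply/funext => x; rewrite !mxE.
  move=> i; exists M, i => x t; rewrite -addrA scalerDr scalerA.
  by rewrite mulrC.
- have := Hx i; rewrite !mxE normrM (gtr0_norm M0) -ler_pdivlMl// => /le_trans; apply.
  rewrite /M invf_div mulrAC ler_pdivrMr ?ltr_wpDl//.
  by rewrite ler_wpM2l ?(ltW h0)// lerDl.
- exists c; exists (delta / M); first by rewrite divr_gt0.
  move=> x Hx; apply: Hdelta => i; have := Hx i; rewrite !mxE => /andP[x1 x2].
  rewrite normrM (gtr0_norm M0) ger0_norm ?subr_ge0// -ltr_pdivlMl//.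
  by rewrite [ltRHS]mulrC ltrBlDl.
Qed.

End weight.

Section dotrV_bound.
Variables (R : realType) (n : nat).

Lemma cos_near_half : exists2 e : R, 0 < e & forall x, `|x| < e -> 1 / 2 <= cos x.
Proof.
have : \forall x \near (0 : R), 1 / 2 < cos x.
  by apply: (cvgr_gt _ (@continuous_cos R 0)); rewrite cos0; lra.
move=> /nbhs_ballP[e e0 He]; exists e => // x xe; apply: ltW; apply: He.
by rewrite /ball/= sub0r normrN.
Qed.

Lemma dotrV_diff_le (w t v : 'rV[R]_n) (a h : R) : 0 <= h ->
  (forall i, `|w ord0 i| <= 1) -> (forall i, `|t ord0 i - a| <= h) ->
  (forall i, `|v ord0 i - a| <= h) -> `|dotrV w t - dotrV w v| <= n%:R * (2 * h).
Proof.
move=> h0 w1 th vh; rewrite /dotrV -sumrB; apply: le_trans (ler_norm_sum _ _ _) _.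
apply: (@le_trans _ _ (\sum_(i < n) (2 * h))); last first.
  by rewrite sumr_const card_ord [leRHS]mulrC mulr_natr.
apply: ler_sum => i _; rewrite -mulrBr normrM -[leRHS]mul1r; apply: ler_pM => //.
rewrite (_ : _ - _ = (t ord0 i - a) - (v ord0 i - a)); last by ring.
by apply: le_trans (ler_normB _ _) _; rewrite mulrDl mul1r lerD.
Qed.

End dotrV_bound.

Section exponents.
Variable R : realType.

Lemma inve_fine (q : \bar R) : (1 <= q)%E -> (q^-1 = (fine q^-1)%:E)%E /\ (0 <= fine q^-1).
Proof.
case: q => [q||]// q1; rewrite lee_fin in q1.
by rewrite inver gt_eqF ?(lt_le_trans _ q1)//= invr_ge0 (le_trans _ q1).
Qed.

(* [fine (q^-1)] is [0] at [q = +oo] *)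
Lemma abse_inve_sub_half_le (r q : \bar R) : (1 <= r)%E -> (1 <= q)%E ->
  (forall rho, r = rho%:E -> rho < 2 -> rho^-1 - 1 / 2 <= fine (q^-1)%E) ->
  (forall rho, r = rho%:E \/ r = +oo%E -> 2 <= rho -> 1 / 2 - rho^-1 <= fine (q^-1)%E) ->
  (`| r^-1 - (1 / 2)%:E | <= q^-1)%E.
Proof.
move=> r1 q1; have [qE q0] := inve_fine q1; rewrite [leRHS]qE.
move: (fine _) q0 => z z0 lt2 ge2 {qE}.
case: r r1 lt2 ge2 => [rho||]// r1 lt2 ge2.
  rewrite lee_fin in r1; rewrite inver gt_eqF ?(lt_le_trans _ r1)// -EFinB lee_fin.
  have rho0 : 0 < rho by exact: lt_le_trans r1.
  have [l2|g2] := ltP rho 2.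
    rewrite ger0_norm; first exact: lt2.
    by rewrite subr_ge0 div1r lef_pV2 ?posrE// ltW.
  rewrite distrC ger0_norm; first by apply: ge2 => //; left.
  by rewrite subr_ge0 div1r lef_pV2 ?posrE.
rewrite invey sub0e abseN lee_fin ger0_norm//.
(* Case r = +oo: 1/2 - 1/rho is at most 1/q for each rho >= 2, and rho = max(2, 1/e) makes 1/rho at
   most e. *)
apply/ler_addgt0Pr => e e0.
have := ge2 (Num.max 2 e^-1) (or_intror erefl); rewrite le_max lexx => /(_ isT).
rewrite lerBlDr => /le_trans; apply; rewrite lerD2l.
have m0 : 0 < Num.max 2 e^-1 by rewrite lt_max ltr0n.
by rewrite -[leRHS]invrK lef_pV2 ?posrE ?invr_gt0// le_max lexx orbT.
Qed.

Lemma nonneg_complexE (z : R[i]) : 0 <= z -> z = (complex.Re z)%:C%C /\ 0 <= complex.Re z.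
Proof. by case: z => a b; rewrite lecE/= => /andP[/eqP -> a0]. Qed.

End exponents.

Theorem theorem5p3 (R : realType) (d : nat) (hd : (1 <= d)%N)
  (phi1 phi2 : 'rV[R]_d -> R[i])
  (hphi1 : smooth_compact_support phi1) (hphi2 : smooth_compact_support phi2)
  (phi1_0 : phi1 0 = 1) (phi2_0 : phi2 0 = 1)
  (phi1_ge0 : forall x, 0 <= phi1 x) (phi2_ge0 : forall x, 0 <= phi2 x)
  (p q r s : \bar R)
  (hp : (1 <= p)%E) (hq : (1 <= q)%E) (hr : (1 <= r)%E) (hs : (1 <= s)%E)
  (C : R) (hC : 0 < C)
  (hbound : forall (f : 'rV[R]_d -> R[i]) (a : 'rV[R]_(d + d) -> R[i]),
     schwartz f -> schwartz a ->
     (amalgam_norm r s (localization_op phi1 phi2 a f)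
      <= C%:E * amalgam_norm p q a * amalgam_norm r s f)%E) :
  (`| r^-1 - (1 / 2)%:E | <= q^-1)%E.
Proof.
case: d hd phi1 phi2 hphi1 hphi2 phi1_0 phi2_0 phi1_ge0 phi2_ge0 hbound => [//|n] _
  phi1 phi2 [[sm1 _] cs1] [[sm2 _] cs2] phi1_0 phi2_0 phi1_ge0 phi2_ge0 hbound.
(* In [R[i]], [0 <= z] forces the imaginary part of [z] to vanish, so both windows are real. *)
pose p1 x := complex.Re (phi1 x); pose p2 x := complex.Re (phi2 x).
have E1 : phi1 = (fun x => (p1 x)%:C%C).
  by apply/funext => x; have [] := nonneg_complexE (phi1_ge0 x).
have E2 : phi2 = (fun x => (p2 x)%:C%C).
  by apply/funext => x; have [] := nonneg_complexE (phi2_ge0 x).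
have p1_ge0 x : 0 <= p1 x by have [] := nonneg_complexE (phi1_ge0 x).
have p1_0 : p1 0 = 1 by rewrite /p1 phi1_0.
have p2_0 : p2 0 = 1 by rewrite /p2 phi2_0.
have supp (phi : 'rV[R]_n.+1 -> R[i]) : compact (closure [set x | phi x != 0]) ->
    exists2 B, 0 <= B & supported (fun x => complex.Re (phi x)) B.
  move=> /compact_supported[B B0 HB]; exists B => // x x0; apply: HB.
  by apply: contraNneq x0 => ->.
have [B B0 sup1] := supp _ cs1; have [B' _ sup2] := supp _ cs2.
have [cont1 _] := sm1 [::]; have [cont2 _] := sm2 [::].
have [d1 d10 H1] := continuous_half cont1 p1_0.
have [d2 d20 H2] := continuous_half cont2 p2_0.
have [e e0 He] := cos_near_half R.
pose D : R := 2 * pi * (n.+1%:R * 2).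
have D0 : 0 < D by rewrite !mulr_gt0 ?pi_gt0.
(* 1/4 keeps the support of [g] inside the unit cube; d1/4 and d2/4 make differences of its points,
   at most 2h, smaller than d1 and d2; e/(2D) makes differences of phases, at most D h, smaller than
   e. *)
pose h := Num.min (1 / 4) (Num.min (d1 / 4) (Num.min (d2 / 4) (e / (2 * D)))).
have D2 : 0 < 2 * D by rewrite mulr_gt0.
have h0 : 0 < h by rewrite !lt_min !divr_gt0.
have : h <= h by []. 
rewrite {2}/h !le_min => /and4P[h4 hd1 hd2 he].
have [g [smg g0 gsupp [a [w w0 g_half]]]] := exists_weight sm1 B0 sup1 p1_ge0 p1_0 h0.
have [contg _] := smg [::].
have gbox x : g x != 0 -> box 0 1 x.
  move=> gx i; have := gsupp x gx i; rewrite ler_norml mxE => /andP[? ?].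
  by apply/andP; split; lra.
have supg : supported g 1.
  move=> x gx i; have := gbox x gx i; rewrite mxE => /andP[? ?].
  by rewrite ger0_norm//; lra.
have [Bg Bg0 gB] := supported_bounded contg supg.
have [B1 B10 p1B] := supported_bounded cont1 sup1.
have [B2 B20 p2B] := supported_bounded cont2 sup2.
have [Lg Lg0 lipg] := smooth_supported_lipschitz ord0 smg supg.
have [L1 L10 lip1] := smooth_supported_lipschitz ord0 sm1 sup1.
(* [Bg + 1] replaces [Bg] to have a strictly positive bound, by which one may divide. *)
have gB1 x : g x <= (Bg + 1) * \1_(box 0 1) x.
  have [->|gx] := eqVneq (g x) 0; first by rewrite mulr_ge0 ?addr_ge0.
  rewrite indicE mem_set ?mulr1; last exact: gbox.
  by apply: le_trans (ler_norm _) (le_trans (gB x) _); rewrite lerDl.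
have Bg1 : 0 < Bg + 1 by rewrite ltr_wpDl.
have diff x v : g x != 0 -> g v != 0 -> forall i, `|(v - x) ord0 i| <= 2 * h.
  move=> gx gv i; rewrite !mxE (_ : _ - _ = (v ord0 i - 1 / 2) - (x ord0 i - 1 / 2)); last by ring.
  by apply: le_trans (ler_normB _ _) _; rewrite mulr_natl mulr2n lerD// gsupp.
have p1_half x v : g x != 0 -> g v != 0 -> 1 / 2 <= p1 (v - x).
  move=> gx gv; apply: H1 => i; apply: le_lt_trans (diff x v gx gv i) _; lra.
have p2_half x v : g x != 0 -> g v != 0 -> 1 / 2 <= p2 (v - x).
  move=> gx gv; apply: H2 => i; apply: le_lt_trans (diff x v gx gv i) _; lra.
have cos_half y t v : g y != 0 -> g t != 0 -> g v != 0 ->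
    1 / 2 <= cos (2 * pi * dotrV y t - 2 * pi * dotrV y v).
  move=> gy gt gv; apply: He; rewrite -mulrBr normrM ger0_norm; last by rewrite mulr_ge0 ?pi_ge0.
  apply: (@le_lt_trans _ _ (D * h)).
    rewrite /D -!mulrA; do 2 (apply: ler_wpM2l; rewrite ?pi_ge0//).
    exact: (dotrV_diff_le (ltW h0) (supg _ gy) (gsupp _ gt) (gsupp _ gv)).
  rewrite mulrC -ltr_pdivlMr//; apply: le_lt_trans he _.
  by rewrite ltr_pM2l// ltf_pV2 ?posrE// ltr_pMl// ltr1n.
rewrite E1 E2 in hbound.
have mg := continuous_measurable_rV contg.
have mp1 := continuous_measurable_rV cont1.
have mp2 := continuous_measurable_rV cont2.
apply: abse_inve_sub_half_le => // rho.
- exact: (necessary_condition_lt2 smg mg mp1 mp2 Bg1 B10 B20 Lg0 L10 g0 gB1 p1B p2B lipg lip1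
    w0 g_half p1_half p2_half cos_half hp hq hr hs hC hbound).
- exact: (necessary_condition_ge2 smg mg mp1 mp2 Bg1 B10 B20 Lg0 L10 g0 gB1 p1B p2B lipg lip1
    w0 g_half p1_half p2_half cos_half hp hq hr hs hC hbound).
Qed.
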